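(* Let $I=\{1,\dots,\kappa\}$, $\kappa\ge2$. Suppose that for each $i\in I$ there are a contractive invertible matrix $A_i\in\mathbb{R}^{2\times2}$ with $\|A_i\|\le\overline{\alpha}<1$ and a translation vector $a_i\in\mathbb{R}^2$. Assume further that for each $i\in I$ there are real numbers $u_i,v_i,w_i,z_i>0$ such that $$A_i=\begin{pmatrix}u_i&v_i\\ w_i&z_i\end{pmatrix}$$ and that the following two conditions hold. (X1) The intervals $[w_i/u_i,z_i/v_i]$, $i\in I$, are pairwise disjoint (with the convention $[x,y]=[y,x]$ if $x>y$). (X2) There is a subset $J=\{j_1<\dots<j_m\}\subset I$ with $m\ge2$ such that, putting $A^{(k)}=A_{j_k}$, $a^{(k)}=a_{j_k}$ and $$x_k=a^{(k)}+\sum_{n=0}^\infty A^{(k)}(A^{(1)})^na^{(1)},\qquad y_k=a^{(k)}+\sum_{n=0}^\infty A^{(k)}(A^{(m)})^na^{(m)}\qquad(1\le k\le m),$$ at least one of the following is satisfied: (a) the $m\times m$ matrix $M$ with $M_{kl}=1$ if $(x_k,y_k)\cap(x_l,y_l)$ is a single point and $M_{kl}=0$ otherwise is irreducible; (b) $x_k\prec x_{k+1}\prec y_k\prec y_{k+1}$ for all $k\in\{1,\dots,m-1\}$. Then the affine IFS $\Phi=\{A_i+a_i\}_{i\in I}$ is stably of Kakeya type, i.e. every affine IFS in some neighborhood of $\Phi$ is of Kakeya type. In particular, the Minkowski dimension of the invariant set is given by the zero of the topological pressure $P$, and it is continuous (as a function of the IFS) on a neighborhood of $\Phi$.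
   Context: For $x,y\in\mathbb{R}^2$: $[x,y]=\{\lambda x+(1-\lambda)y:0\le\lambda\le1\}$, $(x,y)=[x,y]\setminus\{x,y\}$. $\mathcal{Q}_2$ is the set of vectors in $\mathbb{R}^2$ with strictly positive coefficients, and $x\prec y$ means $y-x\in\mathcal{Q}_2$. A nonnegative $m\times m$ matrix $M$ is irreducible if for all $k,l$ there is $n>0$ with $(M^n)_{kl}>0$. Words: $I^*=\bigcup_{n\ge1}I^n$; for $\mathtt{i}=(i_1,\dots,i_n)\in I^n$ put $A_{\mathtt{i}}=A_{i_1}\cdots A_{i_n}$. Singular values: for a contractive invertible $A\in\mathbb{R}^{2\times2}$, $1>\|A\|=\alpha_1(A)\ge\alpha_2(A)>0$ are the square roots of the eigenvalues of $A^*A$ ($A^*$ the transpose), and $\theta_1(A),\theta_2(A)$ are corresponding normalized eigenvectors of $A^*A$. The singular value function is $\varphi^t(A)=\alpha_1(A)^t$ for $0\le t<1$, $\varphi^t(A)=\alpha_1(A)\alpha_2(A)^{t-1}$ for $1\le t<2$, and $\varphi^t(A)=|\det A|^{t/2}$ for $t\ge2$. The topological pressure is $P(t)=\lim_{n\to\infty}\frac1n\log\sum_{\mathtt{i}\in I^n}\varphi^t(A_{\mathtt{i}})$, $t\ge0$; the limit exists, $P$ is continuous and strictly decreasing, and it has a unique zero $t>0$. Affine IFS: a collection $\{A_i+a_i\}_{i\in I}$ of maps $x\mapsto A_ix+a_i$ of $\mathbb{R}^2$, with $A_i$ invertible, $\|A_i\|\le\overline{\alpha}<1$, $a_i\in\mathbb{R}^2$.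 Its invariant set is the unique nonempty compact $E$ with $E=\bigcup_{i\in I}(A_i+a_i)(E)$. IFSs with $\kappa$ maps are topologized as a subset of $(GL_2(\mathbb{R})\times\mathbb{R}^2)^\kappa$; neighborhoods refer to this topology. Cone: for $\theta\in S^1$ (the unit circle) and $0\le\beta\le\pi$, $X(\theta,\beta)=\{x\in\mathbb{R}^2: x\ne0,\ \cos(\beta/2)<|\theta\cdot x|/|x|\}$, with closure $\overline{X(\theta,\beta)}$. Kakeya type: the affine IFS $\{A_i+a_i\}_{i\in I}$, with invariant set $E$, is of Kakeya type if both of the following hold. (1) There exist $\theta\in S^1$ and $0<\beta<\pi/2$ such that $A_i(\overline{X(\theta,\beta)}\setminus\{0\})\subset X(\theta,\beta)$ and $A_i^*(\overline{X(\theta,\beta)}\setminus\{0\})\subset X(\theta,\beta)$ for all $i\in I$, and $A_i(\overline{X(\theta,\beta)})\cap A_j(\overline{X(\theta,\beta)})=\{0\}$ for $i\ne j$. (2) There is a constant $\varrho>0$ such that $\mathcal{L}^1(\{\theta_1(A_{\mathtt{i}})\cdot x: x\in E\})\ge\varrho$ for all $\mathtt{i}\in I^*$, where $\mathcal{L}^1$ is Lebesgue measure on $\mathbb{R}$. *)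

(* Defs.v *)
From HB Require Import structures.
From mathcomp Require Import all_boot all_order all_algebra.
From mathcomp Require Import all_classical all_reals all_analysis.

Set Implicit Arguments.
Unset Strict Implicit.
Unset Printing Implicit Defensive.

Import Order.TTheory GRing.Theory Num.Theory.
Import numFieldNormedType.Exports.

Local Open Scope classical_set_scope.
Local Open Scope ring_scope.

Section Plane.
Context {R : realType}.
Implicit Types (x y : 'cV[R]_2) (A : 'M[R]_2).

Definition dotp x y : R := \sum_(i < 2) x i 0 * y i 0.

(* The norm that the library puts on matrices is the sup norm; only its
   topology is used below. *)
Definition enorm x : R := Num.sqrt (dotp x x).

Definition opnorm A : R :=
  sup [set enorm (A *m x) | x in [set x | enorm x = 1]].

(* A^T A has one or two distinct eigenvalues, all real, so that the largest and
   the smallest one list its spectrum with multiplicity. *)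
Definition alpha1 A : R := Num.sqrt (sup [set l | eigenvalue (A^T *m A) l]).
Definition alpha2 A : R := Num.sqrt (inf [set l | eigenvalue (A^T *m A) l]).

(* theta_1(A) is determined up to sign when alpha2 A < alpha1 A. *)
Definition is_theta1 A (theta : 'cV[R]_2) : Prop :=
  enorm theta = 1 /\ (A^T *m A) *m theta = alpha1 A ^+ 2 *: theta.

Definition svf (t : R) A : R :=
  if t < 1 then alpha1 A `^ t
  else if t < 2 then alpha1 A * alpha2 A `^ (t - 1)
  else `|\det A| `^ (t / 2).

Definition segment x y : set 'cV[R]_2 :=
  [set lambda *: x + (1 - lambda) *: y | lambda in `[0, 1]%classic].
Definition open_segment x y : set 'cV[R]_2 :=
  segment x y `\` [set x; y].

Definition prec x y : Prop := forall i, 0 < (y - x) i 0.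

(* [x, y] with the convention [x, y] = [y, x]. *)
Definition interval_between (x y : R) : set R :=
  `[Num.min x y, Num.max x y]%classic.

Definition mx22 (u v w z : R) : 'M[R]_2 :=
  \matrix_(i < 2, j < 2) nth 0 (nth [::] [:: [:: u; v]; [:: w; z]] i) j.

Definition cone (theta : 'cV[R]_2) (beta : R) : set 'cV[R]_2 :=
  [set x | x != 0 /\ cos (beta / 2) < `|dotp theta x| / enorm x].

Definition irreducible_mx (m : nat) (M : 'M[R]_m.+1) : Prop :=
  (forall k l, 0 <= M k l) /\
  (forall k l, exists2 n : nat, (0 < n)%N & 0 < (M ^+ n) k l).

(* An infimum of natural numbers is attained; inf takes the default value 0 when
   E is unbounded, which does not occur for compact E. *)
Definition covering_number (E : set 'cV[R]_2) (r : R) : R :=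
  inf [set n%:R | n in [set n : nat | exists c : 'I_n -> 'cV[R]_2,
    E `<=` \bigcup_i [set x | enorm (x - c i) <= r]]].

Definition minkowski_ratio (E : set 'cV[R]_2) (r : R) : R :=
  ln (covering_number E r) / - ln r.
Definition has_minkowski_dim (E : set 'cV[R]_2) (s : R) : Prop :=
  minkowski_ratio E r @[r --> 0^'+] --> s.
Definition minkowski_dim (E : set 'cV[R]_2) : R :=
  lim (minkowski_ratio E r @[r --> 0^'+]).

End Plane.

(* The ambient space: invertibility and contraction are imposed separately, by
   is_affine_ifs, whose points carry the subspace topology. *)
Definition ifs_space (R : realType) (kappa : nat) :=
  {ptws 'I_kappa -> ('M[R]_2 * 'cV[R]_2)%type}.

Section IFS.
Context {R : realType} {kappa : nat}.
Implicit Types (A : 'I_kappa -> 'M[R]_2) (Phi : ifs_space R kappa).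

Definition lin_part Phi : 'I_kappa -> 'M[R]_2 := fun i => (Phi i).1.

Definition is_affine_ifs Phi : Prop :=
  exists2 abar : R, abar < 1 &
    forall i, lin_part Phi i \in unitmx /\ opnorm (lin_part Phi i) <= abar.

Definition affine_map Phi (i : 'I_kappa) (x : 'cV[R]_2) : 'cV[R]_2 :=
  (Phi i).1 *m x + (Phi i).2.

(* The set below is a singleton when Phi is an affine IFS; set0 is only the
   default of the choice operator. *)
Definition invariant_set Phi : set 'cV[R]_2 :=
  xget set0 [set E : set 'cV[R]_2 | [/\ E !=set0, compact E &
    E = \bigcup_i (affine_map Phi i @` E)]].

Definition word_mx A (w : seq 'I_kappa) : 'M[R]_2 := \prod_(i <- w) A i.

Definition pressure_seq A (t : R) (n : nat) : R :=
  n%:R^-1 * ln (\sum_(w : n.-tuple 'I_kappa) svf t (word_mx A w)).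

(* P(t) = p; stated as convergence because lim takes a default value on
   divergent sequences. *)
Definition is_pressure A (t p : R) : Prop := pressure_seq A t @ \oo --> p.

Definition is_pressure_zero A (t : R) : Prop :=
  0 < t /\ forall s, 0 <= s -> (is_pressure A s 0 <-> s = t).

Definition kakeya_cone A : Prop :=
  exists (theta : 'cV[R]_2) (beta : R),
    [/\ enorm theta = 1, 0 < beta < pi / 2,
        (forall i, mulmx (A i) @` (closure (cone theta beta) `\ 0)
           `<=` cone theta beta),
        (forall i, mulmx ((A i)^T) @` (closure (cone theta beta) `\ 0)
           `<=` cone theta beta) &
        forall i j, i != j ->
          (mulmx (A i) @` closure (cone theta beta)) `&`
          (mulmx (A j) @` closure (cone theta beta)) = [set 0]].

Definition kakeya_projections A (E : set 'cV[R]_2) : Prop :=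
  exists2 rho : R, 0 < rho &
    forall (w : seq 'I_kappa) (theta : 'cV[R]_2), w != [::] ->
      is_theta1 (word_mx A w) theta ->
      (rho%:E <= lebesgue_measure [set dotp theta x | x in E])%E.

Definition kakeya_type Phi : Prop :=
  kakeya_cone (lin_part Phi) /\
  kakeya_projections (lin_part Phi) (invariant_set Phi).

End IFS.

Section X2.
Context {R : realType} {m : nat}.
Implicit Types (A : 'I_m.+2 -> 'M[R]_2) (a : 'I_m.+2 -> 'cV[R]_2).

(* The subsystem has m + 2 maps, so ord0 and ord_max are its first and last
   index. *)
Definition pt_x A a (k : 'I_m.+2) : 'cV[R]_2 :=
  a k + limn (series (fun n => A k *m A ord0 ^+ n *m a ord0)).
Definition pt_y A a (k : 'I_m.+2) : 'cV[R]_2 :=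
  a k + limn (series (fun n => A k *m A ord_max ^+ n *m a ord_max)).

Definition crossing_mx A a : 'M[R]_m.+2 :=
  \matrix_(k, l)
    (`[< exists p, open_segment (pt_x A a k) (pt_y A a k) `&`
                   open_segment (pt_x A a l) (pt_y A a l) = [set p] >])%:R.

Definition staircase A a : Prop :=
  forall k l : 'I_m.+2, l = k.+1 :> nat ->
    [/\ prec (pt_x A a k) (pt_x A a l), prec (pt_x A a l) (pt_y A a k) &
        prec (pt_y A a k) (pt_y A a l)].

End X2.

(* Main.v *)
(* Let [N w] be the sum of the entries of [A_w] and [d w = |det A_w|]. The
   matrices are positive, so all entries of [A_w] are comparable to [N w] and
   [psi w = N w ^ (2 - t) * d w ^ (t - 1)], which is comparable to the singular
   value function for [1 <= t < 2], is multiplicative up to constants; hence there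
   is a [t] for which the level sums of [psi] stay between two positive constants,
   and it is the zero of the pressure. The disjoint cones give [t < 2], the
   projections of [E] give [1 <= t].

   Hypothesis (X2) is a finite system of strict inequalities between rational
   functions of the entries, and it makes the segments [Phi_k [p, q]], where [p]
   and [q] are the fixed points of the first and the last map of the subsystem,
   a chain: the projection of [[p, q]] is covered by those of the
   [Phi_k [p, q]]. Iterating, [E] projects onto intervals in every direction of
   the positive quadrant, with length bounded below.

   Stop words when [d w / N w], the width of [Phi_w E], drops below [r]. Covering
   each piece by about [N w / r] balls bounds the covering number above by
   [r ^ (- t)]. For the lower bound, given a cover by [n] balls choose for each
   stopped word about [N w / r] balls meeting [Phi_w E] with separated first
   coordinates. Two words splitting at [u] have directions at distance at least a
   constant times the width [d u / N u ^ 2] of the cone of [u], so they share at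
   most a multiple of [N u ^ 2 / d u] balls. Summing over the tree, where the
   widths of disjoint cones add up, the number of pairs of words through a common
   ball is at most the depth of the tree, of order [- ln r], times the number
   [S] of chosen balls, and Cauchy-Schwarz gives [n] at least a constant times
   [S / - ln r], a discrete form of Cordoba's argument. Finally [t] is continuous,
   since the level sums of close systems compare up to [expR (eps * n)]. *)

Require Import Defs.
From HB Require Import structures.
From mathcomp Require Import all_boot all_order all_algebra.
From mathcomp Require Import all_classical all_reals all_analysis.
From mathcomp Require Import measurable_realfun ring lra zify.

Set Implicit Arguments.
Unset Strict Implicit.
Unset Printing Implicit Defensive.

Import Order.TTheory GRing.Theory Num.Theory.
Import numFieldNormedType.Exports.

Local Open Scope classical_set_scope.
Local Open Scope ring_scope.

(** * Products of positive matrices *)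

(** No transfer operator is involved: the constants in the quasi-multiplicativity of [wpsi] are the
    same at every level, so [t] can be the supremum of the [s] in [[1, 2]] for which all level sums
    are at least 1. Sub- and supermultiplicativity then keep the level sums at [t] between 1 and
    [c^-1], which is stronger than vanishing pressure and is what the stopping-time sums need.

    The obstacle in the lower bound is that the pieces of [E] may overlap, since nothing separates
    the translations. Separation of directions takes over: two long thin strips of different slopes
    share only a short stretch. The price is the factor [1 - ln r], which is lost when logarithms
    are divided by [- ln r].

    The constants of neighbouring systems are not made uniform. Each system gets its own, and
    continuity compares exponential growth rates in the level [n], to which constant factors do not
    contribute. *)

Section Coordinates.
Context {R : realType}.
Implicit Types (M P : 'M[R]_2) (x y : 'cV[R]_2).

Lemma sum_ord2 (V : nmodType) (F : 'I_2 -> V) : \sum_(i < 2) F i = F 0 + F 1.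
Proof.
by rewrite big_ord_recl big_ord1; congr (_ + F _); apply/val_inj.
Qed.

Lemma ord2P (P : 'I_2 -> Prop) : P 0 -> P 1 -> forall i, P i.
Proof.
move=> P0 P1 [[|[|//]] lti].
- by rewrite (_ : Ordinal lti = 0) //; apply/val_inj.
- by rewrite (_ : Ordinal lti = 1) //; apply/val_inj.
Qed.

Lemma mulmx2E m (M : 'M[R]_2) (X : 'M[R]_(2, m)) i j :
  (M *m X) i j = M i 0 * X 0 j + M i 1 * X 1 j.
Proof. by rewrite mxE sum_ord2. Qed.

Lemma det2E M : \det M = M 0 0 * M 1 1 - M 0 1 * M 1 0.
Proof.
rewrite (expand_det_row _ 0) sum_ord2 /cofactor !det_mx11 !mxE /=.
rewrite expr0 expr1 mul1r.
have -> : lift 0 0 = 1 :> 'I_2 by apply/val_inj.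
have -> : lift 1 0 = 0 :> 'I_2 by apply/val_inj.
by rewrite mulN1r mulrN.
Qed.

Lemma dotpE x y : dotp x y = x 0 0 * y 0 0 + x 1 0 * y 1 0.
Proof. by rewrite /dotp sum_ord2. Qed.

Definition vec2 (a b : R) : 'cV[R]_2 := \col_i (if i == 0 then a else b).

Lemma vec2_0 (a b : R) : vec2 a b 0 0 = a. Proof. by rewrite mxE. Qed.

Lemma vec2_1 (a b : R) : vec2 a b 1 0 = b. Proof. by rewrite mxE. Qed.

Lemma colB x y i : (x - y) i 0 = x i 0 - y i 0. Proof. by rewrite !mxE. Qed.

Lemma col2P x y : x 0 0 = y 0 0 -> x 1 0 = y 1 0 -> x = y.
Proof. by move=> h0 h1; apply/colP; apply: ord2P. Qed.

(** On nonnegative matrices this is a norm that is linear in [M]. With [e = (1, 1)], [mrow M] and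
    [mcol M] are the coordinates of [M e] and [M^T e], so the sum of a product is an inner product
    ([mxsumM]). *)
Definition mxsum M : R := M 0 0 + M 0 1 + M 1 0 + M 1 1.
Definition mrow M k : R := M k 0 + M k 1.
Definition mcol M k : R := M 0 k + M 1 k.

Lemma mxsum_row M : mxsum M = mrow M 0 + mrow M 1.
Proof. by rewrite /mxsum /mrow addrA. Qed.

Lemma mxsum_col M : mxsum M = mcol M 0 + mcol M 1.
Proof. by rewrite /mxsum /mcol; ring. Qed.

Lemma mxsumM M P : mxsum (M * P) = mcol M 0 * mrow P 0 + mcol M 1 * mrow P 1.
Proof. by rewrite /mxsum /mcol /mrow -!mulmxE !mulmx2E; ring. Qed.

Lemma mrowM M P k : mrow (M * P) k = M k 0 * mrow P 0 + M k 1 * mrow P 1.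
Proof. by rewrite /mrow -!mulmxE !mulmx2E; ring. Qed.

Lemma mcolM M P k : mcol (M * P) k = mcol M 0 * P 0 k + mcol M 1 * P 1 k.
Proof. by rewrite /mcol -!mulmxE !mulmx2E; ring. Qed.

(** The witness makes sense for an empty type as well; it lies below each [f i] because [(f i)^-1]
    is one of the summands. *)
Lemma exists_lower_bound (T : finType) (f : T -> R) :
  (forall i, 0 < f i) -> exists2 c, 0 < c & forall i, c <= f i.
Proof.
move=> f_gt0; exists (1 + \sum_i (f i)^-1)^-1 => [|i].
  by rewrite invr_gt0 ltr_pwDl// sumr_ge0// => i _; rewrite invr_ge0 ltW.
rewrite -[leRHS]invrK lef_pV2 ?posrE ?invr_gt0//; last first.
  by rewrite ltr_pwDl// sumr_ge0// => j _; rewrite invr_ge0 ltW.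
rewrite (bigD1 i)//= addrCA lerDl addr_ge0// sumr_ge0// => j _.
by rewrite invr_ge0 ltW.
Qed.

Lemma det_le_mxsum M : (forall a b, 0 <= M a b) -> `|\det M| <= mxsum M ^+ 2.
Proof.
move=> M0; rewrite det2E /mxsum ler_norml.
have := (M0 0 0, M0 0 1, M0 1 0, M0 1 1) => -[[[]]].
move: (M 0 0) (M 0 1) (M 1 0) (M 1 1) => a b c d a0 b0 c0 d0.
by apply/andP; split; nra.
Qed.

End Coordinates.

Section Words.
Context {R : realType} {kappa : nat}.
Implicit Types (A : 'I_kappa -> 'M[R]_2) (u v w : seq 'I_kappa).

Lemma word_mx_nil A : word_mx A [::] = 1.
Proof. by rewrite /word_mx big_nil. Qed.

Lemma word_mx_cons A i w : word_mx A (i :: w) = A i * word_mx A w.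
Proof. by rewrite /word_mx big_cons. Qed.

Lemma word_mx_cat A u v : word_mx A (u ++ v) = word_mx A u * word_mx A v.
Proof. by rewrite /word_mx big_cat. Qed.

Lemma word_mx_rcons A w i : word_mx A (rcons w i) = word_mx A w * A i.
Proof. by rewrite -cats1 word_mx_cat word_mx_cons word_mx_nil mulr1. Qed.

Definition wdet A w : R := `|\det (word_mx A w)|.
Definition wsum A w : R := mxsum (word_mx A w).

Lemma wdet_nil A : wdet A [::] = 1.
Proof. by rewrite /wdet word_mx_nil det1 normr1. Qed.

Lemma wsum_nil A : wsum A [::] = 2.
Proof. by rewrite /wsum word_mx_nil /mxsum !mxE/= addr0 addr0. Qed.

Lemma wdet_cat A u v : wdet A (u ++ v) = wdet A u * wdet A v.
Proof. by rewrite /wdet word_mx_cat det_mulmx normrM. Qed.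

Lemma wdet_gt0 A w : (forall i, \det (A i) != 0) -> 0 < wdet A w.
Proof.
move=> detA; elim: w => [|i w IH]; first by rewrite wdet_nil.
by rewrite -cat1s wdet_cat mulr_gt0// /wdet /word_mx big_seq1 normr_gt0.
Qed.

Section Positive.
Context {A : 'I_kappa -> 'M[R]_2}.
Hypothesis Apos : forall i a b, 0 < A i a b.

Lemma word_mx_ge0 w a b : 0 <= word_mx A w a b.
Proof.
elim: w a b => [|i w IH] a b; first by rewrite word_mx_nil mxE ler0n.
rewrite word_mx_cons -mulmxE mulmx2E.
by rewrite addr_ge0// mulr_ge0// ?IH// ltW.
Qed.

Lemma word_mx_gt0 w a b : w != [::] -> 0 < word_mx A w a b.
Proof.
case: w => // i w _; elim: w i a b => [|j w IH] i a b.
  by rewrite /word_mx big_seq1.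
rewrite word_mx_cons -mulmxE mulmx2E.
by rewrite addr_gt0// mulr_gt0// IH.
Qed.

Lemma mrow_word_ge0 w k : 0 <= mrow (word_mx A w) k.
Proof. by rewrite addr_ge0 ?word_mx_ge0. Qed.

Lemma mcol_word_ge0 w k : 0 <= mcol (word_mx A w) k.
Proof. by rewrite addr_ge0 ?word_mx_ge0. Qed.

Lemma wsum_gt0 w : 0 < wsum A w.
Proof.
case: (eqVneq w [::]) => [->|w0]; first by rewrite wsum_nil.
by rewrite /wsum /mxsum !addr_gt0// word_mx_gt0.
Qed.

Lemma wdet_le w : wdet A w <= wsum A w ^+ 2.
Proof. by apply: det_le_mxsum => a b; exact: word_mx_ge0. Qed.

Lemma wsum_cat_le u v : wsum A (u ++ v) <= wsum A u * wsum A v.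
Proof.
rewrite /wsum word_mx_cat mxsumM (mxsum_col (word_mx A u)) (mxsum_row (word_mx A v)).
have := (mcol_word_ge0 u 0, mcol_word_ge0 u 1,
         mrow_word_ge0 v 0, mrow_word_ge0 v 1) => -[[[]]].
by move=> *; nra.
Qed.

(* A nonempty word starts and ends with a letter, whose entries are
   comparable. *)
Lemma word_balanced : exists2 c : R, 0 < c & forall w k,
  c * wsum A w <= mrow (word_mx A w) k /\ c * wsum A w <= mcol (word_mx A w) k.
Proof.
have sA i : 0 < mxsum (A i) by rewrite /mxsum !addr_gt0.
have [|c0 c00 hc0] := @exists_lower_bound R ('I_kappa * 'I_2 * 'I_2)%type
  (fun t => A t.1.1 t.1.2 t.2 / mxsum (A t.1.1)).
  by move=> t; rewrite divr_gt0.
have {}hc0 i a b : c0 * mxsum (A i) <= A i a b.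
  by have := hc0 (i, a, b); rewrite /= ler_pdivlMr.
(* The bound 1/2 is for the empty word: the identity has entry sum 2 and row and column sums 1. *)
pose c := Num.min c0 (1 / 2).
have cc0 : c <= c0 by rewrite ge_min lexx.
have chalf : c <= 1 / 2 by rewrite ge_min lexx orbT.
have c_gt0 : 0 < c by rewrite lt_min c00/=; lra.
have hc i a b : c * mxsum (A i) <= A i a b.
  by apply: le_trans (hc0 i a b); rewrite ler_pM2r.
have nil k : c * wsum A [::] <= mrow (word_mx A [::]) k /\
             c * wsum A [::] <= mcol (word_mx A [::]) k.
  rewrite wsum_nil word_mx_nil /mrow /mcol !mxE /=.
  by move: k; apply: ord2P; rewrite /= ?addr0 ?add0r; split; lra.
exists c => // w k; split.
(* The row sums of a product combine the row sums of its right factor with the entries of the left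
   one as weights, so the first letter is split off; for column sums it is the last letter. *)
- case: w => [|i w]; first by have [] := nil k.
  have le : wsum A (i :: w) <= mxsum (A i) * wsum A w.
    have := wsum_cat_le [:: i] w.
    by rewrite cat1s {2}/wsum word_mx_cons word_mx_nil mulr1.
  apply: le_trans (_ : c * (mxsum (A i) * wsum A w) <= _).
    by rewrite ler_pM2l.
  rewrite word_mx_cons mrowM /wsum (mxsum_row (word_mx A w)) mulrA mulrDr lerD//.
    by rewrite ler_wpM2r ?mrow_word_ge0 ?hc.
  by rewrite ler_wpM2r ?mrow_word_ge0 ?hc.
- case/lastP: w => [|w i]; first by have [] := nil k.
  have le : wsum A (rcons w i) <= wsum A w * mxsum (A i).
    have := wsum_cat_le w [:: i].
    by rewrite cats1 {3}/wsum word_mx_cons word_mx_nil mulr1.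
  apply: le_trans (_ : c * (wsum A w * mxsum (A i)) <= _).
    by rewrite ler_pM2l.
  rewrite word_mx_rcons mcolM /wsum (mxsum_col (word_mx A w)) mulrCA mulrDl lerD//.
    by rewrite ler_wpM2l ?mcol_word_ge0 ?hc.
  by rewrite ler_wpM2l ?mcol_word_ge0 ?hc.
Qed.

End Positive.
End Words.

(** * Cones of directions *)

Section Intervals.
Context {R : realType}.
Implicit Types (s L : R).

Lemma lebesgue_segment (a b : R) : a <= b ->
  lebesgue_measure `[a, b]%classic = (b - a)%:E.
Proof.
move=> ab; rewrite lebesgue_measure_itv /= lte_fin.
case: ltP => // ba; have -> : a = b by apply/eqP; rewrite eq_le ab.
by rewrite subrr.
Qed.

Lemma sum_disjoint_segments n (a b : 'I_n -> R) lo hi : lo <= hi ->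
  (forall i, [/\ lo <= a i, a i <= b i & b i <= hi]) ->
  (forall i j, i != j -> b i < a j \/ b j < a i) ->
  \sum_i (b i - a i) <= hi - lo.
Proof.
move=> lohi hab sep.
(* Empty sets extend the family to all naturals, the index type of [measure_bigsetU]. *)
pose F (k : nat) := if insub k is Some i then `[a i, b i]%classic else set0.
have FE (i : 'I_n) : F i = `[a i, b i]%classic by rewrite /F valK.
have mF k : measurable (F k).
  by rewrite /F; case: insubP => [i _ _|_]; [exact: measurable_itv|exact: measurable0].
have tF : trivIset setT F.
  move=> k l _ _ [x []]; rewrite /F.
  case: insubP => // i _ <-; case: insubP => // j _ <- /=.
  rewrite !in_itv/= => /andP[ai bi] /andP[aj bj].
  have [->//|/sep] := eqVneq i j.
  by case=> lt; exfalso; move: lt; apply/negP; rewrite -leNgt;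
    [exact: le_trans aj bi | exact: le_trans ai bj].
rewrite -lee_fin -(lebesgue_segment lohi).
have -> : (\sum_i (b i - a i))%:E =
          lebesgue_measure (\big[setU/set0]_(i < n) F i).
  rewrite measure_bigsetU// -sumEFin; apply: eq_bigr => i _.
  by rewrite FE; apply/esym/lebesgue_segment; have [] := hab i.
apply: le_measure; rewrite ?inE.
- by apply: bigsetU_measurable => i _; exact: mF.
- exact: measurable_itv.
rewrite -bigcup_mkord => x [k /= ltk]; rewrite -[k]/(val (Ordinal ltk)) FE /=.
have [lo_a _ b_hi] := hab (Ordinal ltk).
rewrite !in_itv/= => /andP[ax xb].
by rewrite (le_trans lo_a ax) (le_trans xb b_hi).
Qed.

Lemma segment_cover_le (T : eqType) (W : seq T) (a b : T -> R) s L :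
  0 <= L -> (forall w, a w <= b w) ->
  (forall x, s <= x <= s + L -> exists2 w, w \in W & a w <= x <= b w) ->
  L <= \sum_(w <- W) (b w - a w).
Proof.
move=> L0 ab cov.
case: W cov => [|w0 W'].
  by case/(_ s) => [|w]; rewrite ?lexx ?lerDl.
set W := w0 :: W' => cov.
pose F (k : nat) := `[a (nth w0 W k), b (nth w0 W k)]%classic.
have : (lebesgue_measure `[s, (s + L)%R]%classic <=
         \sum_(k < size W) lebesgue_measure (F k))%E.
  apply: content_subadditive.
  - by move=> k _; exact: measurable_itv.
  - exact: measurable_itv.
  - rewrite -bigcup_mkord => x /=; rewrite in_itv/= => /cov[w wW wx].
    exists (index w W); first by change (index w W < size W)%N; rewrite index_mem.
    by rewrite /F nth_index//= in_itv.
have -> : (\sum_(k < size W) lebesgue_measure (F k) =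
          (\sum_(w <- W) (b w - a w))%R%:E)%E.
  rewrite (big_nth w0) big_mkord -sumEFin; apply: eq_bigr => k _.
  by rewrite /F lebesgue_segment.
by rewrite lebesgue_segment ?lerDl// addrAC subrr add0r lee_fin.
Qed.

End Intervals.

Section Projective.
Context {R : realType} {kappa : nat}.
Implicit Types (u v w : seq 'I_kappa).

(** The determinant of column [k] of [A i] and column [l] of [A j]. Its sign tells which column is
    steeper; it is bilinear in the columns, so a sign common to all [k], [l] passes to the images of
    all nonnegative vectors. *)
Definition cross (A : 'I_kappa -> 'M[R]_2) i j k l : R :=
  A i 0 k * A j 1 l - A i 1 k * A j 0 l.

Definition cone_separated (A : 'I_kappa -> 'M[R]_2) : Prop := forall i j, i != j ->
  (forall k l, 0 < cross A i j k l) \/ (forall k l, cross A i j k l < 0).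

Context {A : 'I_kappa -> 'M[R]_2}.
Hypothesis Apos : forall i a b, 0 < A i a b.
Hypothesis detA : forall i, \det (A i) != 0.
Hypothesis sepA : cone_separated A.

Let detW w : \det (word_mx A w) != 0.
Proof. by have := wdet_gt0 w detA; rewrite normr_gt0. Qed.

Lemma mcol_word_gt0 w k : 0 < mcol (word_mx A w) k.
Proof.
have [->|w0] := eqVneq w [::]; last by rewrite addr_gt0 ?word_mx_gt0.
rewrite word_mx_nil /mcol !mxE; move: k.
by apply: ord2P; rewrite /= ?addr0 ?add0r ltr01.
Qed.

(* The length of the interval of directions [x 1 / (x 0 + x 1)] of the image of
   the positive quadrant under [word_mx A w]. *)
Definition wlen w : R :=
  wdet A w / (mcol (word_mx A w) 0 * mcol (word_mx A w) 1).

Let tau w k := word_mx A w 1 k / mcol (word_mx A w) k.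

(** The columns of [word_mx A w] span the image of the quadrant, and [tau w k] is the direction of
    column [k]. *)
Lemma wlen_tau w : wlen w = Num.max (tau w 0) (tau w 1) - Num.min (tau w 0) (tau w 1).
Proof.
have c0 := mcol_word_gt0 w 0; have c1 := mcol_word_gt0 w 1.
have -> : wlen w = `|tau w 0 - tau w 1|.
  rewrite -normrN /wlen /wdet -[X in _ / X]gtr0_norm ?mulr_gt0// -normf_div.
  congr `| _ |; rewrite /tau det2E /mcol; move: c0 c1; rewrite /mcol.
  move=> c0 c1; field.
  by rewrite !gt_eqF.
by case: (leP (tau w 0) (tau w 1)) => le;
  [rewrite ler0_norm ?opprB ?subr_le0 | rewrite gtr0_norm ?subr_gt0].
Qed.

Lemma wlen_gt0 w : 0 < wlen w.
Proof. by rewrite divr_gt0 ?wdet_gt0// mulr_gt0 ?mcol_word_gt0. Qed.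

(** A matrix acts on directions by a monotone map. The intervals of the children therefore lie in
    that of [w] and are disjoint because those of the letters are. *)
Lemma sum_wlen w : \sum_i wlen (rcons w i) <= wlen w.
Proof.
under eq_bigr do rewrite wlen_tau.
rewrite wlen_tau; apply: sum_disjoint_segments.
- by rewrite le_max ge_min lexx.
- move=> i.
  (* The direction of a column of the child is a weighted mean of the directions of the two columns
     of the parent. *)
  have conv k : Num.min (tau w 0) (tau w 1) <= tau (rcons w i) k <= Num.max (tau w 0) (tau w 1).
    have c0 := mcol_word_gt0 w 0; have c1 := mcol_word_gt0 w 1.
    have E (t : 'I_2) : word_mx A w 1 t = tau w t * mcol (word_mx A w) t.
      by rewrite /tau divfK// gt_eqF ?mcol_word_gt0.
    have := Apos i 0 k; have := Apos i 1 k; set a0 := A i 0 k; set a1 := A i 1 k.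
    move=> a1_gt0 a0_gt0.
    have cw : 0 < mcol (word_mx A w) 0 * a0 + mcol (word_mx A w) 1 * a1.
      by rewrite addr_gt0// mulr_gt0.
    have -> : tau (rcons w i) k =
        (tau w 0 * mcol (word_mx A w) 0 * a0 + tau w 1 * mcol (word_mx A w) 1 * a1) /
        (mcol (word_mx A w) 0 * a0 + mcol (word_mx A w) 1 * a1).
      by rewrite -!E /tau word_mx_rcons mcolM -mulmxE mulmx2E.
    move: c0 c1 cw; move: (tau w 0) (tau w 1) (mcol _ 0) (mcol _ 1).
    move=> t0 t1 C0 C1 c0 c1 cw.
    rewrite ler_pdivlMr// ler_pdivrMr// 2!mulrDr -!mulrA.
    have h0 : 0 <= C0 * a0 by rewrite mulr_ge0// ltW.
    have h1 : 0 <= C1 * a1 by rewrite mulr_ge0// ltW.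
    apply/andP; split; apply: lerD; apply: ler_wpM2r => //.
    + by rewrite ge_min lexx.
    + by rewrite ge_min lexx orbT.
    + by rewrite le_max lexx.
    + by rewrite le_max lexx orbT.
  split.
  + by rewrite le_min; have /andP[-> _] := conv 0; have /andP[-> _] := conv 1.
  + by rewrite le_max ge_min lexx.
  + by rewrite ge_max; have /andP[_ ->] := conv 0; have /andP[_ ->] := conv 1.
- move=> i j neq.
  (* Hence the children are ordered like the letters, in reverse when the determinant of the parent
     is negative. *)
  have E k l : tau (rcons w j) l - tau (rcons w i) k =
      \det (word_mx A w) * cross A i j k l /
      (mcol (word_mx A (rcons w i)) k * mcol (word_mx A (rcons w j)) l).
    have ci := mcol_word_gt0 (rcons w i) k; have cj := mcol_word_gt0 (rcons w j) l.
    move: ci cj; rewrite /tau !word_mx_rcons !mcolM -!mulmxE !mulmx2E det2E /cross /mcol.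
    by move=> ci cj; field; rewrite !gt_eqF.
  have [pos|neg] : (forall k l, 0 < \det (word_mx A w) * cross A i j k l) \/
                   (forall k l, \det (word_mx A w) * cross A i j k l < 0).
    have [s|s] := sepA neq; have := detW w; rewrite neq_lt => /orP[d|d].
    * by right => k l; rewrite nmulr_rlt0.
    * by left => k l; rewrite mulr_gt0.
    * by left => k l; rewrite nmulr_rgt0.
    * by right => k l; rewrite pmulr_rlt0.
  + left; have lt k l : tau (rcons w i) k < tau (rcons w j) l.
      by rewrite -subr_gt0 E divr_gt0// mulr_gt0 ?mcol_word_gt0.
    by rewrite gt_max !lt_min !lt.
  + right; have lt k l : tau (rcons w j) l < tau (rcons w i) k.
      by rewrite -subr_lt0 E pmulr_llt0// invr_gt0 mulr_gt0 ?mcol_word_gt0.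
    by rewrite gt_max !lt_min !lt.
Qed.

Lemma cross_gap : exists2 g : R, 0 < g & forall i j, i != j ->
  forall k l, g <= `|cross A i j k l|.
Proof.
(* The value 1 fills the diagonal, where [cross] may vanish. *)
have [|g g0 hg] := @exists_lower_bound R ('I_kappa * 'I_kappa * ('I_2 * 'I_2))%type
  (fun t => if t.1.1 == t.1.2 then 1 else `|cross A t.1.1 t.1.2 t.2.1 t.2.2|).
  move=> [[i j] [k l]] /=; case: eqVneq => // /sepA[] s; rewrite normr_gt0.
    by rewrite gt_eqF.
  by rewrite lt_eqF.
exists g => // i j /negbTE neq k l.
by have := hg ((i, j), (k, l)); rewrite /= neq.
Qed.

End Projective.

(** * Stopping words *)

Section TupleSums.
Context {I : finType} {R : realType}.
Implicit Types (f : seq I -> R).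

Lemma sum_tuple0 f : \sum_(t : 0.-tuple I) f t = f [::].
Proof.
rewrite (bigD1 [tuple])//= big1 ?addr0// => t /eqP; case.
by rewrite tuple0.
Qed.

Lemma sum_tupleS n f :
  \sum_(t : n.+1.-tuple I) f t = \sum_i \sum_(t : n.-tuple I) f (i :: t).
Proof.
rewrite pair_big /= (reindex (fun p : I * n.-tuple I => [tuple of p.1 :: p.2])) //=.
exists (fun t : n.+1.-tuple I => (thead t, [tuple of behead t])) => [[i t] _|t _] /=.
  by congr (_, _); apply/val_inj.
by rewrite [RHS]tuple_eta; apply/val_inj.
Qed.

Lemma sum_tuple_cat n m f :
  \sum_(t : (n + m).-tuple I) f t =
  \sum_(s : n.-tuple I) \sum_(t : m.-tuple I) f (s ++ t).
Proof.
elim: n f => [|n IH] f.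
  by rewrite (sum_tuple0 (fun s => \sum_(t : m.-tuple I) f (s ++ t))).
rewrite addSn sum_tupleS (sum_tupleS _ (fun s => \sum_(t : m.-tuple I) f (s ++ t))).
by apply: eq_bigr => i _; exact: (IH (fun s => f (i :: s))).
Qed.

Lemma sum_const_seq (T : Type) (W : seq T) (c : R) :
  \sum_(w <- W) c = (size W)%:R * c.
Proof.
by rewrite big_const_seq count_predT iter_addr_0 mulr_natl.
Qed.

(** Cauchy-Schwarz for the square roots of [a w] and [b w], by induction so that no roots occur. *)
Lemma size_sqr_le (T : eqType) (W : seq T) (a b : T -> R) :
  (forall w, w \in W -> [/\ 0 < a w, 0 < b w & 1 <= a w * b w]) ->
  (size W)%:R ^+ 2 <= (\sum_(w <- W) a w) * (\sum_(w <- W) b w).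
Proof.
elim: W => [|w W IH] h; first by rewrite !big_nil mul0r expr0n.
rewrite !big_cons /=.
have hW v : v \in W -> [/\ 0 < a v, 0 < b v & 1 <= a v * b v].
  by move=> vW; apply: h; rewrite inE vW orbT.
have {}IH := IH hW.
have [a0 b0 ab] := h w (mem_head _ _).
have sa : 0 <= \sum_(v <- W) a v.
  by rewrite big_seq sumr_ge0// => v /hW[/ltW].
have sb : 0 <= \sum_(v <- W) b v.
  by rewrite big_seq sumr_ge0// => v /hW[_ /ltW].
move: IH sa sb; rewrite -natr1; move: (\sum_(v <- W) a v) (\sum_(v <- W) b v).
move: (size W)%:R (ler0n R (size W)) => s s0 x y IH x0 y0.
(* Arithmetic-geometric mean: the product of the two terms is at least [s ^+ 2]. *)
have le2 : 2 * s <= a w * y + b w * x.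
  have h1 : s ^+ 2 <= (a w * y) * (b w * x).
    rewrite (_ : _ * _ = (a w * b w) * (x * y)); last by ring.
    by apply: le_trans IH _; rewrite ler_peMl ?mulr_ge0.
  have p0 : 0 <= a w * y by rewrite mulr_ge0// ltW.
  have q0 : 0 <= b w * x by rewrite mulr_ge0// ltW.
  move: p0 q0 h1; move: (a w * y) (b w * x) => p q p0 q0 h1.
  rewrite -ler_sqr ?nnegrE ?mulr_ge0 ?addr_ge0//.
  by have := sqr_ge0 (p - q); nra.
nra.
Qed.

End TupleSums.

Section StoppingTree.
Context {R : realType} {kappa : nat}.
Implicit Types (u v w : seq 'I_kappa) (f g : seq 'I_kappa -> R).

(** [n] is fuel, which makes the recursion structural. Once every word of length [n] has [f] at most
    [r], exhausted fuel no longer shows: all leaves below the root satisfy the stopping condition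
    ([stop_le]). *)
Fixpoint stop_words f (r : R) n u : seq (seq 'I_kappa) :=
  if n is n'.+1 then
    if f u <= r then [:: u]
    else flatten [seq stop_words f r n' (rcons u i) | i <- enum 'I_kappa]
  else [:: u].

Context {f : seq 'I_kappa -> R} {r : R}.
Local Notation stop := (stop_words f r).

Lemma sum_flatten_enum (T : Type) (V : nmodType) (F : 'I_kappa -> seq T) (g : T -> V) :
  \sum_(w <- flatten [seq F i | i <- enum 'I_kappa]) g w =
  \sum_i \sum_(w <- F i) g w.
Proof. by rewrite big_flatten big_map big_enum. Qed.

Lemma stop_prefix n u w : w \in stop n u -> exists v, w = u ++ v.
Proof.
elim: n u => [|n IH] u /=; first by rewrite inE => /eqP->; exists [::]; rewrite cats0.
case: ifP => _; first by rewrite inE => /eqP->; exists [::]; rewrite cats0.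
by case/flatten_mapP => i _ /IH[v ->]; exists (i :: v); rewrite cat_rcons.
Qed.

Lemma stop_child n u i : f u > r -> {subset stop n (rcons u i) <= stop n.+1 u}.
Proof.
move=> fu w wi /=; rewrite leNgt fu; apply/flatten_mapP.
by exists i => //; rewrite mem_enum.
Qed.

Lemma stop_sum_le g : (forall u, \sum_i g (rcons u i) <= g u) ->
  forall n u, \sum_(w <- stop n u) g w <= g u.
Proof.
move=> hg; elim=> [|n IH] u /=; first by rewrite big_seq1.
case: ifP => _; first by rewrite big_seq1.
by rewrite sum_flatten_enum; apply: le_trans (hg u); apply: ler_sum => i _; exact: IH.
Qed.

(** Below a stopped word the remaining levels cost at most the factor [B], however many they are. So
    a sum over leaves of different lengths compares with a sum over a single level. *)
Lemma stop_level_le g B :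
  (forall n u, \sum_(v : n.-tuple 'I_kappa) g (u ++ v) <= B * g u) ->
  forall n u, \sum_(v : n.-tuple 'I_kappa) g (u ++ v) <= B * \sum_(w <- stop n u) g w.
Proof.
move=> hg; elim=> [|n IH] u /=; first by rewrite big_seq1; exact: (hg 0).
case: ifP => _; first by rewrite big_seq1; exact: hg.
rewrite sum_flatten_enum (sum_tupleS _ (fun v => g (u ++ v))) mulr_sumr.
apply: ler_sum => i _; have := IH (rcons u i).
by under eq_bigr do rewrite cat_rcons.
Qed.

Lemma stop_level_ge g b :
  (forall n u, b * g u <= \sum_(v : n.-tuple 'I_kappa) g (u ++ v)) ->
  forall n u, b * \sum_(w <- stop n u) g w <= \sum_(v : n.-tuple 'I_kappa) g (u ++ v).
Proof.
move=> hg; elim=> [|n IH] u /=; first by rewrite big_seq1; exact: (hg 0).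
case: ifP => _; first by rewrite big_seq1; exact: hg.
rewrite sum_flatten_enum (sum_tupleS _ (fun v => g (u ++ v))) mulr_sumr.
apply: ler_sum => i _; have := IH (rcons u i).
by under [X in _ <= X -> _]eq_bigr do rewrite cat_rcons.
Qed.

Lemma stop_le n u : (forall v, size v = (size u + n)%N -> f v <= r) ->
  forall w, w \in stop n u -> f w <= r.
Proof.
elim: n u => [|n IH] u h w /=.
  by rewrite inE => /eqP->; apply: h; rewrite addn0.
case: ifP => fu; first by rewrite inE => /eqP->.
case/flatten_mapP => i _; apply: IH => v sv; apply: h.
by rewrite sv size_rcons addSnnS.
Qed.

(** A leaf other than the root has a parent with [f] above [r], and one more letter loses at most
    the factor [d]. *)
Lemma stop_ge (d : R) : 0 <= d -> (forall u i, d * f u <= f (rcons u i)) ->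
  forall n u, d * r <= f u -> forall w, w \in stop n u -> d * r <= f w.
Proof.
move=> d0 hd; elim=> [|n IH] u h w /=; first by rewrite inE => /eqP->.
case: ifP => fu; first by rewrite inE => /eqP->.
case/flatten_mapP => i _; apply: IH; apply: le_trans (hd u i).
by rewrite ler_wpM2l// ltW// ltNge fu.
Qed.

(** Follow one branch along which [P] is inherited down to its leaf. With [P] saying that a given
    point lies in the piece of the word, this shows that the stopped pieces cover [E]. *)
Lemma stop_ex (P : seq 'I_kappa -> Prop) :
  (forall u, P u -> exists i, P (rcons u i)) ->
  forall n u, P u -> exists2 w, w \in stop n u & P w.
Proof.
move=> hP; elim=> [|n IH] u Pu /=; first by exists u; rewrite ?mem_head.
case: ifP => fu; first by exists u; rewrite ?mem_head.
have [i /IH[w wi Pw]] := hP u Pu; exists w => //.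
by apply/flatten_mapP; exists i => //; rewrite mem_enum.
Qed.

Section Correlation.
Context {T : finType} {B : seq 'I_kappa -> {set T}} {J : seq 'I_kappa -> R}.
Context {W : seq (seq 'I_kappa)} {C D : R}.
Hypotheses (C0 : 0 <= C) (D0 : 0 < D).
Hypothesis Jgt0 : forall u, 0 < J u.
Hypothesis J_super : forall u, \sum_i J (rcons u i) <= J u.
Hypothesis J_card : forall w, w \in W -> 1 <= D * J w * #|B w|%:R.
Hypothesis cross_card : forall u i j v v', i != j ->
  rcons u i ++ v \in W -> rcons u j ++ v' \in W ->
  #|B (rcons u i ++ v) :&: B (rcons u j ++ v')|%:R * J u <= C.

(** The multiplicity of [x]; its second moment counts pairs of words by their common elements. *)
Let F (s : seq (seq 'I_kappa)) x : R := \sum_(w <- s) (x \in B w)%:R.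

Let F_card s s' : \sum_x F s x * F s' x =
  \sum_(w <- s) \sum_(w' <- s') #|B w :&: B w'|%:R.
Proof.
rewrite /F; under eq_bigr do rewrite mulr_suml.
rewrite exchange_big /=; apply: eq_bigr => w _.
under eq_bigr do rewrite mulr_sumr.
rewrite exchange_big /=; apply: eq_bigr => w' _.
rewrite -sum1_card natr_sum [RHS]big_mkcond /=; apply: eq_bigr => x _.
by rewrite inE; case: (x \in B w); case: (x \in B w'); rewrite ?mul1r ?mul0r.
Qed.

(* Pairs splitting exactly at [u] contribute at most
   [(C / J u) * (number of words below u)^2], and by Cauchy-Schwarz
   the square is at most [(sum #|B w|) * (sum D * J w)], where the last sum is at
   most [D * J u]: each level of the tree costs [C * D * sum #|B w|]. *)
Lemma correlation_le n u : {subset stop n u <= W} ->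
  \sum_x (\sum_(w <- stop n u) (x \in B w)%:R : R) ^+ 2 <=
  (1 + C * D * n%:R) * \sum_(w <- stop n u) #|B w|%:R.
Proof.
rewrite -/(F _ _); under eq_bigr do rewrite expr2.
rewrite F_card.
have one v : \sum_(w <- [:: v]) \sum_(w' <- [:: v]) #|B w :&: B w'|%:R =
    \sum_(w <- [:: v]) #|B w|%:R :> R.
  by rewrite !big_seq1 finset.setIid.
have card0 s : 0 <= \sum_(w <- s) #|B w|%:R :> R.
  by rewrite sumr_ge0// => w _; rewrite ler0n.
have CD0 : 0 <= C * D by rewrite mulr_ge0// ltW.
elim: n u => [|n IH] u; first by rewrite /= one mulr0 addr0 mul1r.
case: (leP (f u) r) => fu sub.
  by rewrite /= fu one ler_peMl// lerDl mulr_ge0.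
have subi i : {subset stop n (rcons u i) <= W}.
  by move=> w wi; apply: sub; exact: stop_child wi.
set Wu := stop n.+1 u; set S := \sum_(w <- Wu) #|B w|%:R.
have WuE : Wu = flatten [seq stop n (rcons u i) | i <- enum 'I_kappa].
  by rewrite /Wu /= leNgt fu.
have SE : S = \sum_i \sum_(w <- stop n (rcons u i)) #|B w|%:R.
  by rewrite /S WuE sum_flatten_enum.
have sizeE : (size Wu)%:R = \sum_i (size (stop n (rcons u i)))%:R :> R.
  by rewrite WuE size_flatten /shape -map_comp sumnE big_map big_enum natr_sum.
have -> : \sum_(w <- Wu) \sum_(w' <- Wu) #|B w :&: B w'|%:R =
   \sum_i \sum_j \sum_(w <- stop n (rcons u i)) \sum_(w' <- stop n (rcons u j))
     #|B w :&: B w'|%:R :> R.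
  rewrite WuE sum_flatten_enum; apply: eq_bigr => i _.
  by under eq_bigr do rewrite sum_flatten_enum; rewrite exchange_big.
have size2 : (size Wu)%:R ^+ 2 <= D * J u * S.
  have h2 := @size_sqr_le R _ Wu (fun w => #|B w|%:R) (fun w => D * J w).
  apply: le_trans (h2 _) _ => [w wWu|].
    have h := J_card (sub _ wWu).
    have DJ : 0 < D * J w by rewrite mulr_gt0.
    split=> //; last by rewrite mulrC.
    by rewrite -(pmulr_rgt0 _ DJ) (lt_le_trans _ h).
  rewrite mulrC -mulr_sumr.
  rewrite ler_wpM2r//; apply: ler_wpM2l; [exact: ltW|exact: stop_sum_le].
(* The first term is for pairs inside one child, by induction; the second is for pairs from
   different children. *)
apply: le_trans (_ : (1 + C * D * n%:R) * S + C / J u * (size Wu)%:R ^+ 2 <= _); last first.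
  have -> : (1 + C * D * n.+1%:R) * S = (1 + C * D * n%:R) * S + C * D * S.
    by rewrite -natr1; ring.
  rewrite lerD2l.
  apply: le_trans (_ : C / J u * (D * J u * S) <= _).
    by rewrite ler_wpM2l// divr_ge0// ltW.
  rewrite le_eqVlt; apply/orP; left; apply/eqP; field.
  by rewrite gt_eqF.
rewrite expr2 {1}sizeE mulr_suml mulr_sumr {1}SE mulr_sumr -big_split /=.
apply: ler_sum => i _; rewrite (bigD1 i)//=; apply: lerD; first exact: IH.
(* The square of the size also counts the pairs with [j = i]; these are nonnegative and dropped. *)
rewrite sizeE mulr_sumr mulr_sumr [leRHS](bigD1 i)//= ler_wpDl//.
  by rewrite !mulr_ge0 ?invr_ge0 ?ler0n// ltW.
apply: ler_sum => j ji.
rewrite !big_seq.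
apply: le_trans (_ : \sum_(w <- stop n (rcons u i) | w \in stop n (rcons u i))
   \sum_(w' <- stop n (rcons u j)) C / J u <= _).
  apply: ler_sum => w wi; rewrite big_seq [leRHS]big_seq; apply: ler_sum => w' wj.
  have wW := subi _ _ wi; have wW' := subi _ _ wj.
  have [v wE] := stop_prefix wi; have [v' wE'] := stop_prefix wj.
  rewrite ler_pdivlMr//; move: wW wW'; rewrite wE wE'; apply: cross_card.
  by rewrite eq_sym.
rewrite -big_seq sum_const_seq sum_const_seq le_eqVlt; apply/orP; left; apply/eqP.
by ring.
Qed.

End Correlation.
End StoppingTree.

(** * Level sums and the exponent t *)

Section LevelSums.
Context {R : realType} {kappa : nat}.
Implicit Types (u v w : seq 'I_kappa) (s t : R).

(* For [1 <= s <= 2] this is comparable to the singular value function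
   [alpha1 ^ (2 - s) * |det| ^ (s - 1)]. *)
Definition wpsi (A : 'I_kappa -> 'M[R]_2) s w : R :=
  expR ((2 - s) * ln (wsum A w) + (s - 1) * ln (wdet A w)).

Definition level_sum A s n : R := \sum_(w : n.-tuple 'I_kappa) wpsi A s w.

Lemma geometric_small (x e : R) : 0 <= x -> x < 1 -> 0 < e -> exists n, x ^+ n < e.
Proof.
move=> x0 x1 e0.
have : x ^+ n @[n --> \oo] --> 0 by apply: cvg_expr; rewrite ger0_norm.
move/cvgr0Pnorm_lt => /(_ _ e0)[N _ /(_ N (leqnn N))].
by rewrite /= ger0_norm ?exprn_ge0// => h; exists N.
Qed.

Context {A : 'I_kappa -> 'M[R]_2} {c lam : R}.
Hypothesis kappa_gt0 : (0 < kappa)%N.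
Hypothesis Apos : forall i a b, 0 < A i a b.
Hypothesis detA : forall i, \det (A i) != 0.
Hypothesis c_gt0 : 0 < c.
Hypothesis balanced : forall w k,
  c * wsum A w <= mrow (word_mx A w) k /\ c * wsum A w <= mcol (word_mx A w) k.

Lemma balanced_le_half : c <= 1 / 2.
Proof.
have [h0 _] := balanced [::] 0; have [h1 _] := balanced [::] 1.
have := mxsum_row (word_mx A [::]); rewrite -/(wsum A [::]) => E.
by move: h0 h1 E; rewrite wsum_nil; lra.
Qed.

(** By balance each column sum of [u] is at least [c * wsum A u], and the row sums of [v] add up to
    [wsum A v]. *)
Lemma wsum_cat_ge u v : c * (wsum A u * wsum A v) <= wsum A (u ++ v).
Proof.
rewrite {3}/wsum word_mx_cat mxsumM mulrA {2}/wsum mxsum_row mulrDr.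
by apply: lerD; rewrite ler_wpM2r ?mrow_word_ge0//; have [] := balanced u 0;
  have [] := balanced u 1.
Qed.

Let sum_gt0 := wsum_gt0 Apos.
Let det_gt0 w := wdet_gt0 w detA.

Lemma wpsi_gt0 s w : 0 < wpsi A s w. Proof. exact: expR_gt0. Qed.

Lemma wpsi_cat_le s u v : s <= 2 -> wpsi A s (u ++ v) <= wpsi A s u * wpsi A s v.
Proof.
move=> s2; rewrite /wpsi -expRD ler_expR wdet_cat lnM ?posrE//.
have le : ln (wsum A (u ++ v)) <= ln (wsum A u) + ln (wsum A v).
  by rewrite -lnM ?posrE// ler_ln ?posrE ?mulr_gt0// wsum_cat_le.
have : (2 - s) * ln (wsum A (u ++ v)) <= (2 - s) * (ln (wsum A u) + ln (wsum A v)).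
  by rewrite ler_wpM2l// subr_ge0.
lra.
Qed.

(** The computation loses [c ^ (2 - s)], which is at least [c] because [c <= 1] and [s >= 1]. *)
Lemma wpsi_cat_ge s u v : 1 <= s <= 2 ->
  c * (wpsi A s u * wpsi A s v) <= wpsi A s (u ++ v).
Proof.
move=> /andP[s1 s2]; rewrite -[c in leLHS]lnK ?posrE// /wpsi -!expRD ler_expR.
rewrite wdet_cat lnM ?posrE//.
have le : ln c + (ln (wsum A u) + ln (wsum A v)) <= ln (wsum A (u ++ v)).
  rewrite -!lnM ?posrE ?mulr_gt0// ler_ln ?posrE ?mulr_gt0//.
  exact: wsum_cat_ge.
have := ler_wpM2l (_ : 0 <= 2 - s) le; rewrite subr_ge0 => /(_ s2).
have lnc : ln c <= 0 by apply: ln_le0; have := balanced_le_half; lra.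
have := mulr_ge0_le0 (_ : 0 <= s - 1) lnc; rewrite subr_ge0 => /(_ s1).
lra.
Qed.

Lemma level_sum_gt0 s n : 0 < level_sum A s n.
Proof.
rewrite /level_sum (bigD1 [tuple of nseq n (Ordinal kappa_gt0)])//=.
by rewrite ltr_pwDl ?wpsi_gt0// sumr_ge0// => i _; rewrite ltW ?wpsi_gt0.
Qed.

Lemma level_sum_add_le s n m : s <= 2 ->
  level_sum A s (n + m) <= level_sum A s n * level_sum A s m.
Proof.
move=> s2; rewrite /level_sum (sum_tuple_cat _ _ (wpsi A s)) mulr_suml.
apply: ler_sum => u _; rewrite mulr_sumr.
by apply: ler_sum => v _; exact: wpsi_cat_le.
Qed.

Lemma level_sum_add_ge s n m : 1 <= s <= 2 ->
  c * (level_sum A s n * level_sum A s m) <= level_sum A s (n + m).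
Proof.
move=> s12; rewrite /level_sum (sum_tuple_cat _ _ (wpsi A s)) mulr_suml mulr_sumr.
apply: ler_sum => u _; rewrite mulr_sumr mulr_sumr.
by apply: ler_sum => v _; exact: wpsi_cat_ge.
Qed.

Lemma level_sum_mul_le s n k : s <= 2 ->
  level_sum A s (n * k.+1) <= level_sum A s n ^+ k.+1.
Proof.
move=> s2; elim: k => [|k IH]; first by rewrite muln1 expr1.
rewrite mulnS exprS; apply: le_trans (level_sum_add_le _ _ s2) _.
by rewrite ler_wpM2l// ltW ?level_sum_gt0.
Qed.

Lemma level_sum_mul_ge s n k : 1 <= s <= 2 ->
  (c * level_sum A s n) ^+ k.+1 <= c * level_sum A s (n * k.+1).
Proof.
move=> s12; elim: k => [|k IH]; first by rewrite muln1 expr1.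
have S0 := level_sum_gt0 s n.
rewrite mulnS exprS; apply: le_trans (_ : c * level_sum A s n *
   (c * level_sum A s (n * k.+1)) <= _).
  by rewrite ler_wpM2l// mulr_ge0// ltW.
rewrite -mulrA ler_wpM2l ?(ltW c_gt0)//.
by apply: le_trans (level_sum_add_ge _ _ s12); rewrite mulrCA.
Qed.

(** Raising the exponent costs a power of [wdet A w / wsum A w], a quantity comparable to the
    smaller singular value. All comparisons between exponents rest on this. *)
Lemma wpsi_shift s t w :
  wpsi A t w = wpsi A s w * expR ((t - s) * ln (wdet A w / wsum A w)).
Proof.
by rewrite /wpsi -expRD ln_div ?posrE//; congr expR; ring.
Qed.

Lemma whgt_gt0 w : 0 < wdet A w / wsum A w.
Proof. by rewrite divr_gt0. Qed.

Lemma whgt_le w : wdet A w / wsum A w <= wsum A w.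
Proof. by rewrite ler_pdivrMr// -expr2; exact: wdet_le. Qed.

Lemma whgt_cat_ge u v :
  (wdet A u / wsum A u) * (wdet A v / wsum A v) <= wdet A (u ++ v) / wsum A (u ++ v).
Proof.
rewrite wdet_cat mulrACA -invfM ler_wpM2l ?mulr_ge0 ?(ltW (det_gt0 _))//.
by rewrite lef_pV2 ?posrE ?mulr_gt0// wsum_cat_le.
Qed.

Hypothesis lam_gt0 : 0 < lam.
Hypothesis lam_lt1 : lam < 1.
Hypothesis contr : forall w, wsum A w <= 2 * lam ^+ size w.

Lemma wpsi_shift_le s t w : s <= t ->
  wpsi A t w <= wpsi A s w * expR ((t - s) * ln (2 * lam ^+ size w)).
Proof.
move=> st; rewrite (wpsi_shift s) ler_pM2l ?wpsi_gt0// ler_expR.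
rewrite ler_wpM2l ?subr_ge0// ler_ln ?posrE ?whgt_gt0 ?mulr_gt0 ?exprn_gt0//.
exact: le_trans (whgt_le w) (contr w).
Qed.

Lemma level_sum_shift_le s t n : s <= t ->
  level_sum A t n <= level_sum A s n * expR ((t - s) * ln (2 * lam ^+ n)).
Proof.
move=> st; rewrite /level_sum mulr_suml; apply: ler_sum => w _.
by have := wpsi_shift_le w st; rewrite size_tuple.
Qed.

(** Continuity in the exponent at a fixed level: [L] depends on [n] alone, through the smallest
    height among finitely many words. *)
Lemma level_sum_shift_ge n : exists2 L : R, 0 <= L & forall s t, s <= t ->
  level_sum A s n <= level_sum A t n * expR ((t - s) * L).
Proof.
have [|m m0 hm] := @exists_lower_bound R _
    (fun w : n.-tuple 'I_kappa => wdet A (val w) / wsum A (val w)).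
  by move=> w; exact: whgt_gt0.
exists (Num.max 0 (- ln m)) => [|s t st]; first by rewrite le_max lexx.
rewrite /level_sum mulr_suml; apply: ler_sum => w _.
rewrite (wpsi_shift s t) -mulrA -expRD -[leLHS]mulr1 ler_pM2l ?wpsi_gt0//.
rewrite -[leLHS]expR0 ler_expR -mulrDr mulr_ge0 ?subr_ge0//.
have : ln m <= ln (wdet A w / wsum A w).
  by rewrite ler_ln ?posrE ?whgt_gt0//; exact: hm.
have : - ln m <= Num.max 0 (- ln m) by rewrite le_max lexx orbT.
lra.
Qed.

Hypothesis sepA : cone_separated A.

Lemma level_sum_wlen_le n u : \sum_(v : n.-tuple 'I_kappa) wlen (A := A) (u ++ v) <= wlen (A := A) u.
Proof.
elim: n u => [|n IH] u; first by rewrite (sum_tuple0 (fun v => wlen (u ++ v))) cats0.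
rewrite (sum_tupleS _ (fun v => wlen (u ++ v))).
apply: le_trans (sum_wlen Apos detA sepA u); apply: ler_sum => i _.
by under eq_bigr do rewrite -cat_rcons; exact: IH.
Qed.

Lemma wdet_le_wlen w : wdet A w <= wsum A w ^+ 2 * wlen (A := A) w.
Proof.
have c0 := mcol_word_gt0 Apos w 0; have c1 := mcol_word_gt0 Apos w 1.
rewrite /wlen mulrA ler_pdivlMr ?mulr_gt0// mulrC ler_wpM2r ?(ltW (det_gt0 w))//.
by rewrite /wsum mxsum_col; move: c0 c1; move: (mcol _ 0) (mcol _ 1) => a b *; nra.
Qed.

(** For [s = 2] the summand is [wdet A w], at most [wsum A w ^+ 2 * wlen w]. The first factor decays
    uniformly and the lengths of the disjoint cones add up to at most 1. *)
Lemma level_sum2_small : exists n, level_sum A 2 n < 1.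
Proof.
have l2 : lam ^+ 2 < 1 by rewrite exprn_ilt1// ltW.
(* The 1/4 compensates the factor 2 in [contr], which gets squared. *)
have [n hn] := geometric_small (sqr_ge0 lam) l2 (ltac:(lra) : 0 < 1 / 4 :> R).
exists n; apply: le_lt_trans (_ : _ <= \sum_(w : n.-tuple 'I_kappa)
    (2 * lam ^+ n) ^+ 2 * wlen (A := A) w) _.
  rewrite /level_sum; apply: ler_sum => w _; rewrite /wpsi subrr mul0r add0r.
  rewrite (_ : 2 - 1 = 1) ?mul1r ?lnK ?posrE//; last by ring.
  apply: le_trans (wdet_le_wlen w) _.
  apply: ler_wpM2r; first by rewrite ltW// wlen_gt0.
  have := contr w; rewrite size_tuple => h.
  by rewrite ler_pXn2r// nnegrE ?mulr_ge0 ?exprn_ge0// ltW.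
rewrite -mulr_sumr; have := level_sum_wlen_le n [::]; rewrite /= => h.
have l1 : wlen (A := A) [::] = 1.
  by rewrite /wlen wdet_nil word_mx_nil /mcol !mxE /= addr0 add0r mulr1 divr1.
rewrite l1 in h.
apply: le_lt_trans (_ : _ <= (2 * lam ^+ n) ^+ 2 * 1) _; first by rewrite ler_wpM2l// sqr_ge0.
by rewrite mulr1 exprMn -exprM mulnC exprM; lra.
Qed.

(** [t] is the supremum of the exponents whose level sums are all at least 1. The bound [c^-1] holds
    because a larger level sum would allow a slightly larger exponent. *)
Lemma exists_pressure_root (c1 : R) : 0 < c1 -> (forall n, c1 <= level_sum A 1 n) ->
  exists2 t, 1 <= t < 2 & forall n, 1 <= level_sum A t n <= c^-1.
Proof.
move=> c10 hc1.
have nil_ge1 s : s <= 2 -> 1 <= level_sum A s 0.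
  move=> s2; rewrite /level_sum (sum_tuple0 (wpsi A s)) /wpsi wsum_nil wdet_nil ln1.
  by rewrite mulr0 addr0 -[leLHS]expR0 ler_expR mulr_ge0 ?subr_ge0// ln_ge0// ler1n.
(* A level sum below 1 would, by submultiplicativity, force the sums along multiples of that level
   to 0, against [c1]. *)
have S1 n : 1 <= level_sum A 1 n.
  rewrite leNgt; apply/negP => lt1.
  have [k hk] := geometric_small (ltW (level_sum_gt0 1 n)) lt1 c10.
  have := hc1 (n * k.+1)%N; apply/negP; rewrite -ltNge.
  have le12 : 1 <= 2 :> R by rewrite ler1n.
  apply: le_lt_trans (level_sum_mul_le n k le12) _.
  apply: le_lt_trans hk; rewrite exprS ler_piMl ?exprn_ge0//.
    by rewrite ltW ?level_sum_gt0.
  exact: ltW.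
pose Z := [set s : R | 1 <= s <= 2 /\ forall n, 1 <= level_sum A s n].
have Z1 : Z 1 by split; rewrite ?lexx ?ler1n.
have supZ : has_sup Z.
  by split; [exists 1 | exists 2 => s [/andP[]]].
pose t := sup Z.
have t1 : 1 <= t by apply: ub_le_sup => //; case: supZ.
have t2 : t <= 2 by apply: ge_sup; [exists 1 | move=> s [/andP[]]].
(* The supremum is attained: at a single level the sum is continuous in the exponent. *)
have St n : 1 <= level_sum A t n.
  rewrite leNgt; apply/negP => lt1.
  have [L L0 hL] := level_sum_shift_ge n.
  have lnS : ln (level_sum A t n) < 0 by rewrite ln_lt0// level_sum_gt0.
  pose d := - ln (level_sum A t n) / (L + 1).
  have d0 : 0 < d by rewrite divr_gt0 ?oppr_gt0// ltr_wpDl.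
  have [s [s12 Ss] ts] := sup_adherent d0 supZ.
  have st : s <= t by apply: ub_le_sup => //; case: supZ.
  have := le_trans (Ss n) (hL _ _ st); apply/negP; rewrite -ltNge.
  rewrite -[level_sum A t n]lnK ?posrE ?level_sum_gt0// -expRD -[ltRHS]expR0 ltr_expR.
  have : (t - s) * L <= d * L by rewrite ler_wpM2r//; move: ts; rewrite -/t; lra.
  have : d * (L + 1) = - ln (level_sum A t n) by rewrite divfK// gt_eqF// ltr_wpDl.
  by move: d0; lra.
have tlt2 : t < 2.
  rewrite lt_neqAle t2 andbT; apply/eqP => t_eq.
  have [n] := level_sum2_small; rewrite -t_eq ltNge => /negP; exact.
exists t; first by rewrite t1.
move=> n; rewrite St /=.
rewrite -[leRHS]mul1r ler_pdivlMr// mulrC leNgt; apply/negP => gt1.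
(* At level 0 the sum is [2 ^ (2 - t)], at most 2, and [c] is at most 1/2. *)
case: n gt1 => [|n] gt1.
  move: gt1; apply/negP; rewrite -leNgt.
  rewrite /level_sum (sum_tuple0 (wpsi A t)) /wpsi wsum_nil wdet_nil ln1 mulr0 addr0.
  have le2 : expR ((2 - t) * ln 2) <= 2 :> R.
    rewrite -[leRHS]lnK ?posrE// ler_expR ler_piMl ?ln_ge0 ?ler1n//; lra.
  apply: le_trans (_ : 1 / 2 * 2 <= 1); last by lra.
  by rewrite ler_pM ?expR_ge0 ?(ltW c_gt0)// balanced_le_half.
have [L L0 hL] := level_sum_shift_ge n.+1.
have lnS : 0 < ln (c * level_sum A t n.+1) by rewrite ln_gt0.
have cS0 s : 0 < c * level_sum A s n.+1 by rewrite mulr_gt0 ?level_sum_gt0.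
(* The first bound keeps [t + d] in [[1, 2]], the second keeps [c] times the level sum above 1. As
   [t + d] exceeds the supremum, some other level sum drops below 1 there. *)
pose d := Num.min (2 - t) (ln (c * level_sum A t n.+1) / (L + 1)).
have L10 : 0 < L + 1 by rewrite ltr_wpDl.
have d0 : 0 < d by rewrite lt_min subr_gt0 tlt2 divr_gt0.
have s12 : 1 <= t + d <= 2.
  by rewrite -lerBrDl ge_min lexx andbT; move: d0 t1; lra.
have /andP[s1 s2] := s12.
have Ss : 1 < c * level_sum A (t + d) n.+1.
  have tt : t <= t + d by rewrite lerDl ltW.
  have h := hL _ _ tt; rewrite addrAC subrr add0r in h.
  rewrite -(ltr_pM2r (expR_gt0 (d * L))) mul1r -mulrA.
  apply: lt_le_trans (_ : _ < c * level_sum A t n.+1) _; last by rewrite ler_pM2l.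
  rewrite -[ltRHS]lnK ?posrE// ltr_expR.
  have : d <= ln (c * level_sum A t n.+1) / (L + 1) by rewrite ge_min lexx orbT.
  by rewrite ler_pdivlMr//; lra.
have nZ : ~ Z (t + d).
  move=> Zd; have : t + d <= t by apply: ub_le_sup => //; case: supZ.
  by rewrite -subr_ge0 opprD addNKr oppr_ge0 leNgt d0.
have [N SN] : exists N, level_sum A (t + d) N < 1.
  apply: contrapT => no; apply: nZ; split=> // m.
  by rewrite leNgt; apply/negP => lt; apply: no; exists m.
case: N SN => [|N] SN.
  by move: SN; apply/negP; rewrite -leNgt nil_ge1.
(* At the product of the two levels the multiplicativities collide: [c] times the sum is at least 1
   by one and at most [c] by the other. *)
have := level_sum_mul_ge n.+1 N s12.
apply/negP; rewrite -ltNge.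
apply: le_lt_trans (_ : _ <= c * 1) _.
  rewrite ler_pM2l// mulnC; apply: le_trans (level_sum_mul_le _ _ s2) _.
  by rewrite exprn_ile1 ?(ltW (level_sum_gt0 _ _))// ltW.
apply: lt_le_trans (_ : _ < 1) _; first by have := balanced_le_half; lra.
by rewrite exprn_ege1// ltW.
Qed.

End LevelSums.

(** * Covering numbers *)

Section Covering.
Context {R : realType}.
Implicit Types (x y : 'cV[R]_2) (E : set 'cV[R]_2).

Lemma enorm_ge0 x : 0 <= enorm x. Proof. exact: sqrtr_ge0. Qed.

Lemma dotp_ge0 x : 0 <= dotp x x.
Proof. by rewrite dotpE -!expr2 addr_ge0 ?sqr_ge0. Qed.

Lemma enorm_sqr x : enorm x ^+ 2 = dotp x x.
Proof. by rewrite sqr_sqrtr ?dotp_ge0. Qed.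

Lemma coord_le_enorm x i : `|x i 0| <= enorm x.
Proof.
rewrite -[leLHS]sqrtr_sqr ler_sqrt ?dotp_ge0// dotpE -!expr2.
by move: i; apply: ord2P; rewrite ?lerDl ?lerDr sqr_ge0.
Qed.

Lemma enorm_le_sum x : enorm x <= `|x 0 0| + `|x 1 0|.
Proof.
rewrite -ler_sqr ?nnegrE ?addr_ge0// ?enorm_ge0// enorm_sqr dotpE.
rewrite -!expr2 -(real_normK (num_real (x 0 0))) -(real_normK (num_real (x 1 0))).
by have := mulr_ge0 (normr_ge0 (x 0 0)) (normr_ge0 (x 1 0)); nra.
Qed.

(* Projections onto the directions [(a, b)] of the closed positive quadrant;
   [a + b] is comparable to the norm of [(a, b)]. *)
Definition long_projections E (rho : R) : Prop :=
  forall a b : R, 0 <= a -> 0 <= b -> exists s : R, forall x : R,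
  s <= x <= s + rho * (a + b) -> exists2 e, E e & a * e 0 0 + b * e 1 0 = x.

Definition covers E (r : R) n (c : 'I_n -> 'cV[R]_2) : Prop :=
  E `<=` \bigcup_i [set x | enorm (x - c i) <= r].

Lemma covering_number_le E r (s : seq 'cV[R]_2) :
  (forall x, E x -> exists2 c, c \in s & enorm (x - c) <= r) ->
  covering_number E r <= (size s)%:R.
Proof.
move=> cov; apply: ge_inf => //=; last first.
  exists (size s) => //; exists (tnth (in_tuple s)) => x /cov[c cs xc].
  by have /tnthP[i ci] : c \in in_tuple s by []; exists i => //=; rewrite -ci.
by exists 0 => _ [n _ <-]; rewrite ler0n.
Qed.

(** The existence of one finite cover keeps the infimum away from its default value. *)
Lemma covering_number_ge E r (L : R) :
  (exists n (c : 'I_n -> 'cV[R]_2), covers E r c) ->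
  (forall n (c : 'I_n -> 'cV[R]_2), covers E r c -> L <= n%:R) ->
  L <= covering_number E r.
Proof.
move=> [n0 [c0 cov0]] h; apply: lb_le_inf.
  by exists n0%:R; exists n0 => //; exists c0.
by move=> _ [n [c cov] <-]; exact: h cov.
Qed.

(** Distances from the smallest index in [S] are distinct naturals not exceeding [D]. *)
Lemma card_bounded_diam K (S : {set 'I_K}) (D : R) :
  (forall i j, i \in S -> j \in S -> (i <= j)%N -> (j - i)%:R <= D) -> 0 <= D ->
  #|S|%:R <= D + 1.
Proof.
move=> h D0; case: (set_0Vmem S) => [->|[i0 i0S]].
  by rewrite cards0 addr_ge0.
have [i iS imin] := arg_minnP (fun j : 'I_K => val j) i0S.
have inj : {in enum S &, injective (fun j : 'I_K => (j - i)%N)}.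
  move=> j k; rewrite !mem_enum => jS kS /= jk.
  by apply/val_inj; have := imin _ jS; have := imin _ kS; rewrite /=; lia.
have [m le_mD lt_Dm] : exists2 m : nat, m%:R <= D & D < m.+1%:R.
  exists (Num.truncn D); first by rewrite truncn_le.
  exact: truncnS_gt.
have : (size [seq (val j - i)%N | j <- enum S] <= size (iota 0 m.+1))%N.
  apply: uniq_leq_size; first by rewrite map_inj_in_uniq// enum_uniq.
  move=> _ /mapP[j jS ->]; rewrite mem_iota add0n /=; rewrite mem_enum in jS.
  have := le_lt_trans (h _ _ iS jS (imin _ jS)) lt_Dm.
  by rewrite ltr_nat.
rewrite size_map -cardE size_iota -(ler_nat R) => /le_trans; apply.
by rewrite -natr1 lerD2r.
Qed.

End Covering.

(** * Geometry of a single piece: length, thickness and slope *)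

Section Strips.
Context {R : realType} {kappa : nat} {Phi : ifs_space R kappa}.
Local Notation A := (lin_part Phi).
Implicit Types (x y : 'cV[R]_2) (u v w : seq 'I_kappa).

Definition word_map w x : 'cV[R]_2 := foldr (affine_map Phi) x w.

Lemma word_map_rcons w i x : word_map (rcons w i) x = word_map w (affine_map Phi i x).
Proof. by rewrite /word_map foldr_rcons. Qed.

Lemma word_mapB w x y : word_map w x - word_map w y = word_mx A w *m (x - y).
Proof.
elim: w => [|i w IH] /=; first by rewrite word_mx_nil mul1mx.
rewrite word_mx_cons -mulmxE -mulmxA -IH /affine_map mulmxBr.
by rewrite opprD addrACA subrr addr0.
Qed.

Context {c Rad : R}.
Hypothesis Apos : forall i a b, 0 < A i a b.
Hypothesis c_gt0 : 0 < c.
Hypothesis balanced : forall w k,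
  c * wsum A w <= mrow (word_mx A w) k /\ c * wsum A w <= mcol (word_mx A w) k.
Context {E : set 'cV[R]_2}.
Hypothesis E_bounded : forall x i, E x -> `|x i 0| <= Rad.
Hypothesis Rad_gt0 : 0 < Rad.

(** The slope of the image of [(1, 1)], a representative direction of the image cone along which the
    piece of [w] is stretched. *)
Definition slope w : R := mrow (word_mx A w) 1 / mrow (word_mx A w) 0.

Let sum_gt0 := wsum_gt0 Apos.

Lemma mrow_word_gt0 w k : 0 < mrow (word_mx A w) k.
Proof. by have [h _] := balanced w k; apply: lt_le_trans h; rewrite mulr_gt0. Qed.

Lemma mrow_word_le w k : mrow (word_mx A w) k <= wsum A w.
Proof.
by rewrite /wsum mxsum_row; move: k; apply: ord2P;
  rewrite ?lerDl ?lerDr ltW ?mrow_word_gt0.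
Qed.

Lemma slope_ge0 w : 0 <= slope w.
Proof. by rewrite divr_ge0 ?mrow_word_ge0. Qed.

Lemma slope_le w : slope w <= c^-1.
Proof.
rewrite ler_pdivrMr ?mrow_word_gt0// mulrC ler_pdivlMr//.
apply: le_trans (proj1 (balanced w 0)); rewrite mulrC ler_wpM2l ?(ltW c_gt0)//.
exact: mrow_word_le.
Qed.

(** As [(1, 1)] is mapped onto the line of slope [slope w], only the difference of the two
    coordinates of [x - y] survives. It is scaled by the determinant over a row sum, and is at most
    [4 * Rad]. *)
Lemma word_map_transverse w x y : E x -> E y ->
  `|(word_map w x - word_map w y) 1 0 - slope w * (word_map w x - word_map w y) 0 0|
  <= 4 * Rad / c * (wdet A w / wsum A w).
Proof.
move=> Ex Ey; rewrite word_mapB.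
have r0 := mrow_word_gt0 w 0.
have -> : (word_mx A w *m (x - y)) 1 0 - slope w * (word_mx A w *m (x - y)) 0 0 =
   \det (word_mx A w) * ((x - y) 1 0 - (x - y) 0 0) / mrow (word_mx A w) 0.
  rewrite !mulmx2E det2E /slope.
  by move: r0; rewrite /mrow => r0; field; rewrite gt_eqF.
rewrite !normrM normfV (gtr0_norm r0) -/(wdet A w).
have le4 : `|(x - y) 1 0 - (x - y) 0 0| <= 4 * Rad.
  rewrite !mxE; have := (E_bounded 0 Ex, E_bounded 1 Ex, E_bounded 0 Ey, E_bounded 1 Ey).
  by case=> [[[]]]; rewrite !ler_norml; lra.
rewrite (_ : _ / c * _ = wdet A w * (4 * Rad) / (c * wsum A w)); last first.
  by field; rewrite !gt_eqF.
have wd : 0 <= wdet A w by exact: normr_ge0.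
apply: ler_pM; rewrite ?invr_ge0 ?(ltW r0) ?mulr_ge0//.
  by rewrite ler_wpM2l.
by rewrite lef_pV2 ?posrE ?mulr_gt0//; have [] := balanced w 0.
Qed.

Lemma word_map_horizontal w x y : E x -> E y ->
  `|(word_map w x - word_map w y) 0 0| <= 2 * Rad * wsum A w.
Proof.
move=> Ex Ey; rewrite word_mapB mulmx2E.
apply: le_trans (_ : mrow (word_mx A w) 0 * (2 * Rad) <= _); last first.
  by rewrite mulrC ler_wpM2l ?mrow_word_le// mulr_ge0// ltW.
have lt2 i : `|(x - y) i 0| <= 2 * Rad.
  rewrite !mxE; have := (E_bounded i Ex, E_bounded i Ey).
  by case; rewrite !ler_norml; lra.
apply: le_trans (ler_normD _ _) _; rewrite !normrM !(ger0_norm (word_mx_ge0 Apos _ _ _)).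
by rewrite /mrow mulrDl lerD// ler_wpM2l ?word_mx_ge0.
Qed.

Hypothesis detA : forall i, \det (A i) != 0.
Hypothesis sepA : cone_separated A.

Lemma wlen_le w : wlen (A := A) w <= c^-1 ^+ 2 * (wdet A w / wsum A w ^+ 2).
Proof.
have h k : c * wsum A w <= mcol (word_mx A w) k by have [] := balanced w k.
have cN : 0 < c * wsum A w by rewrite mulr_gt0.
have wd : 0 <= wdet A w by exact: normr_ge0.
rewrite /wlen (_ : _ ^+ 2 * _ = wdet A w / ((c * wsum A w) * (c * wsum A w))).
  rewrite ler_wpM2l// lef_pV2 ?posrE ?mulr_gt0//.
  - by apply: ler_pM; rewrite ?(ltW cN).
  - exact: lt_le_trans cN (h _).
  - exact: lt_le_trans cN (h _).
by field; rewrite !gt_eqF.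
Qed.

Lemma wlen_ge w : wdet A w / wsum A w ^+ 2 <= wlen (A := A) w.
Proof. by rewrite ler_pdivrMr ?exprn_gt0// mulrC wdet_le_wlen. Qed.

Lemma wlen_le_const w : wlen (A := A) w <= c^-1 ^+ 2.
Proof.
apply: le_trans (wlen_le w) _; rewrite ler_piMr ?sqr_ge0//.
by rewrite ler_pdivrMr ?exprn_gt0// mul1r wdet_le.
Qed.

(** The difference of the slopes is, up to sign, [\det (word_mx A u)] times a bilinear form in the
    positive row sums of [v] and [v'], over a product of row sums. The coefficients of the form are
    the entries of [cross A i j]. *)
Lemma slope_gap : exists2 g : R, 0 < g & forall u i j v v', i != j ->
  g * wlen (A := A) u <= `|slope (rcons u i ++ v) - slope (rcons u j ++ v')|.
Proof.
have [g g0 hg] := cross_gap sepA.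
pose Am := \sum_i mxsum (A i).
have msum0 i : 0 < mxsum (A i) by rewrite /mxsum !addr_gt0.
have Am_ge i : mxsum (A i) <= Am.
  by rewrite /Am (bigD1 i)//= lerDl sumr_ge0// => j _; rewrite ltW.
case: (posnP kappa) => [k0|k_gt0].
  by exists 1 => // u i; have := leq_trans (ltn_ord i) (eq_leq k0).
have Am0 : 0 < Am by apply: lt_le_trans (Am_ge (Ordinal k_gt0)).
(* [c ^+ 2] converts [wlen u] into [wdet A u / wsum A u ^+ 2], and [Am ^+ 2] bounds the contribution
   of the letters [i] and [j] to the row sums in the denominator. *)
exists (g * c ^+ 2 / Am ^+ 2) => [|u i j v v' neq].
  by rewrite divr_gt0 ?mulr_gt0 ?exprn_gt0.
have wN := sum_gt0 u; have dN : 0 <= wdet A u by exact: normr_ge0.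
apply: le_trans (_ : g / Am ^+ 2 * (wdet A u / wsum A u ^+ 2) <= _).
  have -> : g / Am ^+ 2 * (wdet A u / wsum A u ^+ 2) =
     g * c ^+ 2 / Am ^+ 2 * (c^-1 ^+ 2 * (wdet A u / wsum A u ^+ 2)).
    by field; rewrite !gt_eqF.
  by rewrite ler_wpM2l ?wlen_le// mulr_ge0 ?invr_ge0 ?mulr_ge0 ?sqr_ge0// ltW.
set w := rcons u i ++ v; set w' := rcons u j ++ v'.
pose xi k := mrow (word_mx A v) k; pose xi' k := mrow (word_mx A v') k.
have xi0 k : 0 < xi k by exact: mrow_word_gt0.
have xi'0 k : 0 < xi' k by exact: mrow_word_gt0.
have wE k : mrow (word_mx A w) k =
    word_mx A u k 0 * (A i 0 0 * xi 0 + A i 0 1 * xi 1) +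
    word_mx A u k 1 * (A i 1 0 * xi 0 + A i 1 1 * xi 1).
  by rewrite word_mx_cat word_mx_rcons -mulrA !mrowM.
have wE' k : mrow (word_mx A w') k =
    word_mx A u k 0 * (A j 0 0 * xi' 0 + A j 0 1 * xi' 1) +
    word_mx A u k 1 * (A j 1 0 * xi' 0 + A j 1 1 * xi' 1).
  by rewrite word_mx_cat word_mx_rcons -mulrA !mrowM.
have r0 := mrow_word_gt0 w 0; have r0' := mrow_word_gt0 w' 0.
pose X := cross A i j 0 0 * (xi 0 * xi' 0) + cross A i j 0 1 * (xi 0 * xi' 1) +
  cross A i j 1 0 * (xi 1 * xi' 0) + cross A i j 1 1 * (xi 1 * xi' 1).
have -> : slope w - slope w' =
    - (\det (word_mx A u) * X) / (mrow (word_mx A w) 0 * mrow (word_mx A w') 0).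
  rewrite /slope; move: (r0) (r0').
  rewrite !wE !wE' /X /cross det2E => {}r0 {}r0'.
  by field; rewrite !gt_eqF.
rewrite normrM normfV (gtr0_norm (mulr_gt0 r0 r0')) normrN normrM -/(wdet A u).
(* All coefficients have the same sign, so nothing cancels. *)
have X_ge : g * ((xi 0 + xi 1) * (xi' 0 + xi' 1)) <= `|X|.
  have -> : g * ((xi 0 + xi 1) * (xi' 0 + xi' 1)) = g * (xi 0 * xi' 0) +
     g * (xi 0 * xi' 1) + g * (xi 1 * xi' 0) + g * (xi 1 * xi' 1) by ring.
  have p k l : 0 <= xi k * xi' l by rewrite mulr_ge0// ltW.
  have [pos|neg] := sepA neq.
    have h k l : g * (xi k * xi' l) <= cross A i j k l * (xi k * xi' l).
      by rewrite ler_wpM2r// -[leRHS]gtr0_norm ?hg.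
    by apply: le_trans (ler_norm _); rewrite /X !lerD.
  have h k l : g * (xi k * xi' l) <= - cross A i j k l * (xi k * xi' l).
    by rewrite ler_wpM2r// -[leRHS]ltr0_norm ?hg.
  rewrite -normrN; apply: le_trans (ler_norm _).
  by rewrite /X !opprD -!mulNr !lerD.
have bound (t : seq 'I_kappa) k (z : 'I_2 -> R) (z0 : forall l, 0 < z l) :
    word_mx A u 0 0 * (A k 0 0 * z 0 + A k 0 1 * z 1) +
    word_mx A u 0 1 * (A k 1 0 * z 0 + A k 1 1 * z 1) <=
    wsum A u * (Am * (z 0 + z 1)).
  apply: le_trans (_ : wsum A u * (mxsum (A k) * (z 0 + z 1)) <= _); last first.
    by rewrite ler_wpM2l ?(ltW wN)// ler_wpM2r ?Am_ge// addr_ge0// ltW.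
  have := (word_mx_ge0 Apos u 0 0, word_mx_ge0 Apos u 0 1,
    word_mx_ge0 Apos u 1 0, word_mx_ge0 Apos u 1 1).
  rewrite /wsum /mxsum.
  move: (word_mx A u 0 0) (word_mx A u 0 1) (word_mx A u 1 0) (word_mx A u 1 1).
  move=> a b a' b' [[[a0 b0] a'0] b'0].
  have hz l m n : 0 <= A k l m * z n by rewrite mulr_ge0 ?ltW.
  have e1 : A k 0 0 * z 0 + A k 0 1 * z 1 <=
     (A k 0 0 + A k 0 1 + A k 1 0 + A k 1 1) * (z 0 + z 1).
    have := (hz 0 0 1, hz 0 1 0, hz 1 0 0, hz 1 0 1, hz 1 1 0, hz 1 1 1).
    by case=> [[[[[]]]]]; lra.
  have e2 : A k 1 0 * z 0 + A k 1 1 * z 1 <=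
     (A k 0 0 + A k 0 1 + A k 1 0 + A k 1 1) * (z 0 + z 1).
    have := (hz 0 0 0, hz 0 0 1, hz 0 1 0, hz 0 1 1, hz 1 0 1, hz 1 1 0).
    by case=> [[[[[]]]]]; lra.
  set Z := (_ + _ + _ + _) * (z 0 + z 1) in e1 e2 *.
  have Z0 : 0 <= Z by apply: le_trans e1; rewrite addr_ge0.
  rewrite -!addrA mulrDl mulrDl; apply: lerD; first by rewrite ler_wpM2l.
  by apply: le_trans (ler_wpM2l b0 e2) _; rewrite lerDl mulr_ge0// addr_ge0.
have b1 := bound v i xi xi0; have b2 := bound v' j xi' xi'0.
rewrite -wE in b1; rewrite -wE' in b2.
set P := (xi 0 + xi 1); set P' := (xi' 0 + xi' 1).
have P0 : 0 < P by rewrite addr_gt0. have P'0 : 0 < P' by rewrite addr_gt0.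
have -> : g / Am ^+ 2 * (wdet A u / wsum A u ^+ 2) =
   wdet A u * (g * (P * P')) / ((wsum A u * (Am * P)) * (wsum A u * (Am * P'))).
  by field; rewrite !gt_eqF.
apply: ler_pM; rewrite ?mulr_ge0 ?invr_ge0 ?mulr_ge0 ?(ltW g0) ?(ltW P0) ?(ltW P'0)
  ?(ltW wN) ?(ltW Am0)//.
  by rewrite ler_wpM2l.
rewrite lef_pV2 ?posrE ?mulr_gt0//.
by apply: ler_pM => //; apply: ltW.
Qed.

End Strips.

Section CoveringBounds.
Context {R : realType} {kappa : nat} {Phi : ifs_space R kappa}.
Local Notation A := (lin_part Phi).
Local Notation slope := (slope (Phi := Phi)).
Local Notation word_map := (word_map (Phi := Phi)).
Context {c lam Rad rho t : R} {E : set 'cV[R]_2}.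
Implicit Types (x y : 'cV[R]_2) (u v w : seq 'I_kappa).

Hypothesis kappa_gt0 : (0 < kappa)%N.
Hypothesis Apos : forall i a b, 0 < A i a b.
Hypothesis detA : forall i, \det (A i) != 0.
Hypothesis sepA : cone_separated A.
Hypothesis c_gt0 : 0 < c.
Hypothesis balanced : forall w k,
  c * wsum A w <= mrow (word_mx A w) k /\ c * wsum A w <= mcol (word_mx A w) k.
Hypotheses (lam_gt0 : 0 < lam) (lam_lt1 : lam < 1).
Hypothesis contr : forall w, wsum A w <= 2 * lam ^+ size w.
Hypotheses (t_ge1 : 1 <= t) (t_lt2 : t < 2).
Hypothesis level_bounds : forall n, 1 <= level_sum A t n <= c^-1.
Hypothesis E_bounded : forall x i, E x -> `|x i 0| <= Rad.
Hypothesis Rad_gt0 : 0 < Rad.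
Hypothesis E_neq0 : E !=set0.
Hypothesis E_inv : E = \bigcup_i (affine_map Phi i @` E).
Hypothesis rho_gt0 : 0 < rho.
Hypothesis proj : long_projections E rho.

Let sum_gt0 := wsum_gt0 Apos.
Let det_gt0 w := wdet_gt0 w detA.
Let det_ge0 w := ltW (det_gt0 w).

(** Comparable to [alpha2], the thickness of the piece of [w]. *)
Definition whgt w : R := wdet A w / wsum A w.

Let hgt_gt0 w : 0 < whgt w. Proof. exact: whgt_gt0. Qed.

Lemma wpsi_hgt w : wpsi A t w = wsum A w * expR ((t - 1) * ln (whgt w)).
Proof.
rewrite /wpsi /whgt ln_div ?posrE// -[X in X * expR _]lnK ?posrE//.
by rewrite -expRD; congr expR; ring.
Qed.

Lemma invariant_affine i x : E x -> E (affine_map Phi i x).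
Proof. by move=> Ex; rewrite E_inv; exists i => //; exists x. Qed.

Lemma invariant_word w x : E x -> E (word_map w x).
Proof. by move=> Ex; elim: w => //= i w; exact: invariant_affine. Qed.

Lemma invariant_stop (f : seq 'I_kappa -> R) (r : R) n x : E x ->
  exists2 w, w \in stop_words f r n [::] & exists2 y, E y & word_map w y = x.
Proof.
move=> Ex; apply: (stop_ex (P := fun w => exists2 y, E y & word_map w y = x)).
  move=> u [y Ey <-]; move: (Ey); rewrite {1}E_inv => -[i _ [z Ez zy]].
  by exists i, z => //; rewrite word_map_rcons zy.
by exists x.
Qed.

(** The fuel is the length at which contraction alone brings heights below [r], hence of order
    [- ln r]. Heights of leaves stay within the factor [k] of [r], the least height of a letter
    capped at 1. *)
Lemma stopping_words : exists k C : R, [/\ 0 < k <= 1, 0 < C & forall r, 0 < r <= 1 / 2 ->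
  exists2 n : nat, n%:R <= C * (1 - ln r) &
    (forall w, w \in stop_words whgt r n [::] -> k * r <= whgt w <= r) /\
    c <= \sum_(w <- stop_words whgt r n [::]) wpsi A t w <= c^-1 ^+ 2].
Proof.
have t2 := ltW t_lt2; have t12 : 1 <= t <= 2 by rewrite t_ge1 t2.
have [|k0 k00 hk0] := @exists_lower_bound R _ (fun i : 'I_kappa => whgt [:: i]).
  by move=> i; exact: hgt_gt0.
pose k := Num.min k0 1.
have k_gt0 : 0 < k by rewrite lt_min k00 ltr01.
have k_le1 : k <= 1 by rewrite ge_min lexx orbT.
have hk i : k <= whgt [:: i] by apply: le_trans (hk0 i); rewrite ge_min lexx.
pose m := - ln lam; have m_gt0 : 0 < m by rewrite oppr_gt0 ln_lt0// lam_gt0.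
have ln2 : 0 <= ln 2 :> R by rewrite ln_ge0// ler1n.
exists k, ((ln 2 + 1) / m + 1); split; first by rewrite k_gt0.
  by rewrite addr_gt0// divr_gt0// ltr_wpDl.
move=> r /andP[r0 r2].
have lnr : ln r <= 0 by rewrite ln_le0//; lra.
have x0 : 0 <= (ln 2 - ln r) / m by rewrite divr_ge0 ?(ltW m_gt0)//; lra.
pose n := (Num.truncn ((ln 2 - ln r) / m)).+1.
have n_gt : (ln 2 - ln r) / m < n%:R by exact: truncnS_gt.
have n_le : n%:R <= (ln 2 - ln r) / m + 1.
  by rewrite /n -natr1 lerD2r truncn_le.
have small v : size v = n -> whgt v <= r.
  move=> sv; apply: le_trans (whgt_le Apos v) _; apply: le_trans (contr v) _.
  rewrite sv -[leRHS]lnK ?posrE// -[leLHS]lnK ?posrE ?mulr_gt0 ?exprn_gt0//.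
  rewrite ler_expR lnM ?posrE ?exprn_gt0// lnXn// -[ln lam *+ _]mulr_natr.
  have := ltW n_gt; rewrite ler_pdivrMr// /m; lra.
exists n.
  apply: le_trans n_le _.
  have -> : ((ln 2 + 1) / m + 1) * (1 - ln r) =
     (ln 2 - ln r) / m + 1 + (1 / m - ln 2 * ln r / m - ln r).
    by field; rewrite gt_eqF.
  rewrite lerDl; have h1 : 0 <= 1 / m by rewrite divr_ge0// ltW.
  have h2 : 0 <= - (ln 2 * ln r / m).
    by rewrite -mulNr -mulrN divr_ge0 ?(ltW m_gt0)// mulr_ge0// oppr_ge0.
  lra.
(* The root has height 1/2, so [r <= 1 / 2] gives the lower bound there too. *)
have r00 : whgt [::] = 1 / 2 by rewrite /whgt wdet_nil wsum_nil.
split.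
  move=> w wW; apply/andP; split.
    apply: stop_ge wW => //; first exact: ltW.
    - move=> u i; rewrite -cats1; apply: le_trans (whgt_cat_ge Apos detA u [:: i]).
      by rewrite mulrC ler_wpM2l ?hk// ltW.
    - by rewrite r00; apply: le_trans r2; rewrite ler_piMl// ltW.
  apply: stop_le wW => v sv; apply: small.
  by rewrite sv add0n.
have S u j : \sum_(v : j.-tuple 'I_kappa) wpsi A t u * wpsi A t v = wpsi A t u * level_sum A t j.
  by rewrite /level_sum mulr_sumr.
(* Below any word the level sums of [wpsi] are its value times a factor between [c] and [c^-1], so
   leaves compare with level [n] both ways. *)
apply/andP; split.
- have := @stop_level_le _ _ whgt r (wpsi A t) c^-1 _ n [::].
  rewrite mulrC ler_pdivlMr// => h.
  have {}h := h (fun j u => _); apply: le_trans (h _).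
    rewrite ler_peMl ?(ltW c_gt0)//.
    by have /andP[] := level_bounds n.
  move=> j u; apply: le_trans (_ : \sum_(v : j.-tuple 'I_kappa) wpsi A t u * wpsi A t v <= _).
    by apply: ler_sum => v _; exact: wpsi_cat_le.
  rewrite S mulrC ler_wpM2r ?(ltW (wpsi_gt0 _ _))//.
  by have /andP[] := level_bounds j.
- have := @stop_level_ge _ _ whgt r (wpsi A t) c _ n [::].
  rewrite mulrC -ler_pdivlMr// => h; rewrite expr2.
  have {}h := h (fun j u => _); apply: le_trans (h _) _.
    move=> j u; apply: le_trans (_ : \sum_(v : j.-tuple 'I_kappa) c * (wpsi A t u * wpsi A t v) <= _).
      rewrite -mulr_sumr S ler_wpM2l ?(ltW c_gt0)// ler_peMr ?(ltW (wpsi_gt0 _ _))//.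
      by have /andP[] := level_bounds j.
    by apply: ler_sum => v _; exact: wpsi_cat_ge.
  rewrite ler_wpM2r ?invr_ge0 ?(ltW c_gt0)//.
  by have /andP[] := level_bounds n.
Qed.

(** The piece of [w] lies in a thin strip of horizontal extent at most [4 * Rad * wsum A w], and
    equally spaced points on the axis of the strip serve as centres. *)
Lemma word_cover : exists D k0 : R, [/\ 0 < D, 0 < k0 <= 1 &
  forall r w, 0 < r -> whgt w <= k0 * r -> exists2 s : seq 'cV[R]_2,
    (size s)%:R <= D * wsum A w / r + 1 &
    forall x, E x -> exists2 z, z \in s & enorm (word_map w x - z) <= r].
Proof.
(* The grid spacing in units of [r]: as slopes are at most [c^-1], being [d * r] away from a grid
   point horizontally costs at most [r / 2]. *)
pose d : R := (2 * (1 + c^-1))^-1.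
have ci0 : 0 < c^-1 by rewrite invr_gt0.
have d0 : 0 < d by rewrite invr_gt0 mulr_gt0// addr_gt0.
(* The other [r / 2] is for the transverse deviation [4 * Rad / c * whgt w]. *)
pose k0 := Num.min 1 (c / (8 * Rad)).
have Rad8 : 0 < 8 * Rad by rewrite mulr_gt0.
have k00 : 0 < k0 by rewrite lt_min ltr01 divr_gt0.
exists (4 * Rad / d), k0; split; first by rewrite divr_gt0// mulr_gt0.
  by rewrite k00 ge_min lexx.
move=> r w r0 hw.
have [e0 Ee0] := E_neq0; pose y0 := word_map w e0.
have dr : 0 < d * r by rewrite mulr_gt0.
have N0 := sum_gt0 w.
pose K := Num.truncn (4 * Rad * wsum A w / (d * r)).
pose f (k : nat) : 'cV[R]_2 :=
  y0 + vec2 (k%:R * (d * r) - 2 * Rad * wsum A w)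
            (slope w * (k%:R * (d * r) - 2 * Rad * wsum A w)).
exists [seq f k | k <- iota 0 K.+1].
  rewrite size_map size_iota -natr1 lerD2r.
  rewrite (_ : _ * _ / r = 4 * Rad * wsum A w / (d * r)); last first.
    by field; rewrite !gt_eqF.
  by rewrite truncn_le divr_ge0 ?(ltW dr)// !mulr_ge0// ltW.
move=> x Ex.
have hor := word_map_horizontal Apos c_gt0 balanced E_bounded Rad_gt0 w Ex Ee0.
have ver := word_map_transverse Apos c_gt0 balanced E_bounded w Ex Ee0.
rewrite -/y0 in hor ver.
set Y := word_map w x - y0 in hor ver.
pose q := (Y 0 0 + 2 * Rad * wsum A w) / (d * r).
move: hor; rewrite ler_norml => /andP[hor1 hor2].
have q0 : 0 <= q by rewrite divr_ge0 ?(ltW dr)//; lra.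
have qE : q * (d * r) = Y 0 0 + 2 * Rad * wsum A w by rewrite divfK// gt_eqF.
have kq : (Num.truncn q)%:R <= q by rewrite truncn_le.
have qk : q < (Num.truncn q)%:R + 1 by rewrite natr1; exact: truncnS_gt.
exists (f (Num.truncn q)).
  apply: map_f; rewrite mem_iota add0n /= ltnS /K; apply: le_truncn.
  by rewrite ler_wpM2r ?invr_ge0 ?(ltW dr)//; lra.
rewrite /f opprD addrA -/Y; apply: le_trans (enorm_le_sum _) _.
set k := (Num.truncn q)%:R in kq qk *.
have -> : (Y - vec2 (k * (d * r) - 2 * Rad * wsum A w)
   (slope w * (k * (d * r) - 2 * Rad * wsum A w))) 0 0 = (q - k) * (d * r).
  by rewrite colB vec2_0 mulrBl qE; ring.
have -> : (Y - vec2 (k * (d * r) - 2 * Rad * wsum A w)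
   (slope w * (k * (d * r) - 2 * Rad * wsum A w))) 1 0 =
   (Y 1 0 - slope w * Y 0 0) + slope w * ((q - k) * (d * r)).
  by rewrite colB vec2_1 mulrBl qE; ring.
have z0 : 0 <= (q - k) * (d * r) by rewrite mulr_ge0 ?(ltW dr)// subr_ge0.
have z1 : (q - k) * (d * r) <= d * r by rewrite ler_piMl ?(ltW dr)//; lra.
have s0 := slope_ge0 Apos w; have s1 := slope_le Apos c_gt0 balanced w.
apply: le_trans (_ : d * r + (r / 2 + c^-1 * (d * r)) <= _); last first.
  have dE : d * (2 * (1 + c^-1)) = 1 by rewrite mulVf// gt_eqF// mulr_gt0// addr_gt0.
  have -> : d * r + (r / 2 + c^-1 * (d * r)) = r / 2 + (d * (2 * (1 + c^-1))) * r / 2.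
    by field; rewrite gt_eqF.
  by rewrite dE; lra.
apply: lerD; first by rewrite ger0_norm.
apply: le_trans (ler_normD _ _) _; apply: lerD; last first.
  by rewrite (ger0_norm (mulr_ge0 s0 z0)); apply: ler_pM.
apply: le_trans ver _; rewrite -/(whgt w).
apply: le_trans (_ : 4 * Rad / c * (c / (8 * Rad) * r) <= _); last first.
  by rewrite le_eqVlt; apply/orP; left; apply/eqP; field; rewrite !gt_eqF.
have Rc : 0 <= 4 * Rad / c by rewrite divr_ge0 ?(ltW c_gt0)// mulr_ge0 ?(ltW Rad_gt0).
rewrite ler_wpM2l//; apply: le_trans hw _.
by rewrite ler_wpM2r ?(ltW r0)// ge_min lexx orbT.
Qed.

(** The axis passes through the image of one point of [E], chosen independently of [w]; two balls
    near the axis can then be compared through [w] alone. *)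
Let intercept w := let y0 := word_map w (projT1 (cid E_neq0)) in
  y0 1 0 - slope w * y0 0 0.

(** Up to a constant, the first coordinate of [word_map w x] is the product of [x] with the first
    row of [word_mx A w], a positive direction. So it fills an interval of length [rho] times a row
    sum. Samples are taken [3 * r] apart; a ball containing a sample has its centre within [r] of
    it, which leaves the centres separated by [r] per step. *)
Lemma word_packing : exists2 C1 : R, 0 < C1 &
  forall r n (z : 'I_n -> 'cV[R]_2) w, 0 < r -> covers E r z -> whgt w <= r ->
  exists p : nat * (nat -> 'I_n), [/\ rho * c * wsum A w / (3 * r) <= p.1%:R,
    (forall j, (j < p.1)%N ->
       `|(z (p.2 j)) 1 0 - slope w * (z (p.2 j)) 0 0 - intercept w| <= C1 * r) &
    (forall j j', (j < j')%N -> (j' < p.1)%N ->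
       (j' - j)%:R * r <= `|(z (p.2 j')) 0 0 - (z (p.2 j)) 0 0|)].
Proof.
(* Thickness of the strip, then vertical and horizontal displacement of the centre, the latter times
   the slope. *)
exists (4 * Rad / c + 1 + c^-1).
  by rewrite !addr_gt0 ?invr_gt0// divr_gt0// mulr_gt0.
move=> r n z w r0 cov hw.
have r30 : 0 < 3 * r by rewrite mulr_gt0.
have [s hs] := proj (word_mx_ge0 Apos w 0 0) (word_mx_ge0 Apos w 0 1).
pose T := Num.truncn (rho * mrow (word_mx A w) 0 / (3 * r)).
have Tle j : (j < T.+1)%N -> j%:R * (3 * r) <= rho * mrow (word_mx A w) 0.
  rewrite ltnS => jT; rewrite -ler_pdivlMr//.
  apply: le_trans (_ : T%:R <= _); first by rewrite ler_nat.
  by rewrite truncn_le divr_ge0 ?(ltW r30)// mulr_ge0 ?(ltW rho_gt0)// mrow_word_ge0.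
(* Beyond the last sample any ball serves, which makes the choice total in [j]. *)
have ex j : exists b : 'I_n, (j < T.+1)%N -> exists2 x, E x &
   word_mx A w 0 0 * x 0 0 + word_mx A w 0 1 * x 1 0 = s + j%:R * (3 * r) /\
   enorm (word_map w x - z b) <= r.
  case: (ltnP j T.+1) => jT; last first.
    have [e0 Ee0] := E_neq0; have [b _ _] := cov _ Ee0.
    by exists b.
  have [|x Ex xE] := hs (s + j%:R * (3 * r)).
    by rewrite lerDl lerD2l Tle// mulr_ge0 ?(ltW r30).
  have [b _ xb] := cov _ (invariant_word w Ex).
  by exists b => _; exists x.
have [b hb] := choice ex.
exists (T.+1, b); split=> /=.
- apply: le_trans (ltW (truncnS_gt _)).
  rewrite ler_wpM2r ?invr_ge0 ?(ltW r30)// -mulrA ler_wpM2l ?(ltW rho_gt0)//.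
  by have [] := balanced w 0.
- move=> j /hb[x Ex [_ xb]].
  rewrite /intercept; case: cid => e0 Ee0 /=; set y0 := word_map w e0.
  have ver := word_map_transverse Apos c_gt0 balanced E_bounded w Ex Ee0.
  have h0 := le_trans (coord_le_enorm _ 0) xb.
  have h1 := le_trans (coord_le_enorm _ 1) xb.
  have s0 := slope_ge0 Apos w; have s1 := slope_le Apos c_gt0 balanced w.
  set x0 := word_map w x in ver h0 h1.
  have -> : z (b j) 1 0 - slope w * z (b j) 0 0 - (y0 1 0 - slope w * y0 0 0) =
     ((x0 - y0) 1 0 - slope w * (x0 - y0) 0 0) - (x0 - z (b j)) 1 0 +
     slope w * (x0 - z (b j)) 0 0.
    by rewrite !mxE; ring.
  have -> : (4 * Rad / c + 1 + c^-1) * r = 4 * Rad / c * r + r + c^-1 * r by ring.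
  apply: le_trans (ler_normD _ _) _; apply: lerD.
    apply: le_trans (ler_normB _ _) _; apply: lerD => //.
    apply: le_trans ver _; apply: ler_wpM2l => //.
    by rewrite divr_ge0 ?(ltW c_gt0)// mulr_ge0 ?(ltW Rad_gt0).
  by rewrite normrM (ger0_norm s0); apply: ler_pM.
- move=> j j' jj' j'T; have jT := ltn_trans jj' j'T.
  have [x Ex [xE xb]] := hb _ jT; have [x' Ex' [x'E xb']] := hb _ j'T.
  have h0 := le_trans (coord_le_enorm _ 0) xb.
  have h0' := le_trans (coord_le_enorm _ 0) xb'.
  have D : (word_map w x' - word_map w x) 0 0 = (j'%:R - j%:R) * (3 * r).
    rewrite word_mapB mulmx2E 2!mxE [X in word_mx A w 0 1 * X]mxE [in X in _ + X]mxE.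
    by move: xE x'E; lra.
  have jj : 1 <= (j' - j)%:R :> R by rewrite ler1n subn_gt0.
  rewrite natrB ?(ltnW jj')// in jj *.
  move: D h0 h0' jj; rewrite !mxE.
  move: (word_map w x 0 0) (word_map w x' 0 0) (z (b j) 0 0) (z (b j') 0 0) (j%:R) (j'%:R).
  move=> X X' Z Z' p q D h0 h0' jj.
  apply: le_trans (ler_norm _); move: h0 h0'; rewrite !ler_norml.
  have : r <= (q - p) * r by rewrite ler_peMl// ltW.
  lra.
Qed.

Let inv_powE r : 0 < r -> expR (- (t * ln r)) = expR (- ((t - 1) * ln r)) / r.
Proof.
move=> r0; rewrite -[X in _ / X]lnK ?posrE// -expRN -expRD.
by congr expR; ring.
Qed.

(** By [wpsi_hgt], [wpsi A t w] is [wsum A w] times the height to the power [t - 1]. With height at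
    least [q * r] the loss is [q ^ (1 - t)], at most [q^-1]. *)
Let wsum_over_le (q r : R) w : 0 < q <= 1 -> 0 < r -> q * r <= whgt w ->
  wsum A w / r <= wpsi A t w * (q^-1 * expR (- (t * ln r))).
Proof.
move=> /andP[q0 q1] r0 hq.
rewrite wpsi_hgt inv_powE// !mulrA ler_wpM2r ?invr_ge0 ?(ltW r0)//.
rewrite -!mulrA ler_peMr ?(ltW (sum_gt0 w))//.
rewrite -[q^-1]lnK ?posrE ?invr_gt0// -!expRD -[leLHS]expR0 ler_expR lnV ?posrE//.
have : ln q + ln r <= ln (whgt w).
  by rewrite -lnM ?posrE// ler_ln ?posrE ?(mulr_gt0 q0 r0)//.
have lnq : ln q <= 0 by rewrite ln_le0.
move=> h; have : (t - 1) * (ln q + ln r) <= (t - 1) * ln (whgt w).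
  by rewrite ler_wpM2l// subr_ge0.
have : 0 <= (2 - t) * - ln q by rewrite mulr_ge0 ?oppr_ge0// subr_ge0 ltW.
lra.
Qed.

Let wsum_over_ge r w : 0 < r -> whgt w <= r ->
  wpsi A t w * expR (- (t * ln r)) <= wsum A w / r.
Proof.
move=> r0 hr; rewrite wpsi_hgt inv_powE// !mulrA ler_wpM2r ?invr_ge0 ?(ltW r0)//.
rewrite -!mulrA ler_piMr ?(ltW (sum_gt0 w))//.
rewrite -!expRD -[leRHS]expR0 ler_expR.
have h : ln (whgt w) <= ln r by rewrite ler_ln ?posrE.
have : (t - 1) * ln (whgt w) <= (t - 1) * ln r by rewrite ler_wpM2l// subr_ge0.
lra.
Qed.

Lemma covering_upper : exists2 C : R, 0 < C & forall r, 0 < r <= 1 / 2 ->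
  exists2 s : seq 'cV[R]_2, (size s)%:R <= C * expR (- (t * ln r)) &
    forall x, E x -> exists2 z, z \in s & enorm (x - z) <= r.
Proof.
have [D [k0 [D0 /andP[k00 k01] cov]]] := word_cover.
have [k [C0 [/andP[k_gt0 k_le1] _ stopW]]] := stopping_words.
(* Stopping at [k0 * r] makes the strips thin enough for balls of radius [r]; heights are then at
   least [q * r]. *)
pose q := k * k0.
have q0 : 0 < q by rewrite mulr_gt0.
have q1 : q <= 1 by rewrite -[leRHS]mulr1 ler_pM// ltW.
have qi0 : 0 < q^-1 by rewrite invr_gt0.
exists ((D + q^-1) * (q^-1 * c^-1 ^+ 2)).
  by rewrite mulr_gt0 ?addr_gt0// mulr_gt0// exprn_gt0// invr_gt0.
move=> r /andP[r0 r2].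
have r'0 : 0 < k0 * r by rewrite mulr_gt0.
have r'2 : k0 * r <= 1 / 2 by apply: le_trans r2; rewrite ler_piMl// ltW.
have [|n _ [hW /andP[_ psiW]]] := stopW (k0 * r); first by rewrite r'0.
set W := stop_words _ _ _ _ in hW psiW.
have ex w : exists s : seq 'cV[R]_2, w \in W ->
    (size s)%:R <= D * wsum A w / r + 1 /\
    forall x, E x -> exists2 z, z \in s & enorm (word_map w x - z) <= r.
  case: (boolP (w \in W)) => wW; last by exists [::].
  have /andP[_ hw] := hW _ wW.
  by have [s ss sc] := cov _ _ r0 hw; exists s.
have [S hS] := choice ex.
exists (flatten [seq S w | w <- W]); last first.
  move=> x Ex; have [w wW [y Ey yx]] := invariant_stop whgt (k0 * r) n Ex.
  have [_ /(_ _ Ey)[z zS yz]] := hS _ wW.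
  by exists z; rewrite -?yx//; apply/flatten_mapP; exists w.
rewrite size_flatten /shape -map_comp sumnE big_map natr_sum.
apply: le_trans (_ : \sum_(w <- W) (D + q^-1) * (wpsi A t w * (q^-1 * expR (- (t * ln r)))) <= _).
  rewrite big_seq [leRHS]big_seq; apply: ler_sum => w wW /=.
  have [sw _] := hS _ wW; apply: le_trans sw _.
  have /andP[hw _] := hW _ wW; rewrite mulrA -/q in hw.
  (* The summand 1 is absorbed because [wsum A w >= whgt w >= q * r]. *)
  apply: le_trans (_ : (D + q^-1) * (wsum A w / r) <= _).
    rewrite mulrDl mulrA lerD2l mulrA ler_pdivlMr// mul1r ler_pdivlMl//.
    exact: le_trans hw (whgt_le Apos w).
  rewrite ler_wpM2l ?addr_ge0 ?(ltW D0) ?(ltW qi0)//.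
  by apply: wsum_over_le; rewrite ?q0.
rewrite -mulr_sumr -mulr_suml.
have -> : (D + q^-1) * (q^-1 * c^-1 ^+ 2) * expR (- (t * ln r)) =
  (D + q^-1) * (c^-1 ^+ 2 * (q^-1 * expR (- (t * ln r)))) by ring.
rewrite ler_wpM2l ?addr_ge0 ?(ltW D0) ?(ltW qi0)// ler_wpM2r//.
by rewrite mulr_ge0 ?(ltW qi0) ?expR_ge0.
Qed.

Lemma covering_lower : exists2 C : R, 0 < C & forall r n (z : 'I_n -> 'cV[R]_2),
  0 < r <= 1 / 2 -> covers E r z ->
  expR (- (t * ln r)) <= C * (1 - ln r) * n%:R.
Proof.
have [C1 C10 pack] := word_packing.
have [g g0 gap] := slope_gap Apos c_gt0 balanced sepA.
have [k [C0 [/andP[k_gt0 _] C00 stopW]]] := stopping_words.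
have ci0 : 0 < c^-1 by rewrite invr_gt0.
(* Two words share at most [4 * C1] over their slope difference, plus 1, balls. After multiplication
   by [wlen u], [slope_gap] bounds the first term and [wlen_le_const] the second. *)
pose C := 4 * C1 / g + c^-1 ^+ 2.
have C_gt0 : 0 < C by rewrite addr_gt0 ?exprn_gt0// divr_gt0// mulr_gt0.
(* Chosen so that [D * wlen w] times the number of balls of [w] is at least [whgt w / (k * r)],
   hence at least 1. *)
pose D := 3 / (rho * c * k).
have D_gt0 : 0 < D by rewrite divr_gt0// !mulr_gt0.
exists (3 / (rho * c) * (c^-1 * (1 + C * D * C0))).
  have rc : 0 < 3 / (rho * c) by rewrite divr_gt0// mulr_gt0.
  by apply: mulr_gt0 => //; apply: mulr_gt0 => //; exact: addr_gt0 ltr01 (mulr_gt0 (mulr_gt0 C_gt0 D_gt0) C00).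
move=> r N z /andP[r0 r2] cov.
have lnr : ln r <= 0 by rewrite ln_le0//; lra.
have [|n nle [hW /andP[psiW _]]] := stopW r; first by rewrite r0.
set W := stop_words _ _ _ _ in hW psiW.
have N_gt0 : (0 < N)%N.
  by have [x Ex] := E_neq0; have [i _ _] := cov _ Ex; exact: leq_ltn_trans (leq0n i) (ltn_ord i).
have ex w : exists p : nat * (nat -> 'I_N), w \in W ->
  [/\ rho * c * wsum A w / (3 * r) <= p.1%:R,
    (forall j, (j < p.1)%N ->
       `|(z (p.2 j)) 1 0 - slope w * (z (p.2 j)) 0 0 - intercept w| <= C1 * r) &
    (forall j j', (j < j')%N -> (j' < p.1)%N ->
       (j' - j)%:R * r <= `|(z (p.2 j')) 0 0 - (z (p.2 j)) 0 0|)].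
  case: (boolP (w \in W)) => wW; last by exists (0, fun=> Ordinal N_gt0).
  have /andP[_ hw] := hW _ wW.
  by have [p hp] := pack _ _ _ _ r0 cov hw; exists p.
have [p hp] := choice ex.
pose B w : {set 'I_N} := [set (p w).2 (val j) | j in 'I_((p w).1)]%SET.
have cardB w : w \in W -> #|B w| = (p w).1.
  move=> wW; rewrite card_imset ?card_ord// => i j eq_ij.
  have [_ _ sep] := hp _ wW; apply/val_inj/eqP; rewrite eqn_leq.
  have H (a b : 'I_((p w).1)) : (p w).2 (val a) = (p w).2 (val b) -> (val b <= val a)%N.
    move=> eq_ab; rewrite leqNgt; apply/negP => lt_ab.
    have := sep _ _ lt_ab (ltn_ord b); rewrite eq_ab subrr normr0.
    by apply/negP; rewrite -ltNge mulr_gt0// ltr0n subn_gt0.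
  by rewrite (H j i)// (H i j).
have wl := wlen_gt0 Apos detA.
have cross u i j v v' : i != j -> rcons u i ++ v \in W -> rcons u j ++ v' \in W ->
    #|B (rcons u i ++ v) :&: B (rcons u j ++ v')|%:R * wlen (A := A) u <= C.
  move=> neq wW w'W; have := gap u i j v v' neq.
  move: wW w'W; set w := rcons u i ++ v; set w' := rcons u j ++ v' => wW w'W hgap.
  have [_ str sep] := hp _ wW; have [_ str' _] := hp _ w'W.
  have sl0 : 0 < `|slope w - slope w'| by apply: lt_le_trans hgap; rewrite mulr_gt0.
  pose S : {set 'I_((p w).1)} := [set j | (p w).2 (val j) \in B w']%SET.
  have sub : B w :&: B w' \subset [set (p w).2 (val j) | j in S]%SET.
    apply/fintype.subsetP => x; rewrite inE => /andP[/imsetP[l _ ->] h].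
    by apply/imsetP; exists l => //; rewrite inE.
  have := leq_trans (subset_leq_card sub) (leq_imset_card _ _).
  rewrite -(ler_nat R) => le1.
  have le2 : #|S|%:R <= 4 * C1 / `|slope w - slope w'| + 1.
    apply: card_bounded_diam; last first.
      by rewrite divr_ge0// mulr_ge0// ltW.
    (* A common ball is near both axes; subtracting the two inequalities confines its first
       coordinate. *)
    have near l : l \in S -> `|(slope w - slope w') * (z ((p w).2 (val l))) 0 0 +
        (intercept w - intercept w')| <= 2 * C1 * r.
      rewrite inE => /imsetP[l' _ lE].
      have := str _ (ltn_ord l); have := str' _ (ltn_ord l'); rewrite -lE.
      by rewrite !ler_norml; lra.
    move=> l l' lS l'S; rewrite leq_eqVlt => /orP[/eqP->|ll'].
      by rewrite subnn divr_ge0// mulr_ge0// ltW.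
    have hsep := sep _ _ ll' (ltn_ord l').
    rewrite ler_pdivlMr// -(ler_pM2r r0).
    apply: le_trans (_ : `|(z ((p w).2 l')) 0 0 - (z ((p w).2 l)) 0 0| * `|slope w - slope w'| <= _).
      by rewrite mulrAC; apply: ler_wpM2r.
    rewrite -normrM; have := near _ lS; have := near _ l'S.
    by rewrite !ler_norml; lra.
  apply: le_trans (_ : (4 * C1 / `|slope w - slope w'| + 1) * wlen u <= _).
    by apply: ler_wpM2r; [exact: ltW (wl u)|exact: le_trans le1 le2].
  rewrite mulrDl mul1r /C; apply: lerD; last exact: wlen_le_const.
  rewrite mulrAC ler_pdivrMr// [leRHS]mulrAC ler_pdivlMr// -[leLHS]mulrA.
  by apply: ler_wpM2l; rewrite ?mulr_ge0 ?(ltW C10)// mulrC.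
have cardJ w : w \in W -> 1 <= D * wlen (A := A) w * #|B w|%:R.
  move=> wW; rewrite cardB//; have [hK _ _] := hp _ wW.
  have /andP[hw _] := hW _ wW.
  apply: le_trans (_ : D * (wdet A w / wsum A w ^+ 2) * (rho * c * wsum A w / (3 * r)) <= _).
    have -> : D * (wdet A w / wsum A w ^+ 2) * (rho * c * wsum A w / (3 * r)) =
       whgt w / (k * r).
      by rewrite /D /whgt; field; rewrite !gt_eqF.
    by rewrite ler_pdivlMr ?mulr_gt0// mul1r.
  have h2 : 0 <= wdet A w / wsum A w ^+ 2 by rewrite divr_ge0 ?exprn_ge0 ?(ltW (sum_gt0 w)).
  apply: ler_pM => //.
  - exact: mulr_ge0 (ltW D_gt0) h2.
  - by rewrite divr_ge0 ?mulr_ge0 ?(ltW rho_gt0) ?(ltW c_gt0) ?(ltW r0) ?(ltW (sum_gt0 w)).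
  - by apply: ler_wpM2l; [exact: ltW D_gt0|exact: wlen_ge].
have := @correlation_le _ _ whgt r _ B (wlen (A := A)) W C D (ltW C_gt0) D_gt0 wl
  (sum_wlen Apos detA sepA) cardJ cross n [::] (fun w h => h).
rewrite -/W; set Q := \sum_(x : 'I_N) _; set S := \sum_(w <- W) #|B w|%:R => QS.
have SE : S = \sum_(x : 'I_N) \sum_(w <- W) (x \in B w)%:R.
  rewrite exchange_big /=; apply: eq_bigr => w _.
  by rewrite -sum1_card natr_sum big_mkcond; apply: eq_bigr => x _; case: ifP.
have Sge : rho * c / 3 * (c * expR (- (t * ln r))) <= S.
  apply: le_trans (_ : \sum_(w <- W) rho * c / 3 * (wpsi A t w * expR (- (t * ln r))) <= _).
    rewrite -mulr_sumr -mulr_suml ler_wpM2l ?divr_ge0 ?mulr_ge0 ?(ltW rho_gt0) ?(ltW c_gt0)//.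
    by rewrite ler_wpM2r ?expR_ge0.
  rewrite /S big_seq [leRHS]big_seq; apply: ler_sum => w wW.
  rewrite cardB//; have [hK _ _] := hp _ wW; apply: le_trans hK.
  have /andP[_ hw] := hW _ wW.
  rewrite [leRHS](_ : _ = rho * c / 3 * (wsum A w / r)); last first.
    by field; rewrite gt_eqF.
  by rewrite ler_wpM2l ?wsum_over_ge// divr_ge0 ?mulr_ge0 ?(ltW rho_gt0) ?(ltW c_gt0).
have S_gt0 : 0 < S.
  by apply: lt_le_trans Sge; rewrite !mulr_gt0 ?expR_gt0// invr_gt0.
have NR : 0 < N%:R :> R by rewrite ltr0n.
(* Cauchy-Schwarz over the balls, from [2 * a * b <= a ^+ 2 + b ^+ 2] with [a] the mean multiplicity
   [S / N%:R]. *)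
have CS : S ^+ 2 <= N%:R * Q.
  have : 2 * (S / N%:R) * S <= N%:R * (S / N%:R) ^+ 2 + Q.
    rewrite [X in _ * X <= _]SE mulr_sumr.
    apply: le_trans (_ : \sum_(x : 'I_N) ((S / N%:R) ^+ 2 +
        (\sum_(w <- W) (x \in B w)%:R) ^+ 2) <= _).
      apply: ler_sum => x _; move: (S / _) (\sum_(w <- W) _) => a b.
      by have := sqr_ge0 (a - b); nra.
    by rewrite big_split /= sumr_const card_ord mulr_natl.
  have -> : 2 * (S / N%:R) * S = 2 * (S ^+ 2 / N%:R) by ring.
  have -> : N%:R * (S / N%:R) ^+ 2 = S ^+ 2 / N%:R by field; rewrite gt_eqF.
  by move=> h; rewrite mulrC -ler_pdivrMr//; lra.
have CD0 : 0 < C * D by exact: mulr_gt0 C_gt0 D_gt0.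
have SN : S <= N%:R * (1 + C * D * n%:R).
  rewrite -(ler_pM2r S_gt0) -expr2 -[leRHS]mulrA; apply: le_trans CS _.
  by apply: ler_wpM2l => //; exact: ltW.
have fin : 1 + C * D * n%:R <= (1 + C * D * C0) * (1 - ln r).
  have : C * D * n%:R <= C * D * (C0 * (1 - ln r)) by apply: ler_wpM2l => //; exact: ltW.
  lra.
have : rho * c / 3 * (c * expR (- (t * ln r))) <= N%:R * ((1 + C * D * C0) * (1 - ln r)).
  apply: le_trans Sge _; apply: le_trans SN _.
  by apply: ler_wpM2l => //; exact: ltW.
have rc : 0 < 3 / (rho * c) * c^-1 by rewrite mulr_gt0// divr_gt0// mulr_gt0.
rewrite -(ler_pM2l rc) => /le_trans h; apply: le_trans (h _ _).
  rewrite le_eqVlt; apply/orP; left; apply/eqP; field.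
  by rewrite !gt_eqF.
by rewrite le_eqVlt; apply/orP; left; apply/eqP; ring.
Qed.

End CoveringBounds.

(** * From covering bounds to the Minkowski dimension *)

Section MinkowskiLimit.
Context {R : realType}.

(** With [L = - ln r], [ln N] differs from [t * L] by constants and [ln (1 + L)]. Half of [e * L]
    absorbs the constants, the other half the logarithm. *)
Lemma minkowski_dim_bounds (E : set 'cV[R]_2) (t C1 C2 : R) : 0 < C1 -> 0 < C2 ->
  (forall r, 0 < r <= 1 / 2 -> exists2 s : seq 'cV[R]_2,
    (size s)%:R <= C1 * expR (- (t * ln r)) &
    forall x, E x -> exists2 z, z \in s & enorm (x - z) <= r) ->
  (forall r n (z : 'I_n -> 'cV[R]_2), 0 < r <= 1 / 2 -> covers E r z ->
    expR (- (t * ln r)) <= C2 * (1 - ln r) * n%:R) ->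
  has_minkowski_dim E t.
Proof.
move=> C10 C20 upper lower; apply/cvgrPdist_le => /= e e0.
pose d := e / 2; have d0 : 0 < d by rewrite divr_gt0.
pose K := `|ln C1| + `|ln C2| + d + `|ln d|.
have K0 : 0 <= K by rewrite !addr_ge0// ltW.
pose M := Num.max (2 * K / e) 1.
near=> r.
have r0 : 0 < r by near: r; exact: nbhs_right_gt.
have rM : r < expR (- M) by near: r; apply: nbhs_right_lt; exact: expR_gt0.
have r2 : r < 1 / 2 by near: r; apply: nbhs_right_lt; lra.
have rr : 0 < r <= 1 / 2 by rewrite r0 ltW.
pose L := - ln r.
have LM : M <= L.
  rewrite /L lerNr -(expRK (- M)) ler_ln ?posrE ?expR_gt0//; exact: ltW.
have L1 : 1 <= L by apply: le_trans LM; rewrite le_max lexx orbT.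
have LK : 2 * K / e <= L by apply: le_trans LM; rewrite le_max lexx.
have [s sz scov] := upper _ rr.
set N := covering_number E r.
have Nle : N <= C1 * expR (- (t * ln r)).
  by apply: le_trans sz; exact: covering_number_le scov.
have CL : 0 < C2 * (1 - ln r) by rewrite mulr_gt0//; move: L1; rewrite /L; lra.
have Nge : expR (- (t * ln r)) / (C2 * (1 - ln r)) <= N.
  apply: covering_number_ge.
    exists (size s), (tnth (in_tuple s)) => x /scov[z zs xz].
    by have /tnthP[i iz] : z \in in_tuple s by []; exists i => //=; rewrite -iz.
  by move=> n z cov; rewrite ler_pdivrMr// [leRHS]mulrC; exact: lower rr cov.
have N0 : 0 < N by apply: lt_le_trans Nge; rewrite divr_gt0 ?expR_gt0.
have lnN1 : ln N <= ln C1 + t * L.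
  rewrite -[X in _ <= _ + X](expRK) -lnM ?posrE ?expR_gt0//.
  by rewrite ler_ln ?posrE ?mulr_gt0 ?expR_gt0// /L mulrN.
have lnN2 : t * L - ln C2 - ln (1 + L) <= ln N.
  have : ln (expR (- (t * ln r)) / (C2 * (1 - ln r))) <= ln N.
    by rewrite ler_ln ?posrE ?divr_gt0 ?expR_gt0.
  rewrite ln_div ?posrE ?expR_gt0// expRK lnM ?posrE//; last by move: L1; rewrite /L; lra.
  by rewrite /L mulrN opprD addrA.
(* The inequality [ln y <= y] at [y = d * (1 + L)]. *)
have lnL : ln (1 + L) <= d * (1 + L) - ln d.
  have L10 : 0 < 1 + L by lra.
  have : ln (d * (1 + L)) <= d * (1 + L).
    apply: ltW; rewrite -[X in _ < X]expRK ltr_ln ?posrE ?expR_gt0 ?mulr_gt0//.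
    apply: lt_le_trans (expR_ge1Dx _); lra.
  by rewrite lnM ?posrE//; lra.
rewrite /minkowski_ratio -/N -/L.
have L0 : 0 < L by lra.
have -> : t - ln N / L = (t * L - ln N) / L by field; rewrite gt_eqF.
rewrite normrM normfV (gtr0_norm L0) ler_pdivrMr// ler_norml.
have KL : K <= d * L.
  move: LK; rewrite ler_pdivrMr// /d; lra.
have dL : e * L = d * L + d * L by rewrite /d; field.
have := (ler_norm (ln C1), ler_norm (ln C2), ler_norm (- ln d)).
rewrite normrN => -[[h1 h2] h3].
move: KL; rewrite /K dL.
have := (normr_ge0 (ln C1), normr_ge0 (ln C2), normr_ge0 (ln d)) => -[[p1 p2] p3].
move=> KL; apply/andP; split; lra.
Unshelve. all: by end_near.
Qed.

End MinkowskiLimit.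

(** * Singular values and pressure *)

Section SingularValues.
Context {R : realType}.
Implicit Types (M : 'M[R]_2).

Lemma eigenvalue_det2 (G : 'M[R]_2) (l : R) :
  eigenvalue G l = ((G 0 0 - l) * (G 1 1 - l) - G 0 1 * G 1 0 == 0).
Proof.
rewrite /eigenvalue /eigenspace kermx_eq0 row_free_unit unitmxE unitfE negbK det2E.
by rewrite !mxE /= mulr1n mulr0n !subr0.
Qed.

(** The square root of the discriminant of the characteristic polynomial of a symmetric [G]; [ltop]
    and [lbot] are its roots, which makes the supremum and infimum in [alpha1] and [alpha2]
    explicit. *)
Let disc (G : 'M[R]_2) := Num.sqrt ((G 0 0 - G 1 1) ^+ 2 + 4 * G 0 1 ^+ 2).

Let ltop (G : 'M[R]_2) := (G 0 0 + G 1 1 + disc G) / 2.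
Let lbot (G : 'M[R]_2) := (G 0 0 + G 1 1 - disc G) / 2.

Let disc_sqr (G : 'M[R]_2) : disc G ^+ 2 = (G 0 0 - G 1 1) ^+ 2 + 4 * G 0 1 ^+ 2.
Proof. by rewrite sqr_sqrtr// addr_ge0 ?sqr_ge0// mulr_ge0// sqr_ge0. Qed.

Let disc_ge0 (G : 'M[R]_2) : 0 <= disc G. Proof. exact: sqrtr_ge0. Qed.

Let spectrum (G : 'M[R]_2) : G 1 0 = G 0 1 ->
  [set l | eigenvalue G l] = [set l | l = ltop G \/ l = lbot G].
Proof.
move=> sym; apply/seteqP; split => l /=; rewrite eigenvalue_det2 sym.
  move=> /eqP h.
  have : (l - ltop G) * (l - lbot G) = 0.
    rewrite -[RHS]h /ltop /lbot; have := disc_sqr G; lra.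
  by move/eqP; rewrite mulf_eq0 !subr_eq0 => /orP[]/eqP; [left|right].
by case=> ->; apply/eqP; rewrite /ltop /lbot; have := disc_sqr G; lra.
Qed.

Let bot_le_top (G : 'M[R]_2) : lbot G <= ltop G.
Proof. by rewrite /lbot /ltop; have := disc_ge0 G; lra. Qed.

Let sup_spectrum (G : 'M[R]_2) : G 1 0 = G 0 1 -> sup [set l | eigenvalue G l] = ltop G.
Proof.
move=> sym; rewrite spectrum//; apply/eqP; rewrite eq_le; apply/andP; split.
  by apply: ge_sup; [exists (ltop G); left | move=> _ [->|->]//; exact: bot_le_top].
by apply: ub_le_sup; [exists (ltop G) => _ [->|->]//; exact: bot_le_top | left].
Qed.

Let inf_spectrum (G : 'M[R]_2) : G 1 0 = G 0 1 -> inf [set l | eigenvalue G l] = lbot G.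
Proof.
move=> sym; rewrite spectrum//; apply/eqP; rewrite eq_le; apply/andP; split.
  by apply: ge_inf; [exists (lbot G) => _ [->|->]//; exact: bot_le_top | right].
by apply: lb_le_inf; [exists (ltop G); left | move=> _ [->|->]//; exact: bot_le_top].
Qed.

Lemma gramE M i j : (M^T *m M) i j = M 0 i * M 0 j + M 1 i * M 1 j.
Proof. by rewrite mulmx2E !mxE. Qed.

Let gram_sym M : (M^T *m M) 1 0 = (M^T *m M) 0 1.
Proof. by rewrite !gramE; ring. Qed.

Let prod_top_bot M : ltop (M^T *m M) * lbot (M^T *m M) = \det M ^+ 2.
Proof.
have h := disc_sqr (M^T *m M).
have -> : ltop (M^T *m M) * lbot (M^T *m M) =
    (((M^T *m M) 0 0 + (M^T *m M) 1 1) ^+ 2 - disc (M^T *m M) ^+ 2) / 4.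
  by rewrite /ltop /lbot; field.
by rewrite h !gramE det2E; field.
Qed.

Let top_ge M : ((M^T *m M) 0 0 + (M^T *m M) 1 1) / 2 <= ltop (M^T *m M).
Proof. by rewrite /ltop; have := disc_ge0 (M^T *m M); lra. Qed.

Let gram_ge0 M i : 0 <= (M^T *m M) i i.
Proof. by rewrite gramE -!expr2 addr_ge0 ?sqr_ge0. Qed.

Let top_ge0 M : 0 <= ltop (M^T *m M).
Proof. by apply: le_trans (top_ge M); rewrite divr_ge0 ?addr_ge0. Qed.

Let bot_ge0 M : 0 <= lbot (M^T *m M).
Proof.
rewrite /lbot divr_ge0// subr_ge0 -ler_sqr ?nnegrE ?addr_ge0// disc_sqr !gramE.
have := sqr_ge0 (M 0 0 * M 1 1 - M 0 1 * M 1 0); nra.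
Qed.

Lemma alpha1_ge0 M : 0 <= alpha1 M. Proof. exact: sqrtr_ge0. Qed.

Lemma alpha2_ge0 M : 0 <= alpha2 M. Proof. exact: sqrtr_ge0. Qed.

Lemma alpha2_le_alpha1 M : alpha2 M <= alpha1 M.
Proof. by rewrite /alpha1 /alpha2 sup_spectrum// inf_spectrum// ler_wsqrtr. Qed.

Lemma alpha_mul M : alpha1 M * alpha2 M = `|\det M|.
Proof.
rewrite /alpha1 /alpha2 sup_spectrum// inf_spectrum// -sqrtrM//.
by rewrite prod_top_bot sqrtr_sqr.
Qed.

Lemma gram_le_alpha1 M i : (M^T *m M) i i <= alpha1 M ^+ 2.
Proof.
rewrite /alpha1 sup_spectrum// sqr_sqrtr// /ltop.
set G := M^T *m M.
have h : `|G 0 0 - G 1 1| <= disc G.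
  by rewrite -sqrtr_sqr ler_wsqrtr// lerDl mulr_ge0// sqr_ge0.
by move: h; rewrite ler_norml => /andP[h1 h2]; move: i; apply: ord2P; lra.
Qed.

Lemma alpha1_le_mxsum M : (forall i j, 0 <= M i j) -> alpha1 M <= mxsum M.
Proof.
move=> M0; have s0 : 0 <= mxsum M by rewrite !addr_ge0.
rewrite -ler_sqr ?nnegrE ?alpha1_ge0// /alpha1 sup_spectrum// sqr_sqrtr//.
apply: le_trans (_ : (M^T *m M) 0 0 + (M^T *m M) 1 1 <= _).
  have := bot_ge0 M; rewrite /lbot /ltop; lra.
rewrite !gramE /mxsum; have := (M0 0 0, M0 0 1, M0 1 0, M0 1 1) => -[[[]]].
by move=> *; nra.
Qed.

(** The squared sum of four entries is at most 4 times the sum of their squares, which is the trace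
    of [M^T *m M], at most [2 * alpha1 M ^+ 2]; and 8 is below [3 ^+ 2]. *)
Lemma mxsum_le_alpha1 M : mxsum M <= 3 * alpha1 M.
Proof.
case: (leP 0 (mxsum M)) => [s0|/ltW s0]; last first.
  by apply: le_trans s0 _; rewrite mulr_ge0 ?alpha1_ge0.
rewrite -ler_sqr ?nnegrE ?mulr_ge0 ?alpha1_ge0// exprMn.
have := (gram_le_alpha1 M 0, gram_le_alpha1 M 1) => -[].
rewrite !gramE /mxsum.
have := (sqr_ge0 (M 0 0 - M 0 1), sqr_ge0 (M 0 0 - M 1 0), sqr_ge0 (M 0 0 - M 1 1)).
have := (sqr_ge0 (M 0 1 - M 1 0), sqr_ge0 (M 0 1 - M 1 1), sqr_ge0 (M 1 0 - M 1 1)).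
move=> [[h1 h2] h3] [[h4 h5] h6] h7 h8; have := sqr_ge0 (alpha1 M).
nra.
Qed.

(* By Perron-Frobenius the top eigenvector of [M^T M] lies in the positive
   quadrant, up to sign. *)
Lemma theta1_same_sign M th : (forall i j, 0 < M i j) -> is_theta1 M th ->
  0 <= th 0 0 * th 1 0.
Proof.
move=> M0 [_ /(congr1 (fun x : 'cV[R]_2 => x 0 0))].
rewrite mulmx2E [in RHS]mxE => h.
have b0 : 0 < (M^T *m M) 0 1 by rewrite gramE addr_gt0 ?mulr_gt0.
have := gram_le_alpha1 M 0; move: (M^T *m M) h b0 => G h b0 ge.
rewrite -(pmulr_rge0 _ b0).
(* The first row of the eigenvector equation, multiplied by [th 0 0]. *)
have -> : G 0 1 * (th 0 0 * th 1 0) = (alpha1 M ^+ 2 - G 0 0) * th 0 0 ^+ 2.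
  rewrite mulrBl [alpha1 M ^+ 2 * th 0 0 ^+ 2]mulrA -h; ring.
by rewrite mulr_ge0 ?sqr_ge0// subr_ge0.
Qed.

Lemma alpha1_gt0 M : \det M != 0 -> 0 < alpha1 M.
Proof.
move=> dM; rewrite lt_neqAle alpha1_ge0 andbT; apply/eqP => a0.
by move: (alpha_mul M); rewrite -a0 mul0r => /esym/eqP; rewrite normr_eq0 (negPf dM).
Qed.

Lemma alpha2_gt0 M : \det M != 0 -> 0 < alpha2 M.
Proof.
move=> dM; rewrite lt_neqAle alpha2_ge0 andbT; apply/eqP => a0.
by move: (alpha_mul M); rewrite -a0 mulr0 => /esym/eqP; rewrite normr_eq0 (negPf dM).
Qed.

Definition log_svf (s : R) M : R :=
  if s < 1 then s * ln (alpha1 M)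
  else if s < 2 then ln (alpha1 M) + (s - 1) * ln (alpha2 M)
  else s / 2 * (ln (alpha1 M) + ln (alpha2 M)).

Lemma svf_exp s M : \det M != 0 -> svf s M = expR (log_svf s M).
Proof.
move=> dM; rewrite /svf /log_svf /powR.
have a1 := alpha1_gt0 dM; have a2 := alpha2_gt0 dM.
case: ifP => _; first by rewrite gt_eqF.
case: ifP => _; first by rewrite gt_eqF// expRD lnK ?posrE.
by rewrite normr_eq0 (negPf dM) -alpha_mul lnM ?posrE.
Qed.

(** [log_svf] is piecewise linear in [s], with slopes [ln (alpha1 M)], [ln (alpha2 M)] and their
    mean on the three ranges. Each slope is at most [ln q]. *)
Lemma log_svf_shift (s t q : R) M : \det M != 0 -> alpha1 M <= q -> 0 <= s ->
  1 <= t < 2 ->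
  (t <= s -> log_svf s M <= log_svf t M + (s - t) * ln q) /\
  (s <= t -> log_svf t M <= log_svf s M + (t - s) * ln q).
Proof.
move=> dM aq s0 /andP[t1 t2].
have a1 := alpha1_gt0 dM; have a2 := alpha2_gt0 dM.
have l1 : ln (alpha1 M) <= ln q by rewrite ler_ln ?posrE//; apply: lt_le_trans aq.
have l2 : ln (alpha2 M) <= ln (alpha1 M) by rewrite ler_ln ?posrE// alpha2_le_alpha1.
have tE : log_svf t M = ln (alpha1 M) + (t - 1) * ln (alpha2 M).
  by rewrite /log_svf ltNge t1 /= t2.
rewrite tE /log_svf; move: l1 l2.
move: (ln (alpha1 M)) (ln (alpha2 M)) (ln q) => x y z xz yx.
have yz := le_trans yx xz.
have pos (k u : R) : 0 <= k -> u <= z -> k * u <= k * z.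
  by move=> k0 uz; apply: ler_wpM2l.
split=> st.
  case: (ltP s 1) => s1; first by exfalso; lra.
  case: (ltP s 2) => s2.
    by have := pos (s - t) y; rewrite subr_ge0 => /(_ st yz); lra.
  have := pos (s / 2 - 1) x; have := pos (s / 2 - t + 1) y.
  by move=> /(_ _ yz) h1 /(_ _ xz) h2; have := h1 (ltac:(lra)); have := h2 (ltac:(lra)); lra.
case: (ltP s 1) => s1.
  have := pos (1 - s) x; have := pos (t - 1) y.
  by move=> /(_ _ yz) h1 /(_ _ xz) h2; have := h1 (ltac:(lra)); have := h2 (ltac:(lra)); lra.
rewrite (le_lt_trans st t2).
by have := pos (t - s) y; rewrite subr_ge0 => /(_ st yz); lra.
Qed.

End SingularValues.

Section PressureZero.
Context {R : realType} {kappa : nat} {A : 'I_kappa -> 'M[R]_2} {c lam t : R}.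
Hypothesis kappa_gt0 : (0 < kappa)%N.
Hypothesis Apos : forall i a b, 0 < A i a b.
Hypothesis detA : forall i, \det (A i) != 0.
Hypotheses (lam_gt0 : 0 < lam) (lam_lt1 : lam < 1).
Hypothesis contr : forall w, wsum A w <= 2 * lam ^+ size w.
Hypotheses (t_ge1 : 1 <= t) (t_lt2 : t < 2).
Hypothesis level_bounds : forall n, 1 <= level_sum A t n <= c^-1.

Let detW w : \det (word_mx A w) != 0.
Proof. by have := wdet_gt0 w detA; rewrite normr_gt0. Qed.

Let sum_gt0 := wsum_gt0 Apos.

Lemma svf_wpsi w :
  wpsi A t w <= 3 * svf t (word_mx A w) /\ svf t (word_mx A w) <= wpsi A t w.
Proof.
have a1 := alpha1_gt0 (detW w); have a2 := alpha2_gt0 (detW w).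
have h1 : ln (alpha1 (word_mx A w)) <= ln (wsum A w).
  by rewrite ler_ln ?posrE//; apply: alpha1_le_mxsum => i j; exact: word_mx_ge0.
have h2 : ln (wsum A w) <= ln 3 + ln (alpha1 (word_mx A w)).
  rewrite -lnM ?posrE// ler_ln ?posrE ?mulr_gt0//; exact: mxsum_le_alpha1.
have l3 : 0 <= ln 3 :> R by rewrite ln_ge0// ler1n.
have dE : ln (wdet A w) = ln (alpha1 (word_mx A w)) + ln (alpha2 (word_mx A w)).
  by rewrite /wdet -alpha_mul lnM ?posrE.
rewrite svf_exp// -[X in X * expR _]lnK ?posrE// -expRD !ler_expR.
rewrite /log_svf ltNge t_ge1 /= t_lt2 dE.
move: h1 h2; move: (ln (wsum A w)) (ln (alpha1 _)) (ln (alpha2 _)) => n x y h1 h2.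
have e1 : (2 - t) * x <= (2 - t) * n by rewrite ler_wpM2l// subr_ge0 ltW.
have e2 : (2 - t) * n <= (2 - t) * (ln 3 + x) by rewrite ler_wpM2l// subr_ge0 ltW.
have e3 : 0 <= (t - 1) * ln 3 by rewrite mulr_ge0// subr_ge0.
by split; lra.
Qed.

Let T (s : R) n := \sum_(w : n.-tuple 'I_kappa) svf s (word_mx A w).

Let T_gt0 s n : 0 < T s n.
Proof.
rewrite /T (bigD1 [tuple of nseq n (Ordinal kappa_gt0)])//=.
rewrite ltr_pwDl ?svf_exp ?expR_gt0// sumr_ge0// => i _.
by rewrite svf_exp// expR_ge0.
Qed.

Let T_bounds n : ln (T t n) <= `|ln c| /\ - ln 3 <= ln (T t n).
Proof.
have /andP[l1 l2] := level_bounds n.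
have c0 : 0 < c^-1 by apply: lt_le_trans l2; apply: lt_le_trans l1.
split.
  apply: le_trans (_ : ln c^-1 <= _); last first.
    have c00 : 0 < c by rewrite -invr_gt0.
    by rewrite lnV ?posrE// -normrN ler_norm.
  rewrite ler_ln ?posrE//; apply: le_trans l2; apply: ler_sum => w _.
  by have [] := svf_wpsi w.
rewrite -lnV ?posrE// ler_ln ?posrE ?invr_gt0//.
rewrite -[leLHS]mulr1 ler_pdivrMl//.
apply: le_trans l1 _; rewrite /T mulr_sumr; apply: ler_sum => w _.
by have [] := svf_wpsi w.
Qed.

Let T_shift s n : 0 <= s ->
  (t <= s -> ln (T s n) <= ln (T t n) + (s - t) * ln (2 * lam ^+ n)) /\
  (s <= t -> ln (T t n) <= ln (T s n) + (t - s) * ln (2 * lam ^+ n)).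
Proof.
move=> s0; have t12 : 1 <= t < 2 by rewrite t_ge1.
have sh (w : n.-tuple 'I_kappa) : alpha1 (word_mx A w) <= 2 * lam ^+ n.
  apply: le_trans (alpha1_le_mxsum (word_mx_ge0 Apos w)) _.
  by have := contr w; rewrite size_tuple.
split=> st; rewrite -[X in _ <= _ + X]expRK -lnM ?posrE ?expR_gt0//.
  rewrite ler_ln ?posrE ?mulr_gt0 ?expR_gt0// /T mulr_suml; apply: ler_sum => w _.
  rewrite !svf_exp// -expRD ler_expR.
  by have [h _] := log_svf_shift (detW w) (sh w) s0 t12; exact: h.
rewrite ler_ln ?posrE ?mulr_gt0 ?expR_gt0// /T mulr_suml; apply: ler_sum => w _.
rewrite !svf_exp// -expRD ler_expR.
by have [_ h] := log_svf_shift (detW w) (sh w) s0 t12; exact: h.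
Qed.

(** At [t] the logarithms of the sums are bounded. Moving to [s] changes them by at least
    [n * |s - t| * (- ln lam)] up to a constant, so the pressure sequence at [s] stays away from
    0. *)
Lemma pressure_zero : is_pressure_zero A t.
Proof.
split; first exact: lt_le_trans ltr01 t_ge1.
have ln2 : 0 <= ln 2 :> R by rewrite ln_ge0// ler1n.
have ln3 : 0 <= ln 3 :> R by rewrite ln_ge0// ler1n.
have lnlam : ln lam < 0 by rewrite ln_lt0// lam_gt0.
pose B := `|ln c| + ln 3.
have B0 : 0 <= B by rewrite addr_ge0.
have bnd n : `|ln (T t n)| <= B.
  have [h1 h2] := T_bounds n; rewrite ler_norml /B.
  by have := normr_ge0 (ln c); lra.
have pE s n : pressure_seq A s n = n%:R^-1 * ln (T s n) by [].
move=> s s0; split; last first.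
  move=> ->; apply/cvgrPdist_le => e e0; near=> n.
  have n0 : 0 < n%:R :> R by near: n; exact: nbhs_infty_gtr.
  have nB : B / e < n%:R by near: n; exact: nbhs_infty_gtr.
  rewrite sub0r normrN pE normrM ger0_norm ?invr_ge0 ?ler0n// ler_pdivrMl//.
  by apply: le_trans (bnd n) _; rewrite -ler_pdivrMr// ltW.
move=> /cvgrPdist_lt lim; apply/eqP/negPn/negP => st.
pose h := `|s - t|; have h0 : 0 < h by rewrite normr_gt0 subr_eq0.
pose sg := h * - ln lam; have sg0 : 0 < sg by rewrite mulr_gt0// oppr_gt0.
pose K := B + h * ln 2.
have sg20 : 0 < sg / 2 by rewrite divr_gt0.
suff : \forall n \near \oo, False by case=> N _ /(_ N (leqnn N)).
near=> n.
have n0 : 0 < n%:R :> R by near: n; exact: nbhs_infty_gtr.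
have nK : K / (sg / 2) < n%:R by near: n; exact: nbhs_infty_gtr.
have : `|0 - pressure_seq A s n| < sg / 2 by near: n; exact: lim.
rewrite sub0r normrN pE normrM ger0_norm ?invr_ge0 ?ler0n// ltr_pdivrMl//.
rewrite ltr_pdivrMr// in nK.
have lnE : ln (2 * lam ^+ n) = ln 2 + n%:R * ln lam.
  by rewrite lnM ?posrE ?exprn_gt0// lnXn// -[ln lam *+ _]mulr_natl.
have [h1 h2] := T_shift n s0; have := bnd n; rewrite ler_norml => /andP[b1 b2].
have : n%:R * sg - K <= `|ln (T s n)|.
  rewrite /sg /K /h; case: (leP t s) => ts.
    rewrite ger0_norm ?subr_ge0// -[leRHS]normrN; apply: le_trans (ler_norm _).
    by have := h1 ts; rewrite lnE; lra.
  rewrite ltr0_norm ?subr_lt0//; apply: le_trans (ler_norm _).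
  by have := h2 (ltW ts); rewrite lnE; lra.
move=> l1 l2; move: nK; apply/negP; rewrite -leNgt.
by lra.
Unshelve. all: by end_near.
Qed.

End PressureZero.

(** * The invariant set and its projections *)

Section EuclideanNorm.
Context {R : realType}.
Implicit Types (x y : 'cV[R]_2) (M : 'M[R]_2).

Lemma dotp_le x y : `|dotp x y| <= enorm x * enorm y.
Proof.
rewrite -ler_sqr ?nnegrE ?mulr_ge0 ?enorm_ge0// exprMn !enorm_sqr !dotpE.
rewrite real_normK ?num_real//.
have := sqr_ge0 (x 0 0 * y 1 0 - x 1 0 * y 0 0).
by move: (x 0 0) (x 1 0) (y 0 0) (y 1 0) => a b c d; nra.
Qed.

Lemma enormD x y : enorm (x + y) <= enorm x + enorm y.
Proof.
rewrite -ler_sqr ?nnegrE ?addr_ge0 ?enorm_ge0// sqrrD !enorm_sqr.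
have := le_trans (ler_norm _) (dotp_le x y).
rewrite !dotpE !mxE; lra.
Qed.

Lemma enormZ (k : R) x : enorm (k *: x) = `|k| * enorm x.
Proof.
rewrite /enorm -sqrtr_sqr -sqrtrM ?sqr_ge0//; congr Num.sqrt.
by rewrite !dotpE !mxE; ring.
Qed.

Lemma enorm_eq0 x : enorm x = 0 -> x = 0.
Proof.
move=> h; have z i : x i 0 = 0.
  by apply/eqP; rewrite -normr_eq0 eq_le normr_ge0 andbT -h coord_le_enorm.
by apply: col2P; rewrite z mxE.
Qed.

Lemma enorm_mulmx_le M x : enorm (M *m x) <= opnorm M * enorm x.
Proof.
have [x0|x0] := eqVneq (enorm x) 0.
  rewrite x0 mulr0; have -> : M *m x = 0 by rewrite (enorm_eq0 x0) mulmx0.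
  by rewrite /enorm dotpE !mxE !mul0r addr0 sqrtr0.
have xp : 0 < enorm x by rewrite lt_neqAle eq_sym x0 enorm_ge0.
rewrite -ler_pdivrMr//.
have -> : enorm (M *m x) / enorm x = enorm (M *m ((enorm x)^-1 *: x)).
  by rewrite -scalemxAr enormZ ger0_norm ?invr_ge0 ?enorm_ge0// mulrC.
apply: ub_le_sup; last first.
  exists ((enorm x)^-1 *: x) => //=.
  by rewrite enormZ ger0_norm ?invr_ge0 ?enorm_ge0// mulVf.
exists (`|M 0 0| + `|M 0 1| + (`|M 1 0| + `|M 1 1|)) => _ [y /= y1 <-].
apply: le_trans (enorm_le_sum _) _; rewrite !mulmx2E.
have h i j : `|M i j * y j 0| <= `|M i j|.
  by rewrite normrM ler_piMr// -y1 coord_le_enorm.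
by apply: lerD; apply: le_trans (ler_normD _ _) _; apply: lerD.
Qed.

(** The square of [enorm (M^T *m x)] is the product of [x] with [M *m (M^T *m x)]; one factor
    cancels. *)
Lemma enorm_trmx_le M (q : R) : 0 <= q -> (forall x, enorm (M *m x) <= q * enorm x) ->
  forall x, enorm (M^T *m x) <= q * enorm x.
Proof.
move=> q0 hM x; have [->|x0] := eqVneq (enorm (M^T *m x)) 0.
  by rewrite mulr_ge0 ?enorm_ge0.
have xp : 0 < enorm (M^T *m x) by rewrite lt_neqAle eq_sym x0 enorm_ge0.
rewrite -(ler_pM2r xp) -expr2 enorm_sqr.
have -> : dotp (M^T *m x) (M^T *m x) = dotp x (M *m (M^T *m x)).
  by rewrite !dotpE !mulmx2E !mxE; ring.
apply: le_trans (le_trans (ler_norm _) (dotp_le _ _)) _.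
rewrite mulrAC mulrC ler_wpM2r ?enorm_ge0//; exact: hM.
Qed.

Lemma cvg_mx (T : Type) (F : set_system T) (FF : Filter F) m n
    (f : T -> 'M[R]_(m, n)) (M : 'M[R]_(m, n)) :
  (forall i j, f x i j @[x --> F] --> M i j) -> f x @[x --> F] --> M.
Proof.
move=> h B [P MP sPB]; rewrite /nbhs /=; apply: filterS (_ : F _).
  by move=> x; exact: (sPB (f x)).
by apply: filter_forall => i; apply: filter_forall => j; exact: h (MP i j).
Qed.

Lemma compact_box (q : R) : compact [set x : 'cV[R]_2 | forall i, `|x i 0| <= q].
Proof.
pose f (p : R * R) : 'cV[R]_2 := vec2 p.1 p.2.
have -> : [set x : 'cV[R]_2 | forall i, `|x i 0| <= q] =
    f @` (`[- q, q]%classic `*` `[- q, q]%classic).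
  apply/seteqP; split => [x /= h|_ [[a b] [/= ha hb] <-]]; last first.
    move: ha hb; rewrite !in_itv /= => ha hb.
    by apply: ord2P; rewrite ?vec2_0 ?vec2_1 ler_norml.
  exists (x 0 0, x 1 0) => /=; first by rewrite !in_itv /= -!ler_norml.
  by apply: col2P; rewrite ?vec2_0 ?vec2_1.
apply: continuous_compact; last by apply: compact_setX; exact: segment_compact.
apply: continuous_subspaceT => p; apply: cvg_mx => i j; rewrite ord1 /f.
move: i; apply: ord2P.
  rewrite vec2_0 (_ : (fun p => _) = fst); last by apply/funext => r; rewrite vec2_0.
  exact: cvg_fst.
rewrite vec2_1 (_ : (fun p => _) = snd); last by apply/funext => r; rewrite vec2_1.
exact: cvg_snd.
Qed.

End EuclideanNorm.

Section InvariantSet.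
Context {R : realType} {kappa : nat} {Phi : ifs_space R kappa} {lam : R}.
Local Notation A := (lin_part Phi).
Hypothesis lam_gt0 : 0 < lam.
Hypothesis lam_lt1 : lam < 1.
Hypothesis contrA : forall i x, enorm (A i *m x) <= lam * enorm x.

(** The determinant of [1 - A i], as a polynomial in the entries, so that fixed points are visibly
    continuous in the system. *)
Definition fix_det i : R := (1 - A i 0 0) * (1 - A i 1 1) - A i 0 1 * A i 1 0.

(* Cramer's rule for [(1 - A i) x = a i]. *)
Definition fixpt i : 'cV[R]_2 :=
  vec2 (((1 - A i 1 1) * (Phi i).2 0 0 + A i 0 1 * (Phi i).2 1 0) / fix_det i)
       ((A i 1 0 * (Phi i).2 0 0 + (1 - A i 0 0) * (Phi i).2 1 0) / fix_det i).

Lemma fix_det_neq0 i : fix_det i != 0.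
Proof.
(* [det0P] yields a row vector, hence the transposes. Its transpose would be a nonzero vector fixed
   by a contraction. *)
have -> : fix_det i = \det (1%:M - A i)^T.
  by rewrite det_tr det2E !mxE /fix_det /=; ring.
apply/det0P => -[v v0 hv].
have hx : A i *m v^T = v^T.
  have : (1%:M - A i) *m v^T = 0.
    by rewrite -[_ - _]trmxK -trmx_mul hv trmx0.
  by rewrite mulmxBl mul1mx => /eqP; rewrite subr_eq0 => /eqP.
have := contrA i v^T; rewrite hx => le1.
have n0 : enorm v^T = 0.
  apply/eqP; rewrite eq_le enorm_ge0 andbT -(@pmulr_rle0 _ (1 - lam)) ?subr_gt0//.
  by rewrite mulrBl mul1r subr_le0.
by move/negP: v0; apply; rewrite -(trmxK v) (enorm_eq0 n0) trmx0.
Qed.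

Lemma fixptP i : affine_map Phi i (fixpt i) = fixpt i.
Proof.
have d0 := fix_det_neq0 i; rewrite /affine_map -/(lin_part Phi i).
by apply: col2P; rewrite mxE mulmx2E !vec2_0 !vec2_1; move: d0;
  rewrite /fix_det => d0; field.
Qed.

Lemma word_mx_contr w x : enorm (word_mx A w *m x) <= lam ^+ size w * enorm x.
Proof.
elim: w => [|i w IH]; first by rewrite word_mx_nil mul1mx expr0 mul1r.
rewrite word_mx_cons -mulmxE -mulmxA; apply: le_trans (contrA _ _) _.
by rewrite exprS -mulrA ler_wpM2l// ltW.
Qed.

(** The entry sum is the coordinate sum of the image of [(1, 1)]. The factor 2 is the square root of
    2 taken twice, for the norm of [(1, 1)] and for coordinate sum against norm. *)
Lemma wsum_contr w : wsum A w <= 2 * lam ^+ size w.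
Proof.
have := word_mx_contr w (vec2 1 1).
have := enorm_sqr (word_mx A w *m vec2 1 1); have := enorm_sqr (vec2 (1 : R) 1).
have := enorm_ge0 (word_mx A w *m vec2 1 1); have := enorm_ge0 (vec2 (1 : R) 1).
have -> : wsum A w = (word_mx A w *m vec2 1 1) 0 0 + (word_mx A w *m vec2 1 1) 1 0.
  by rewrite /wsum /mxsum !mulmx2E !vec2_0 !vec2_1; ring.
have l0 : 0 <= lam ^+ size w by rewrite exprn_ge0// ltW.
move: (word_mx A w *m vec2 1 1) l0 => y; move: (lam ^+ _) => l l0.
rewrite !dotpE !vec2_0 !vec2_1; move: (enorm _) (enorm _) (y 0 0) (y 1 0).
move=> k n a b n0 k0 n2 k2 le.
have [ab|/ltW ab] := leP 0 (a + b); last first.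
  by apply: le_trans ab _; rewrite mulr_ge0.
rewrite -ler_sqr ?nnegrE ?mulr_ge0//.
have : k ^+ 2 <= (l * n) ^+ 2 by rewrite ler_sqr ?nnegrE ?mulr_ge0.
rewrite !exprMn n2 k2; have := sqr_ge0 (a - b); nra.
Qed.

Lemma affine_map_continuous i : continuous (affine_map Phi i).
Proof.
move=> x; apply: (cvg_mx (nbhs_filter x)) => k j; rewrite ord1.
have E : (fun y => affine_map Phi i y k 0) =
   (fun y : 'cV[R]_2 => A i k 0 * y 0 0 + A i k 1 * y 1 0 + (Phi i).2 k 0).
  by apply/funext => y; rewrite /affine_map mxE mulmx2E.
have Ex : affine_map Phi i x k 0 = A i k 0 * x 0 0 + A i k 1 * x 1 0 + (Phi i).2 k 0.
  by rewrite /affine_map mxE mulmx2E.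
rewrite Ex E; apply: cvgD; last exact: cvg_cst.
by apply: cvgD; apply: cvgM; [exact: cvg_cst | exact: coord_continuous
  | exact: cvg_cst | exact: coord_continuous].
Qed.

(** The closure of the orbit of one fixed point under all words: bounded, hence compact, and mapped
    into itself by continuity. *)
Lemma invariant_set_exists : (0 < kappa)%N -> exists E : set 'cV[R]_2,
  [/\ E !=set0, compact E & E = \bigcup_i (affine_map Phi i @` E)].
Proof.
move=> k0; pose i0 := Ordinal k0; pose p := fixpt i0.
pose O := [set word_map (Phi := Phi) w p | w in setT].
pose m := \sum_i enorm (Phi i).2.
(* The ball of this radius contains [p] and is invariant, because [lam * q + m <= q]. *)
pose q := enorm p + m / (1 - lam).
have l1 : 0 < 1 - lam by rewrite subr_gt0.
have m0 i : enorm (Phi i).2 <= m.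
  by rewrite /m (bigD1 i)//= lerDl sumr_ge0// => j _; exact: enorm_ge0.
have bO w : enorm (word_map (Phi := Phi) w p) <= q.
  elim: w => [|i w IH] /=.
    by rewrite /q lerDl divr_ge0 ?(ltW l1)// sumr_ge0// => j _; exact: enorm_ge0.
  apply: le_trans (enormD _ _) _; apply: le_trans (lerD (contrA i _) (m0 i)) _.
  apply: le_trans (_ : lam * q + m <= _); first by rewrite lerD2r ler_wpM2l// ltW.
  have : (1 - lam) * q = (1 - lam) * enorm p + m by rewrite /q; field; rewrite gt_eqF.
  have : 0 <= (1 - lam) * enorm p by rewrite mulr_ge0 ?enorm_ge0// ltW.
  lra.
have box := @compact_box R q.
have haus : hausdorff_space 'cV[R]_2 by exact: norm_hausdorff.
have cO : compact (closure O).
  apply: (subclosed_compact _ box); first exact: closed_closure.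
  rewrite (proj1 (closure_id _) (compact_closed haus box)).
  apply: closure_subset => _ [w _ <-] i.
  exact: le_trans (coord_le_enorm _ _) (bO w).
exists (closure O); split=> //.
  by exists p; apply: subset_closure; exists [::].
have img i : compact (affine_map Phi i @` closure O).
  apply: continuous_compact => //; apply: continuous_subspaceT.
  exact: affine_map_continuous.
apply/seteqP; split.
  have cl : closed (\bigcup_i (affine_map Phi i @` closure O)).
    apply: closed_bigcup; first exact: finite_finset.
    by move=> i _; exact: compact_closed haus (img i).
  rewrite [X in _ `<=` X](proj1 (closure_id _) cl); apply: closure_subset.
  (* The empty word gives [p], which is its own image under the map [i0]. *)
  move=> _ [[|i w] _ <-] /=.
    exists i0 => //; exists p; last exact: fixptP.
    by apply: subset_closure; exists [::].
  exists i => //; exists (word_map (Phi := Phi) w p) => //.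
  by apply: subset_closure; exists w.
move=> _ [i _ [x Ox <-]]; move=> B nB.
have [_ [[w _ <-] Bw]] := Ox _ (@affine_map_continuous i x _ nB).
by exists (word_map (Phi := Phi) (i :: w) p); split => //; exists (i :: w).
Qed.

Lemma invariant_setP : (0 < kappa)%N -> let E := invariant_set Phi in
  [/\ E !=set0, compact E & E = \bigcup_i (affine_map Phi i @` E)].
Proof. by move=> k0; exact: xgetPex (invariant_set_exists k0). Qed.

End InvariantSet.

Section Projections.
Context {R : realType}.
Implicit Types (x y th : 'cV[R]_2).

Definition between (a b s : R) : bool := Num.min a b <= s <= Num.max a b.

Lemma betweenC a b s : between a b s = between b a s.
Proof. by rewrite /between minC maxC. Qed.

Lemma betweenE a b s : a <= b -> between a b s = (a <= s <= b).
Proof. by move=> ab; rewrite /between (min_idPl ab) (max_idPr ab). Qed.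

Lemma betweenD a b s c : between (a + c) (b + c) (s + c) = between a b s.
Proof. by rewrite /between -addr_minl -addr_maxl !lerD2r. Qed.

Lemma between_l a b : between a b a.
Proof. by rewrite /between ge_min le_max !lexx. Qed.

Lemma between_norm a b s e : between a b s ->
  `|s - e| <= Num.max `|a - e| `|b - e|.
Proof.
rewrite /between => /andP[]; rewrite ge_min => h1; rewrite le_max => h2.
have := (ler_norm (a - e), ler_norm (b - e), ler_norm (- (a - e)), ler_norm (- (b - e))).
rewrite !normrN => -[[[n1 n2] n3] n4].
have h3 : - `|a - e| <= s - e \/ - `|b - e| <= s - e.
  by case/orP: h1 => h; [left|right]; lra.
have h4 : s - e <= `|a - e| \/ s - e <= `|b - e|.
  by case/orP: h2 => h; [left|right]; lra.
have m1 : `|a - e| <= Num.max `|a - e| `|b - e| by rewrite le_max lexx.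
have m2 : `|b - e| <= Num.max `|a - e| `|b - e| by rewrite le_max lexx orbT.
move: m1 m2; move: (Num.max _ _) => m m1 m2; rewrite ler_norml.
by apply/andP; split; [case: h3|case: h4]; lra.
Qed.

(* The intervals are linked into a chain, so that one missing [s] would have its
   whole chain on one side of [s]. *)
Lemma chain_cover n (G : 'I_n -> 'I_n -> Prop) (a b : 'I_n -> R) k0 k1 p q s :
  (forall S : 'I_n -> Prop, S k0 -> (forall k l, G k l -> S k -> S l) -> S k1) ->
  (forall k l, G k l -> exists2 z, between (a k) (b k) z & between (a l) (b l) z) ->
  between (a k0) (b k0) p -> between (a k1) (b k1) q -> between p q s ->
  exists k, between (a k) (b k) s.
Proof.
move=> conn link hp hq hs; apply: contrapT => /forallNP no.
have side k : s < Num.min (a k) (b k) \/ Num.max (a k) (b k) < s.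
  have := no k; move/negP; rewrite /between negb_and -!ltNge.
  by case/orP; [left|right].
have minmax (u v : R) : Num.min u v <= Num.max u v by rewrite ge_min !le_max lexx.
move: hp hq; rewrite /between => /andP[p1 p2] /andP[q1 q2].
have link' k l : G k l -> Num.min (a l) (b l) <= Num.max (a k) (b k) /\
    Num.min (a k) (b k) <= Num.max (a l) (b l).
  by move=> /link[z /andP[h1 h2] /andP[h3 h4]]; split;
    [exact: le_trans h3 h2|exact: le_trans h1 h4].
(* Either [s] is [p] or [q], or it lies between them in one of the two orders, and then [conn]
   carries the side of [s] from [k0] to [k1]. *)
move: hs; rewrite /between ge_min le_max => /andP[/orP[] h1 /orP[] h2].
- have sp : s = p by apply/eqP; rewrite eq_le h1 h2.
  by case: (no k0); rewrite /between sp p1 p2.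
- have : Num.max (a k1) (b k1) < s.
    apply: (conn (fun k => Num.max (a k) (b k) < s)) => [|k l /link'[e _] h].
      by case: (side k0) => // h; have := lt_le_trans h (le_trans p1 h1); rewrite ltxx.
    by case: (side l) => // h'; have := lt_le_trans h' (le_trans e (ltW h)); rewrite ltxx.
  by move=> h; have := le_lt_trans (le_trans h2 q2) h; rewrite ltxx.
- have : s < Num.min (a k1) (b k1).
    apply: (conn (fun k => s < Num.min (a k) (b k))) => [|k l /link'[_ e] h].
      by case: (side k0) => // h; have := le_lt_trans (le_trans h2 p2) h; rewrite ltxx.
    by case: (side l) => // h'; have := lt_le_trans h (le_trans e (ltW h')); rewrite ltxx.
  by move=> h; have := lt_le_trans h (le_trans q1 h1); rewrite ltxx.
- have sq : s = q by apply/eqP; rewrite eq_le h1 h2.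
  by case: (no k1); rewrite /between sq q1 q2.
Qed.

Lemma dotpDr th x y : dotp th (x + y) = dotp th x + dotp th y.
Proof. by rewrite !dotpE !mxE; ring. Qed.

Lemma dotpBr th x y : dotp th (x - y) = dotp th x - dotp th y.
Proof. by rewrite !dotpE !mxE; ring. Qed.

Lemma dotpZr th k x : dotp th (k *: x) = k * dotp th x.
Proof. by rewrite !dotpE !mxE; ring. Qed.

Lemma dotp_mulmx th (M : 'M[R]_2) x : dotp th (M *m x) = dotp (M^T *m th) x.
Proof. by rewrite !dotpE !mulmx2E !mxE; ring. Qed.

Lemma dotp_continuous th : continuous (dotp th).
Proof.
move=> x; have E : dotp th = (fun y : 'cV[R]_2 => th 0 0 * y 0 0 + th 1 0 * y 1 0).
  by apply/funext => y; rewrite dotpE.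
suff h : th 0 0 * y 0 0 + th 1 0 * y 1 0 @[y --> x] --> th 0 0 * x 0 0 + th 1 0 * x 1 0.
  by rewrite /continuous_at dotpE E; exact: h.
exact: (cvgD (FF := nbhs_filter x)
  (cvgM (FF := nbhs_filter x) (cvg_cst _) (@coord_continuous _ _ _ 0 0 x))
  (cvgM (FF := nbhs_filter x) (cvg_cst _) (@coord_continuous _ _ _ 1 0 x))).
Qed.

Lemma compact_projection th (E : set 'cV[R]_2) : compact E -> compact (dotp th @` E).
Proof.
move=> cE; apply: continuous_compact => //; apply: continuous_subspaceT.
exact: dotp_continuous.
Qed.

End Projections.

Section IntervalProjections.
Context {R : realType} {kappa : nat} {Phi : ifs_space R kappa} {lam : R}.
Local Notation A := (lin_part Phi).
Implicit Types (x y th : 'cV[R]_2).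
Hypothesis lam_gt0 : 0 < lam.
Hypothesis lam_lt1 : lam < 1.
Hypothesis contrA : forall i x, enorm (A i *m x) <= lam * enorm x.
Hypothesis Apos : forall i a b, 0 < A i a b.
Context {E : set 'cV[R]_2}.
Hypothesis E_neq0 : E !=set0.
Hypothesis E_compact : compact E.
Hypothesis E_inv : E = \bigcup_i (affine_map Phi i @` E).

Let E_map i x : E x -> E (affine_map Phi i x).
Proof. by move=> Ex; rewrite E_inv; exists i => //; exists x. Qed.

Let nonneg th := forall i, 0 <= th i 0.

Let nonneg_tr th i : nonneg th -> nonneg ((A i)^T *m th).
Proof. by move=> h k; rewrite mulmx2E !mxE addr_ge0// mulr_ge0// ltW. Qed.

Lemma dotp_affine th i x :
  dotp th (affine_map Phi i x) = dotp ((A i)^T *m th) x + dotp th (Phi i).2.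
Proof. by rewrite /affine_map dotpDr -/(lin_part Phi i) dotp_mulmx. Qed.

Context {n : nat} {J : 'I_n -> 'I_kappa} {p q : 'cV[R]_2}.
Hypothesis cover : forall th, nonneg th -> forall s,
  between (dotp th p) (dotp th q) s -> exists k,
  between (dotp th (affine_map Phi (J k) p)) (dotp th (affine_map Phi (J k) q)) s.

(** Covering replaces [th] by [(A (J k))^T *m th], again nonnegative, and the translated [s] is
    again between the projections of [p] and [q]. After [j] rounds a point of [E] projects within
    [C * lam ^+ j * enorm th] of [s], and the projection of [E] is closed. *)
Lemma projection_contains th s : nonneg th ->
  between (dotp th p) (dotp th q) s -> exists2 e, E e & dotp th e = s.
Proof.
have [e0 Ee0] := E_neq0.
pose C := Num.max (enorm (p - e0)) (enorm (q - e0)).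
have C0 : 0 <= C by rewrite le_max enorm_ge0.
have approx j : forall th s, nonneg th -> between (dotp th p) (dotp th q) s ->
    exists2 e, E e & `|s - dotp th e| <= C * lam ^+ j * enorm th.
  elim: j => [|j IH] {}th {}s th0 hs.
    exists e0 => //; apply: le_trans (between_norm (dotp th e0) hs) _.
    rewrite expr0 mulr1 -!dotpBr ge_max; apply/andP; split;
      (apply: le_trans (dotp_le _ _) _; rewrite mulrC ler_wpM2r ?enorm_ge0//).
      by rewrite le_max lexx.
    by rewrite le_max lexx orbT.
  have [k hk] := cover th0 hs.
  rewrite !dotp_affine -[s](subrK (dotp th (Phi (J k)).2)) betweenD in hk.
  have [e Ee he] := IH _ _ (@nonneg_tr _ (J k) th0) hk.
  exists (affine_map Phi (J k) e); first exact: E_map.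
  rewrite dotp_affine.
  rewrite [X in `|X|](_ : _ = s - dotp th (Phi (J k)).2 - dotp ((A (J k))^T *m th) e).
    apply: le_trans he _; rewrite exprSr !mulrA -[leRHS]mulrA.
    apply: ler_wpM2l; first by rewrite mulr_ge0// exprn_ge0// ltW.
    by apply: enorm_trmx_le; first exact: ltW.
  by ring.
move=> th0 hs.
have cl : closed (dotp th @` E).
  by apply: compact_closed; [exact: norm_hausdorff | exact: compact_projection].
have : closure (dotp th @` E) s; last first.
  by rewrite -(proj1 (closure_id _) cl) => -[e Ee <-]; exists e.
move=> B /nbhs_ballP[eps /= eps0 sB].
have D0 : 0 < C * enorm th + 1 by rewrite ltr_wpDl// mulr_ge0 ?enorm_ge0.
have [j hj] := geometric_small (ltW lam_gt0) lam_lt1 (divr_gt0 eps0 D0).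
have [e Ee he] := approx j th s th0 hs.
exists (dotp th e); split; first by exists e.
apply: sB; rewrite /ball /=; apply: le_lt_trans he _.
rewrite ltr_pdivlMr// in hj; apply: le_lt_trans hj.
by rewrite mulrAC mulrDr mulr1 [leLHS]mulrC lerDl exprn_ge0// ltW.
Qed.

Lemma interval_projection_prec : prec p q -> exists2 rho : R, 0 < rho & long_projections E rho.
Proof.
move=> pq; pose rho := Num.min ((q - p) 0 0) ((q - p) 1 0).
have rho0 : 0 < rho by rewrite lt_min !pq.
exists rho => // a b a0 b0; pose th := vec2 a b.
have th0 : nonneg th by apply: ord2P; rewrite ?vec2_0 ?vec2_1.
have thE x : dotp th x = a * x 0 0 + b * x 1 0 by rewrite dotpE vec2_0 vec2_1.
exists (dotp th p) => x hx.
have le1 : dotp th p + rho * (a + b) <= dotp th q.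
  have r0 : rho <= (q - p) 0 0 by rewrite ge_min lexx.
  have r1 : rho <= (q - p) 1 0 by rewrite ge_min lexx orbT.
  have := ler_wpM2l a0 r0; have := ler_wpM2l b0 r1; rewrite !thE !colB; lra.
have [|e Ee eE] := @projection_contains th x th0; last by exists e; rewrite -?thE.
have /andP[h1 h2] := hx; rewrite betweenE.
  by rewrite h1 (le_trans h2 le1).
by apply: le_trans le1; rewrite lerDl mulr_ge0 ?addr_ge0// ltW.
Qed.

Definition cross2 (d d' : 'cV[R]_2) : R := d 0 0 * d' 1 0 - d 1 0 * d' 0 0.

(** Without [prec p q] some positive direction may be orthogonal to [q - p]. It cannot be orthogonal
    to both of two nonparallel pieces: Cramer's rule recovers [a] and [b] from the products with [d]
    and [d'], so one of these is long. *)
Lemma interval_projection_cross k l :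
  cross2 (affine_map Phi (J k) q - affine_map Phi (J k) p)
         (affine_map Phi (J l) q - affine_map Phi (J l) p) != 0 ->
  exists2 rho : R, 0 < rho & long_projections E rho.
Proof.
set d := _ - _; set d' := _ - affine_map Phi (J l) p => cr.
pose K : R := `|d 0 0| + `|d 1 0| + `|d' 0 0| + `|d' 1 0|.
have K0 : 0 <= K by rewrite !addr_ge0.
have K1 : 0 < K + 1 by rewrite ltr_wpDl.
have cr0 : 0 < `|cross2 d d'| by rewrite normr_gt0.
exists (`|cross2 d d'| / (4 * (K + 1))); first by rewrite divr_gt0// mulr_gt0.
set rho := _ / _ => a b a0 b0; pose th := vec2 a b.
have th0 : nonneg th by apply: ord2P; rewrite ?vec2_0 ?vec2_1.
have thE x : dotp th x = a * x 0 0 + b * x 1 0 by rewrite dotpE vec2_0 vec2_1.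
have piece i (x : R) : between (dotp th (affine_map Phi (J i) p))
    (dotp th (affine_map Phi (J i) q)) x -> exists2 e, E e & dotp th e = x.
  rewrite !dotp_affine -[x](subrK (dotp th (Phi (J i)).2)) betweenD => h.
  have [e Ee eE] := projection_contains (@nonneg_tr _ (J i) th0) h.
  exists (affine_map Phi (J i) e); first exact: E_map.
  by rewrite dotp_affine eE.
have long i : rho * (a + b) <=
    `|dotp th (affine_map Phi (J i) q - affine_map Phi (J i) p)| ->
    exists s : R, forall x : R, s <= x <= s + rho * (a + b) ->
    exists2 e, E e & a * e 0 0 + b * e 1 0 = x.
  rewrite dotpBr; set u := dotp th _; set v := dotp th _ => h.
  exists (Num.min v u) => x /andP[h1 h2].
  have [|e Ee eE] := piece i x; last by exists e; rewrite -?thE.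
  rewrite /between -/u -/v h1; apply: le_trans h2 _.
  move: h; case: (leP v u) => vu; first by rewrite ger0_norm ?subr_ge0//; lra.
  by rewrite ltr0_norm ?subr_lt0//; lra.
have key : rho * (a + b) <= `|dotp th d| \/ rho * (a + b) <= `|dotp th d'|.
  have e0 : a * cross2 d d' = dotp th d * d' 1 0 - dotp th d' * d 1 0.
    by rewrite !thE /cross2; ring.
  have e1 : b * cross2 d d' = dotp th d' * d 0 0 - dotp th d * d' 0 0.
    by rewrite !thE /cross2; ring.
  have ab : (a + b) * `|cross2 d d'| <= (`|dotp th d| + `|dotp th d'|) * (2 * (K + 1)).
    rewrite -{1}(ger0_norm a0) -{1}(ger0_norm b0) mulrDl -!normrM e0 e1.
    have t0 := ler_normB (dotp th d * d' 1 0) (dotp th d' * d 1 0).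
    have t1 := ler_normB (dotp th d' * d 0 0) (dotp th d * d' 0 0).
    apply: le_trans (lerD t0 t1) _; rewrite !normrM.
    have := (normr_ge0 (dotp th d), normr_ge0 (dotp th d')).
    have := (normr_ge0 (d 0 0), normr_ge0 (d 1 0), normr_ge0 (d' 0 0), normr_ge0 (d' 1 0)).
    rewrite /K; move: `|d 0 0| `|d 1 0| `|d' 0 0| `|d' 1 0| `|dotp th d| `|dotp th d'|.
    by move=> x0 x1 y0 y1 D D' [[[X0 X1] Y0] Y1] [P P']; nra.
  have rE : rho * (a + b) * (4 * (K + 1)) = (a + b) * `|cross2 d d'|.
    by rewrite /rho; field; rewrite gt_eqF.
  have K4 : 0 < 2 * (K + 1) by rewrite mulr_gt0.
  have : 2 * (rho * (a + b)) <= `|dotp th d| + `|dotp th d'|.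
    by rewrite -(ler_pM2r K4); apply: le_trans ab; rewrite -rE; lra.
  by case: (leP (rho * (a + b)) `|dotp th d|) => h; [left|right; lra].
by case: key => h; exact: long h.
Qed.

End IntervalProjections.

(** * Kakeya type *)

Section KakeyaCone.
Context {R : realType} {kappa : nat} {A : 'I_kappa -> 'M[R]_2}.
Implicit Types (x y th : 'cV[R]_2).
Hypothesis Apos : forall i a b, 0 < A i a b.
Hypothesis sepA : cone_separated A.

Let diag : 'cV[R]_2 := vec2 (Num.sqrt (1 / 2)) (Num.sqrt (1 / 2)).

Let sqrt_half : Num.sqrt (1 / 2 : R) ^+ 2 = 1 / 2.
Proof. by rewrite sqr_sqrtr// divr_ge0. Qed.

Let diag_unit : enorm diag = 1.
Proof.
by rewrite /enorm dotpE vec2_0 vec2_1 -expr2 sqrt_half (_ : 1 / 2 + 1 / 2 = 1) ?sqrtr1//; field.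
Qed.

(** The angle is [acos e], by the half-angle formula. It turns the cone about the diagonal into the
    quadratic inequality of [coneE]. *)
Let exists_angle (e : R) : 0 < e <= 1 / 2 -> exists b : R,
  [/\ 0 < b < pi / 2, 0 <= cos (b / 2) & cos (b / 2) ^+ 2 = (1 + e) / 2].
Proof.
move=> /andP[e0 e2]; exists (acos e).
have e11 : e \in `[-1, 1] by rewrite in_itv /=; lra.
have b0 : 0 < acos e by apply: acos_gt0; lra.
have b1 : acos e < pi / 2.
  have le_pi : acos e <= pi by apply: acos_lepi; lra.
  rewrite ltNge; apply/negP => le.
  have : 0 <= sin (acos e - pi / 2).
    by apply: sin_ge0_pi; have := pi_ge0 R; lra.
  have := cosDpihalf (acos e - pi / 2); rewrite subrK acosK//; lra.
have pi0 := pi_ge0 R.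
split; first by rewrite b0.
  by apply: cos_ge0_pihalf; lra.
have := cos_mulr2n (acos e / 2).
have -> : acos e / 2 *+ 2 = acos e by rewrite -mulr_natr divfK ?pnatr_eq0.
by rewrite acosK// -mulr_natr; lra.
Qed.

Let coneE (e b : R) x : 0 <= cos (b / 2) -> cos (b / 2) ^+ 2 = (1 + e) / 2 ->
  cone diag b x <-> x != 0 /\ e * (x 0 0 ^+ 2 + x 1 0 ^+ 2) < 2 * (x 0 0 * x 1 0).
Proof.
move=> c0 cE; rewrite /cone /=.
have main : x != 0 -> (cos (b / 2) < `|dotp diag x| / enorm x) =
    (e * (x 0 0 ^+ 2 + x 1 0 ^+ 2) < 2 * (x 0 0 * x 1 0)).
  move=> x0; have n0 : 0 < enorm x.
    by rewrite lt_neqAle enorm_ge0 andbT eq_sym; apply: contra x0 => /eqP/enorm_eq0->.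
  rewrite ltr_pdivlMr// -ltr_sqr ?nnegrE ?mulr_ge0 ?enorm_ge0//.
  rewrite exprMn cE enorm_sqr real_normK ?num_real// !dotpE !vec2_0 !vec2_1.
  rewrite -mulrDr exprMn sqrt_half; apply/idP/idP; lra.
by split=> -[x0]; rewrite ?main// -?main.
Qed.

Let same_sign (a b : R) : 0 <= a * b -> exists2 s : R, s = 1 \/ s = -1 &
  a = s * `|a| /\ b = s * `|b|.
Proof.
move=> ab; have [a0|a0|a0] := ltgtP a 0.
- have b0 : b <= 0 by rewrite -(nmulr_rge0 _ a0).
  by exists (-1); [right|rewrite !ler0_norm ?(ltW a0)// !mulN1r !opprK].
- have b0 : 0 <= b by rewrite -(pmulr_rge0 _ a0).
  by exists 1; [left|rewrite !ger0_norm ?(ltW a0)// !mul1r].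
- have [b0|b0] := leP 0 b.
    by exists 1; [left|rewrite a0 normr0 ger0_norm// mulr0 mul1r].
  by exists (-1); [right|rewrite a0 normr0 ltr0_norm// mulr0 mulN1r opprK].
Qed.

Let closed_quadrant e b : 0 <= e -> 0 <= cos (b / 2) -> cos (b / 2) ^+ 2 = (1 + e) / 2 ->
  closure (cone diag b) `<=` [set x | 0 <= x 0 0 * x 1 0].
Proof.
move=> e0 c0 cE.
have cl : closed [set x : 'cV[R]_2 | 0 <= x 0 0 * x 1 0].
  have ct : continuous (fun x : 'cV[R]_2 => x 0 0 * x 1 0).
    by move=> x; exact: (cvgM (FF := nbhs_filter x) (@coord_continuous _ _ _ 0 0 x)
      (@coord_continuous _ _ _ 1 0 x)).
  exact: (closed_comp (fun x _ => ct x) (@closed_ge R 0)).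
rewrite [X in _ `<=` X](proj1 (closure_id _) cl); apply: closure_subset.
move=> x /(coneE _ c0 cE)[_ h] /=.
have : 0 <= e * (x 0 0 ^+ 2 + x 1 0 ^+ 2) by rewrite mulr_ge0// addr_ge0 ?sqr_ge0.
by move: h; lra.
Qed.

(** Up to a common sign both coordinates of the image lie between [m * (a + b)] and [K * (a + b)],
    so neither exceeds [K / m] times the other. *)
Let cone_img (P : 'M[R]_2) (m K : R) x : 0 < m -> (forall i j, m <= P i j <= K) ->
  x != 0 -> 0 <= x 0 0 * x 1 0 -> P *m x != 0 /\
  m / (2 * K) * ((P *m x) 0 0 ^+ 2 + (P *m x) 1 0 ^+ 2) < 2 * ((P *m x) 0 0 * (P *m x) 1 0).
Proof.
move=> m0 hP x0 /same_sign[s ss [h0 h1]].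
have K0 : 0 < K by apply: lt_le_trans m0 _; have /andP[] := hP 0 0; exact: le_trans.
set a := `|x 0 0| in h0; set b := `|x 1 0| in h1.
have a0 : 0 <= a by exact: normr_ge0.
have b0 : 0 <= b by exact: normr_ge0.
have ab : 0 < a + b.
  rewrite lt_neqAle addr_ge0// andbT eq_sym paddr_eq0//.
  apply: contra x0 => /andP[/eqP a00 /eqP b00]; apply/eqP/col2P; rewrite [RHS]mxE.
    by rewrite h0 a00 mulr0.
  by rewrite h1 b00 mulr0.
have E i : (P *m x) i 0 = s * (P i 0 * a + P i 1 * b).
  by rewrite mulmx2E h0 h1; ring.
have lo i : m * (a + b) <= P i 0 * a + P i 1 * b.
  by rewrite mulrDr; apply: lerD; rewrite ler_wpM2r//; have /andP[] := hP i 0; have /andP[] := hP i 1.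
have hi i : P i 0 * a + P i 1 * b <= K * (a + b).
  by rewrite mulrDr; apply: lerD; rewrite ler_wpM2r//; have /andP[] := hP i 0; have /andP[] := hP i 1.
have mab : 0 < m * (a + b) by rewrite mulr_gt0.
have y0 i : 0 < P i 0 * a + P i 1 * b by apply: lt_le_trans (lo i).
have s2 : s * s = 1 by case: ss => ->; rewrite ?mulr1 ?mulrNN ?mulr1.
have s0 : s != 0 by apply/eqP => s00; move: s2; rewrite s00 mul0r; lra.
split.
  apply/eqP => /(congr1 (fun y : 'cV[R]_2 => y 0 0)); rewrite E mxE => /eqP.
  by rewrite mulf_eq0 (negPf s0) gt_eqF.
rewrite !E; have := (lo 0, lo 1, hi 0, hi 1, y0 0, y0 1).
move: (P 0 0 * a + _) (P 1 0 * a + _) => p q [[[[[l0 l1] u0] u1] p0] q0].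
have -> : (s * p) ^+ 2 + (s * q) ^+ 2 = (s * s) * (p ^+ 2 + q ^+ 2) by ring.
have -> : s * p * (s * q) = (s * s) * (p * q) by ring.
rewrite s2 !mul1r mulrAC ltr_pdivrMr ?mulr_gt0//.
have e1 : m * p <= K * q.
  apply: le_trans (_ : K * (m * (a + b)) <= _); last by rewrite ler_wpM2l// ltW.
  by rewrite mulrCA ler_wpM2l// ltW.
have e2 : m * q <= K * p.
  apply: le_trans (_ : K * (m * (a + b)) <= _); last by rewrite ler_wpM2l// ltW.
  by rewrite mulrCA ler_wpM2l// ltW.
have f1 : m * p * p <= K * q * p by rewrite ler_wpM2r// ltW.
have f2 : m * q * q <= K * p * q by rewrite ler_wpM2r// ltW.
have f3 : 0 < K * p * q by rewrite !mulr_gt0.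
by lra.
Qed.

Lemma cone_separated_kakeya : kakeya_cone A.
Proof.
have [|m m0 hm] := @exists_lower_bound R _ (fun t : 'I_kappa * 'I_2 * 'I_2 => A t.1.1 t.1.2 t.2).
  by move=> t; exact: Apos.
pose K := m + \sum_(t : 'I_kappa * 'I_2 * 'I_2) A t.1.1 t.1.2 t.2.
have mK : m <= K by rewrite lerDl sumr_ge0// => t _; rewrite ltW.
have K0 : 0 < K by apply: lt_le_trans mK.
have hA i a b : m <= A i a b <= K.
  rewrite (hm (i, a, b)) /K (bigD1 (i, a, b))//= addrCA lerDl addr_ge0 ?(ltW m0)//.
  by rewrite sumr_ge0// => t _; rewrite ltW.
pose e := m / (2 * K).
have e0 : 0 < e by rewrite divr_gt0// mulr_gt0.
have e2 : e <= 1 / 2 by rewrite /e ler_pdivrMr ?mulr_gt0//; lra.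
have [|b [b01 c0 cE]] := @exists_angle e; first by rewrite e0.
have clq := closed_quadrant (ltW e0) c0 cE.
have img (P : 'M[R]_2) : (forall i j, m <= P i j <= K) ->
    mulmx P @` (closure (cone diag b) `\ 0) `<=` cone diag b.
  move=> hP _ [x [/= /clq /= xq /eqP x0] <-]; apply/(coneE _ c0 cE).
  exact: (cone_img m0 hP).
exists diag, b; split=> //.
- by move=> i; apply: img.
- by move=> i; apply: img => k l; rewrite mxE.
move=> i j neq; apply/seteqP; split.
  move=> _ [[x /clq /= /same_sign[s ss [xs0 xs1]] <-] [x' /clq /= /same_sign[s' ss' [xs0' xs1']] eq_xx']].
  have s2 : s * s = 1 by case: ss => ->; rewrite ?mulr1 ?mulrNN ?mulr1.
  have s2' : s' * s' = 1 by case: ss' => ->; rewrite ?mulr1 ?mulrNN ?mulr1.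
  (* Equal images have zero determinant. Expanded in the absolute values of the coordinates, this is
     a sum of terms of one sign, so each of them vanishes. *)
  have X0 : cross A i j 0 0 * (`|x 0 0| * `|x' 0 0|) + cross A i j 0 1 * (`|x 0 0| * `|x' 1 0|)
    + cross A i j 1 0 * (`|x 1 0| * `|x' 0 0|) + cross A i j 1 1 * (`|x 1 0| * `|x' 1 0|) = 0.
    have h : (A i *m x) 0 0 * (A j *m x') 1 0 - (A i *m x) 1 0 * (A j *m x') 0 0 = 0.
      by rewrite eq_xx'; ring.
    have Ei k : (A i *m x) k 0 = s * (A i k 0 * `|x 0 0| + A i k 1 * `|x 1 0|).
      by rewrite mulmx2E {1}xs0 {1}xs1; ring.
    have Ej k : (A j *m x') k 0 = s' * (A j k 0 * `|x' 0 0| + A j k 1 * `|x' 1 0|).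
      by rewrite mulmx2E {1}xs0' {1}xs1'; ring.
    rewrite !Ei !Ej in h.
    have {}h : (s * s') * ((A i 0 0 * `|x 0 0| + A i 0 1 * `|x 1 0|) *
       (A j 1 0 * `|x' 0 0| + A j 1 1 * `|x' 1 0|) -
       (A i 1 0 * `|x 0 0| + A i 1 1 * `|x 1 0|) *
       (A j 0 0 * `|x' 0 0| + A j 0 1 * `|x' 1 0|)) = 0 by rewrite -[RHS]h; ring.
    rewrite /cross; move/(congr1 ( *%R (s * s'))): h; rewrite mulr0 mulrA.
    by rewrite mulrACA s2 s2' !mul1r => h; rewrite -[RHS]h; ring.
  have p k l : 0 <= `|x k 0| * `|x' l 0| by rewrite mulr_ge0.
  have z k l : `|x k 0| * `|x' l 0| = 0.
    have [pos|neg] := sepA neq.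
      have t a c : 0 <= cross A i j a c * (`|x a 0| * `|x' c 0|) by rewrite mulr_ge0// ltW.
      have : cross A i j k l * (`|x k 0| * `|x' l 0|) <= 0.
        rewrite -X0; have := (t 0 0, t 0 1, t 1 0, t 1 1) => -[[[]]].
        by move: k l; apply: ord2P; apply: ord2P; lra.
      by rewrite pmulr_rle0// => h; apply/eqP; rewrite eq_le h p.
    have t a c : cross A i j a c * (`|x a 0| * `|x' c 0|) <= 0.
      by rewrite mulr_le0_ge0// ltW.
    have : 0 <= cross A i j k l * (`|x k 0| * `|x' l 0|).
      rewrite -X0; have := (t 0 0, t 0 1, t 1 0, t 1 1) => -[[[]]].
      by move: k l; apply: ord2P; apply: ord2P; lra.
    by rewrite nmulr_rge0// => h; apply/eqP; rewrite eq_le h p.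
  have [x0|x0] := eqVneq x 0; first by rewrite x0 mulmx0.
  have [k xk] : exists k, x k 0 != 0.
    apply/existsP; rewrite -[X in is_true X]negbK negb_exists; apply: contra x0 => /forallP h.
    by apply/eqP/col2P; rewrite [RHS]mxE; apply/eqP/negPn/h.
  have x'0 : x' = 0.
    have zl l : x' l 0 = 0.
      by have /eqP := z k l; rewrite mulf_eq0 !normr_eq0 (negPf xk) => /eqP.
    by apply: col2P; rewrite zl mxE.
  by rewrite -eq_xx' x'0 mulmx0.
(* The origin is excluded from the cone but is a limit of points on the diagonal. *)
have cl0 : closure (cone diag b) 0.
  move=> B nB.
  have ct : (fun t : R => vec2 t t : 'cV[R]_2) t @[t --> 0] --> (0 : 'cV[R]_2).
    apply: (cvg_mx (nbhs_filter (0 : R))) => k l; rewrite ord1 mxE.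
    rewrite (_ : (fun t => _) = id); first exact: cvg_id.
    by apply/funext => t; move: k; apply: ord2P; rewrite ?vec2_0 ?vec2_1.
  have /nbhs_ballP[d /= d0 sB] := ct _ nB.
  exists (vec2 (d / 2) (d / 2)); split; last first.
    by apply: sB; rewrite /ball /= sub0r normrN gtr0_norm ?divr_gt0//; lra.
  apply/(coneE _ c0 cE); rewrite vec2_0 vec2_1; split.
    apply/eqP => /(congr1 (fun y : 'cV[R]_2 => y 0 0)); rewrite vec2_0 mxE; lra.
  have : 0 < (d / 2) ^+ 2 by rewrite exprn_gt0// divr_gt0.
  by move: ((d / 2)) => f f0; nra.
by move=> _ ->; split; exists 0 => //; rewrite mulmx0.
Qed.

End KakeyaCone.

Section KakeyaProjections.
Context {R : realType} {kappa : nat} {A : 'I_kappa -> 'M[R]_2}.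
Hypothesis Apos : forall i a b, 0 < A i a b.
Context {E : set 'cV[R]_2} {rho : R}.
Hypothesis E_compact : compact E.
Hypothesis rho_gt0 : 0 < rho.
Hypothesis proj : long_projections E rho.

(** A top eigenvector is nonnegative up to sign, and a unit vector has coordinate sum at least 1 in
    absolute value. For the negative sign the interval is reflected. *)
Lemma interval_kakeya_projections : kakeya_projections A E.
Proof.
exists rho => // w th w0 hth.
have ss : 0 <= th 0 0 * th 1 0.
  by apply: (theta1_same_sign _ hth) => i j; exact: word_mx_gt0.
have th1 : 1 <= `|th 0 0| + `|th 1 0| by rewrite -(proj1 hth) enorm_le_sum.
have meas s : `[s, s + rho]%classic `<=` [set dotp th x | x in E] ->
    (rho%:E <= lebesgue_measure [set dotp th x | x in E])%E.
  move=> sub; have -> : rho%:E = lebesgue_measure `[s, s + rho]%classic.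
    by rewrite lebesgue_segment ?lerDl ?(ltW rho_gt0)// addrAC subrr add0r.
  apply: le_measure => //; rewrite inE; first exact: measurable_itv.
  by have := compact_measurable (@compact_projection _ th _ E_compact).
have [s hs] := proj (normr_ge0 (th 0 0)) (normr_ge0 (th 1 0)).
have long : rho <= rho * (`|th 0 0| + `|th 1 0|) by rewrite ler_peMr// ltW.
have [|] := leP 0 (th 0 0 + th 1 0) => sg.
  have [t0 t1] : 0 <= th 0 0 /\ 0 <= th 1 0 by split; nra.
  apply: (meas s) => x /=; rewrite in_itv /= => /andP[x1 x2].
  have [|e Ee eE] := hs x; first by rewrite x1; lra.
  by exists e => //; rewrite dotpE -eE !ger0_norm.
have [t0 t1] : th 0 0 <= 0 /\ th 1 0 <= 0 by split; nra.
apply: (meas (- (s + rho))) => x /=; rewrite in_itv /= => /andP[x1 x2].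
have [|e Ee eE] := hs (- x); first by apply/andP; split; lra.
exists e => //; rewrite dotpE; move: eE; rewrite !ler0_norm// !mulNr -opprD.
by move/oppr_inj.
Qed.

End KakeyaProjections.

(** * The chain of segments of the subsystem *)

Section Chains.
Context {R : realType} {kappa m : nat} {J : 'I_m.+2 -> 'I_kappa}.
Implicit Types (Psi : ifs_space R kappa) (k l : 'I_m.+2).

(** The point [x_k] of (X2), with the series summed to a fixed point; this form makes sense for
    every nearby system. *)
Definition seg_x Psi k : 'cV[R]_2 := affine_map Psi (J k) (fixpt (Phi := Psi) (J ord0)).
Definition seg_y Psi k : 'cV[R]_2 := affine_map Psi (J k) (fixpt (Phi := Psi) (J ord_max)).

(** The parameters of the intersection of the two lines are [cross2 e d' / D] and [cross2 e d / D]
    with [D = cross2 d d']. That [D] is nonzero and both lie strictly between 0 and 1 is expressed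
    without division, after multiplication by [D ^+ 2]. *)
Definition crossing_at Psi k l : Prop :=
  let d := seg_y Psi k - seg_x Psi k in
  let d' := seg_y Psi l - seg_x Psi l in
  let e := seg_x Psi l - seg_x Psi k in
  [/\ 0 < cross2 d d' ^+ 2,
      0 < cross2 e d' * cross2 d d', cross2 e d' * cross2 d d' < cross2 d d' ^+ 2,
      0 < cross2 e d * cross2 d d' & cross2 e d * cross2 d d' < cross2 d d' ^+ 2].

Definition staircase_at Psi k l : Prop :=
  [/\ prec (seg_x Psi k) (seg_x Psi l), prec (seg_x Psi l) (seg_y Psi k) &
      prec (seg_y Psi k) (seg_y Psi l)].

(** A path from the first to the last index, stated as the induction it supports. *)
Definition connects (G : 'I_m.+2 -> 'I_m.+2 -> Prop) : Prop :=
  forall S : 'I_m.+2 -> Prop, S ord0 -> (forall k l, G k l -> S k -> S l) -> S ord_max.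

Lemma cross2_cramer (d d' e : 'cV[R]_2) : cross2 d d' != 0 ->
  (cross2 e d' * cross2 d d' / cross2 d d' ^+ 2) *: d =
  e + (cross2 e d * cross2 d d' / cross2 d d' ^+ 2) *: d'.
Proof. by move=> D0; apply: col2P; rewrite !mxE; move: D0; rewrite /cross2 => D0; field. Qed.

Lemma crossing_point Psi k l : crossing_at Psi k l -> exists s t : R,
  [/\ 0 <= s <= 1, 0 <= t <= 1 &
  seg_x Psi k + s *: (seg_y Psi k - seg_x Psi k) =
  seg_x Psi l + t *: (seg_y Psi l - seg_x Psi l)].
Proof.
rewrite /crossing_at; set d := seg_y Psi k - _; set d' := seg_y Psi l - _.
set e := seg_x Psi l - _ => -[D0 s0 s1 t0 t1].
set D := cross2 d d' in D0 s0 s1 t0 t1.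
have Dn : D != 0 by apply/eqP => D00; move: D0; rewrite D00 expr0n ltxx.
exists (cross2 e d' * D / D ^+ 2), (cross2 e d * D / D ^+ 2).
have in01 x : 0 < x -> x < D ^+ 2 -> 0 <= x / D ^+ 2 <= 1.
  by move=> x0 x1; rewrite divr_ge0 ?(ltW x0) ?(ltW D0)//= ler_pdivrMr// mul1r ltW.
split; [exact: in01|exact: in01|].
have -> : seg_x Psi l = seg_x Psi k + e by rewrite /e addrCA subrr addr0.
by rewrite /D cross2_cramer// addrA.
Qed.

Lemma between_convex (a b s : R) : 0 <= s <= 1 -> between a b (a + s * (b - a)).
Proof.
move=> /andP[s0 s1]; have [ab|/ltW ab] := leP a b.
  rewrite betweenE//; have := mulr_ge0 s0 (_ : 0 <= b - a); rewrite subr_ge0 => /(_ ab).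
  have : s * (b - a) <= 1 * (b - a) by rewrite ler_wpM2r// subr_ge0.
  by lra.
rewrite betweenC betweenE//; have := mulr_ge0 s0 (_ : 0 <= a - b); rewrite subr_ge0 => /(_ ab).
have : s * (a - b) <= 1 * (a - b) by rewrite ler_wpM2r// subr_ge0.
by lra.
Qed.

Lemma prec_dotp (th x y : 'cV[R]_2) : (forall i, 0 <= th i 0) -> prec x y ->
  dotp th x <= dotp th y.
Proof.
move=> th0 xy; rewrite -subr_ge0 -dotpBr dotpE addr_ge0// mulr_ge0//; exact: ltW.
Qed.

Lemma prec_trans (x y z : 'cV[R]_2) : prec x y -> prec y z -> prec x z.
Proof.
move=> xy yz i; have -> : z - x = (z - y) + (y - x) by rewrite addrA subrK.
by rewrite mxE addr_gt0.
Qed.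

Context {Psi : ifs_space R kappa} {lam : R} {E : set 'cV[R]_2}.
Local Notation A := (lin_part Psi).
Hypothesis lam_gt0 : 0 < lam.
Hypothesis lam_lt1 : lam < 1.
Hypothesis contrA : forall i x, enorm (A i *m x) <= lam * enorm x.
Hypothesis Apos : forall i a b, 0 < A i a b.
Hypothesis E_neq0 : E !=set0.
Hypothesis E_compact : compact E.
Hypothesis E_inv : E = \bigcup_i (affine_map Psi i @` E).

Let seg_x0 : seg_x Psi ord0 = fixpt (Phi := Psi) (J ord0).
Proof. exact: fixptP lam_lt1 contrA _. Qed.

Let seg_ymax : seg_y Psi ord_max = fixpt (Phi := Psi) (J ord_max).
Proof. exact: fixptP lam_lt1 contrA _. Qed.

Let cover (G : 'I_m.+2 -> 'I_m.+2 -> Prop) : connects G ->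
  (forall th : 'cV[R]_2, (forall i, 0 <= th i 0) -> forall k l, G k l -> exists2 z,
     between (dotp th (seg_x Psi k)) (dotp th (seg_y Psi k)) z &
     between (dotp th (seg_x Psi l)) (dotp th (seg_y Psi l)) z) ->
  forall th : 'cV[R]_2, (forall i, 0 <= th i 0) -> forall s,
  between (dotp th (fixpt (Phi := Psi) (J ord0))) (dotp th (fixpt (Phi := Psi) (J ord_max))) s ->
  exists k, between (dotp th (seg_x Psi k)) (dotp th (seg_y Psi k)) s.
Proof.
move=> conn link th th0 s hs; apply: (chain_cover conn (link th th0) _ _ hs).
  by rewrite -seg_x0 between_l.
by rewrite -seg_ymax betweenC between_l.
Qed.

Lemma crossing_projections (G : 'I_m.+2 -> 'I_m.+2 -> Prop) : connects G ->
  (exists k l, G k l) -> (forall k l, G k l -> crossing_at Psi k l) ->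
  exists2 rho : R, 0 < rho & long_projections E rho.
Proof.
move=> conn [k [l kl]] cr.
apply: (interval_projection_cross lam_gt0 lam_lt1 contrA Apos E_neq0 E_compact E_inv
  (J := J) (p := fixpt (Phi := Psi) (J ord0)) (q := fixpt (Phi := Psi) (J ord_max)) _
  (k := k) (l := l)).
  apply: cover conn _ => th th0 i j /cr /crossing_point[s [t [s01 t01 eq_st]]].
  exists (dotp th (seg_x Psi i + s *: (seg_y Psi i - seg_x Psi i))).
    by rewrite dotpDr dotpZr dotpBr between_convex.
  by rewrite eq_st dotpDr dotpZr dotpBr between_convex.
have [D0 _ _ _ _] := cr _ _ kl.
by apply/eqP => D00; move: D0; rewrite /seg_x /seg_y D00 expr0n ltxx.
Qed.

Let conn_succ : connects (fun k l => l = k.+1 :> nat).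
Proof.
move=> S S0 step; have h j (lt : (j < m.+2)%N) : S (Ordinal lt).
  elim: j lt => [|j IH] lt; first by rewrite (_ : Ordinal lt = ord0)//; apply/val_inj.
  exact: (step (Ordinal (ltnW lt)) (Ordinal lt)).
by rewrite (_ : ord_max = Ordinal (ltnSn m.+1))//; apply/val_inj.
Qed.

Lemma staircase_projections : (forall k l, l = k.+1 :> nat -> staircase_at Psi k l) ->
  exists2 rho : R, 0 < rho & long_projections E rho.
Proof.
move=> st; apply: (interval_projection_prec lam_gt0 lam_lt1 contrA Apos E_neq0 E_compact E_inv
  (J := J) (p := fixpt (Phi := Psi) (J ord0)) (q := fixpt (Phi := Psi) (J ord_max))).
  apply: cover conn_succ _ => th th0 k l /st[h1 h2 h3].
  have d1 := prec_dotp th0 h1; have d2 := prec_dotp th0 h2; have d3 := prec_dotp th0 h3.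
  exists (dotp th (seg_x Psi l)); last exact: between_l.
  by rewrite betweenE ?d1// (le_trans d1 d2).
(* The comparison [x_0], [x_1], [y_0] starts the induction, and the [y_k] increase. *)
rewrite -seg_x0 -seg_ymax; apply: (conn_succ (S := fun k => prec (seg_x Psi ord0) (seg_y Psi k))).
  have lt1 : (1 < m.+2)%N by [].
  have [h1 h2 _] := st ord0 (Ordinal lt1) (erefl 1%N).
  exact: prec_trans h1 h2.
by move=> k l /st[_ _ h3] h; exact: prec_trans h h3.
Qed.

End Chains.

Section GoodSystem.
Context {R : realType} {kappa : nat} {Psi : ifs_space R kappa}.
Local Notation A := (lin_part Psi).
Local Notation E := (invariant_set Psi).
Hypothesis kappa_gt0 : (0 < kappa)%N.
Hypothesis Apos : forall i a b, 0 < A i a b.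
Hypothesis sepA : cone_separated A.

Lemma affine_ifs_contr : is_affine_ifs Psi -> exists lam : R,
  [/\ 0 < lam, lam < 1, (forall i, \det (A i) != 0) &
      forall i x, enorm (A i *m x) <= lam * enorm x].
Proof.
(* The maximum makes the ratio positive, so that its logarithm and powers can be used. *)
move=> [abar ab1 h]; exists (Num.max abar (1 / 2)); split.
- by rewrite lt_max divr_gt0 ?orbT.
- by rewrite gt_max ab1 /=; lra.
- by move=> i; have [] := h i; rewrite unitmxE unitfE.
- move=> i x; apply: le_trans (enorm_mulmx_le _ _) _.
  rewrite ler_wpM2r ?enorm_ge0// le_max; have [_ ->] := h i; by [].
Qed.

Lemma compact_coord_bounded (F : set 'cV[R]_2) : compact F ->
  exists2 q : R, 0 < q & forall x i, F x -> `|x i 0| <= q.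
Proof.
move=> cF; have bnd th : exists q : R, forall x, F x -> `|dotp th x| <= q.
  have [M [_ hM]] := compact_bounded (compact_projection (th := th) cF).
  exists (M + 1) => x Fx; apply: hM; first by rewrite ltrDl.
  by exists x.
have [q0 h0] := bnd (vec2 1 0); have [q1 h1] := bnd (vec2 0 1).
exists (`|q0| + `|q1| + 1); first by rewrite ltr_wpDl// addr_ge0.
move=> x i Fx; move: (h0 _ Fx) (h1 _ Fx); rewrite !dotpE !vec2_0 !vec2_1.
rewrite !mul1r !mul0r addr0 add0r.
have := (ler_norm q0, ler_norm q1, normr_ge0 q0, normr_ge0 q1) => -[[[n0 n1] p0] p1].
by move: i; apply: ord2P; lra.
Qed.

(** The bound [B] on the level sums at [t] is part of the conclusion because continuity of [t] is
    derived from it. *)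
Lemma kakeya_and_dimension : is_affine_ifs Psi ->
  (forall lam : R, 0 < lam -> lam < 1 ->
     (forall i x, enorm (A i *m x) <= lam * enorm x) -> E !=set0 -> compact E ->
     E = \bigcup_i (affine_map Psi i @` E) ->
     exists2 rho : R, 0 < rho & long_projections E rho) ->
  kakeya_type Psi /\ exists t B : R, [/\ 1 <= t < 2, is_pressure_zero A t,
    has_minkowski_dim E t & forall n, 1 <= level_sum A t n <= B].
Proof.
move=> aff hproj.
have [lam [lam0 lam1 detA contrA]] := affine_ifs_contr aff.
have [E0 Ec Einv] := invariant_setP lam0 lam1 contrA kappa_gt0.
have [rho rho0 proj] := hproj lam lam0 lam1 contrA E0 Ec Einv.
split.
  split; first exact: cone_separated_kakeya.
  exact: (interval_kakeya_projections Apos Ec rho0 proj).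
have [c c0 bal] := word_balanced Apos.
have [Rad Rad0 Ebd] := compact_coord_bounded Ec.
have contr := wsum_contr lam0 contrA.
have Ewords n x : E x -> exists (w : n.-tuple 'I_kappa) y, E y /\ word_map (Phi := Psi) w y = x.
  elim: n x => [|n IH] x Ex; first by exists [tuple], x.
  move: (Ex); rewrite {1}Einv => -[i _ [x' Ex' <-]].
  by have [w [y [Ey <-]]] := IH x' Ex'; exists [tuple of i :: w], y.
(* The projection to the first axis contains an interval of length [rho], and each piece of level
   [n] contributes at most [4 * Rad * wsum A w]. *)
have S1 n : rho / (4 * Rad) <= level_sum A 1 n.
  have [e0 Ee0] := E0.
  pose y0 (w : n.-tuple 'I_kappa) := (word_map (Phi := Psi) w e0) 0 0.
  have [s hs] := proj 1 0 ler01 (lexx 0); rewrite addr0 mulr1 in hs.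
  have := @segment_cover_le R _ (enum {: n.-tuple 'I_kappa})
    (fun w => y0 w - 2 * Rad * wsum A w) (fun w => y0 w + 2 * Rad * wsum A w) s rho (ltW rho0).
  have N0 w : 0 < 2 * Rad * wsum A w by rewrite !mulr_gt0// wsum_gt0.
  rewrite big_enum /= => h; rewrite ler_pdivrMr ?mulr_gt0//.
  apply: le_trans (h _ _) _.
  - by move=> w; have := N0 w; lra.
  - move=> x /hs[e Ee ee]; have [w [y [Ey yE]]] := Ewords n e Ee.
    exists w; first by rewrite mem_enum.
    have := word_map_horizontal Apos c0 bal Ebd Rad0 w Ey Ee0.
    rewrite yE colB -/(y0 w) -ee mul1r mul0r addr0 ler_norml; lra.
  rewrite mulr_suml; apply: ler_sum => w _; rewrite /wpsi subrr mul0r addr0.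
  by rewrite (_ : 2 - 1 = 1) ?mul1r ?lnK ?posrE ?wsum_gt0//; lra.
have rR : 0 < rho / (4 * Rad) by rewrite divr_gt0// mulr_gt0.
have [t /andP[t1 t2] lb] :=
  exists_pressure_root kappa_gt0 Apos detA c0 bal lam0 lam1 contr sepA rR S1.
exists t, c^-1; split=> //; first by rewrite t1.
  exact: (pressure_zero kappa_gt0 Apos detA lam0 lam1 contr t1 t2 lb).
have [C1 C10 up] := covering_upper Apos detA c0 bal lam0 lam1 contr
  t1 t2 lb Ebd Rad0 E0 Einv.
have [C2 C20 low] := covering_lower Apos detA sepA c0 bal lam0 lam1 contr
  t1 t2 lb Ebd Rad0 E0 Einv rho0 proj.
exact: minkowski_dim_bounds C10 C20 up low.
Qed.

End GoodSystem.

(** * Stability *)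

Section Perturbation.
Context {R : realType} {kappa : nat}.
Implicit Types (A B : 'I_kappa -> 'M[R]_2).

Lemma wsum_perturb A B (q : R) w : 0 < q ->
  (forall i a b, 0 < A i a b) -> (forall i a b, 0 < B i a b) ->
  (forall i a b, B i a b <= q * A i a b) -> wsum B w <= q ^+ size w * wsum A w.
Proof.
move=> q0 A0 B0 AB.
have h a b : word_mx B w a b <= q ^+ size w * word_mx A w a b.
  elim: w a b => [|i w IH] a b; first by rewrite !word_mx_nil expr0 mul1r.
  rewrite !word_mx_cons -!mulmxE !mulmx2E mulrDr exprS.
  have e k : B i a k * word_mx B w k b <= q * q ^+ size w * (A i a k * word_mx A w k b).
    rewrite mulrACA; apply: ler_pM => //; first exact: ltW.
    exact: word_mx_ge0.
  by apply: lerD.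
by rewrite /wsum /mxsum !mulrDr !lerD.
Qed.

Lemma wdet_perturb A B (q : R) w : 0 < q ->
  (forall i, `|\det (B i)| <= q * `|\det (A i)|) -> wdet B w <= q ^+ size w * wdet A w.
Proof.
move=> q0 AB; elim: w => [|i w IH]; first by rewrite !wdet_nil expr0 mul1r.
have wd v : 0 <= wdet B v by exact: normr_ge0.
rewrite -cat1s !wdet_cat exprS mulrACA; apply: ler_pM => //.
by rewrite /wdet !word_mx_cons !word_mx_nil !mulr1.
Qed.

(** The exponents [2 - s] and [s - 1] are nonnegative and add up to 1, so the rate [d] is preserved
    exactly. *)
Lemma level_sum_perturb A B (d s : R) n : 1 <= s <= 2 ->
  (forall i a b, 0 < A i a b) -> (forall i a b, 0 < B i a b) ->
  (forall i, \det (A i) != 0) -> (forall i, \det (B i) != 0) ->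
  (forall i a b, B i a b <= expR d * A i a b) ->
  (forall i, `|\det (B i)| <= expR d * `|\det (A i)|) ->
  level_sum B s n <= expR (n%:R * d) * level_sum A s n.
Proof.
move=> /andP[s1 s2] A0 B0 dA dB AB detAB; rewrite /level_sum mulr_sumr.
apply: ler_sum => w _; rewrite /wpsi -expRD ler_expR.
have q0 : 0 < expR d by exact: expR_gt0.
have qE : expR d ^+ n = expR (n%:R * d) by rewrite -expRM_natl.
have h1 : ln (wsum B w) <= n%:R * d + ln (wsum A w).
  rewrite -[X in X + _]expRK -lnM ?posrE ?expR_gt0 ?wsum_gt0//.
  rewrite ler_ln ?posrE ?mulr_gt0 ?expR_gt0 ?wsum_gt0// -qE.
  by have := wsum_perturb w q0 A0 B0 AB; rewrite size_tuple.
have h2 : ln (wdet B w) <= n%:R * d + ln (wdet A w).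
  rewrite -[X in X + _]expRK -lnM ?posrE ?expR_gt0 ?wdet_gt0//.
  rewrite ler_ln ?posrE ?mulr_gt0 ?expR_gt0 ?wdet_gt0// -qE.
  by have := wdet_perturb w q0 detAB; rewrite size_tuple.
have k1 : (2 - s) * ln (wsum B w) <= (2 - s) * (n%:R * d + ln (wsum A w)).
  by rewrite ler_wpM2l// subr_ge0.
have k2 : (s - 1) * ln (wdet B w) <= (s - 1) * (n%:R * d + ln (wdet A w)).
  by rewrite ler_wpM2l// subr_ge0.
by lra.
Qed.

Lemma archimedean_rate (x K : R) : (forall n : nat, n%:R * x <= K) -> x <= 0.
Proof.
move=> h; rewrite leNgt; apply/negP => x0.
have := h (Num.truncn (K / x)).+1; apply/negP; rewrite -ltNge -ltr_pdivrMr//.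
exact: truncnS_gt.
Qed.

(** Moving the exponent changes level sums at rate at least [|t - t'| * (- ln lam)], passing from
    [A] to [B] at rate at most [d], while the sums at the two roots stay bounded. The bounds [K] and
    [K'] vanish on division by [n], so they may be unrelated. *)
Lemma pressure_root_perturb A B (lam t t' K K' d : R) : 0 < lam ->
  (0 < kappa)%N ->
  (forall w, wsum A w <= 2 * lam ^+ size w) ->
  (forall i a b, 0 < A i a b) -> (forall i a b, 0 < B i a b) ->
  (forall i, \det (A i) != 0) -> (forall i, \det (B i) != 0) ->
  (forall i a b, B i a b <= expR d * A i a b) ->
  (forall i a b, A i a b <= expR d * B i a b) ->
  (forall i, `|\det (B i)| <= expR d * `|\det (A i)|) ->
  (forall i, `|\det (A i)| <= expR d * `|\det (B i)|) ->
  1 <= t < 2 -> 1 <= t' < 2 ->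
  (forall n, 1 <= level_sum A t n <= K) -> (forall n, 1 <= level_sum B t' n <= K') ->
  `|t - t'| * - ln lam <= d.
Proof.
move=> lam0 k0 contr A0 B0 dA dB AB BA detAB detBA /andP[t1 t2] /andP[t1' t2'] SA SB.
have S0 (C : 'I_kappa -> 'M[R]_2) s n : 0 < level_sum C s n by exact: level_sum_gt0.
have lnE n : ln (2 * lam ^+ n) = ln 2 + n%:R * ln lam.
  by rewrite lnM ?posrE ?exprn_gt0// lnXn// -[ln lam *+ _]mulr_natl.
have shift s s' n : s <= s' -> ln (level_sum A s' n) <=
    ln (level_sum A s n) + (s' - s) * (ln 2 + n%:R * ln lam).
  move=> ss; rewrite -lnE -[X in _ <= _ + X]expRK -lnM ?posrE ?expR_gt0//.
  rewrite ler_ln ?posrE ?mulr_gt0 ?expR_gt0//.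
  exact: (level_sum_shift_le A0 dA lam0 contr).
have pert (C C' : 'I_kappa -> 'M[R]_2) s n : 1 <= s <= 2 ->
    (forall i a b, 0 < C i a b) -> (forall i a b, 0 < C' i a b) ->
    (forall i, \det (C i) != 0) -> (forall i, \det (C' i) != 0) ->
    (forall i a b, C' i a b <= expR d * C i a b) ->
    (forall i, `|\det (C' i)| <= expR d * `|\det (C i)|) ->
    ln (level_sum C' s n) <= n%:R * d + ln (level_sum C s n).
  move=> s12 C0 C0' dC dC' CC detCC.
  rewrite -[X in X + _]expRK -lnM ?posrE ?expR_gt0//.
  rewrite ler_ln ?posrE ?mulr_gt0 ?expR_gt0//; exact: level_sum_perturb.
have lnle (C : 'I_kappa -> 'M[R]_2) s n k : 1 <= level_sum C s n <= k ->
    0 <= ln (level_sum C s n) <= ln k.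
  move=> /andP[h1 h2]; rewrite ln_ge0//= ler_ln ?posrE//.
  by apply: lt_le_trans h2; apply: lt_le_trans h1.
rewrite -subr_le0; case: (leP t t') => tt.
  have tt0 : t - t' <= 0 by rewrite subr_le0.
  rewrite (ler0_norm tt0); apply: (@archimedean_rate _ (ln K + (t' - t) * ln 2)) => n.
  have /andP[_ a1] := lnle _ _ _ _ (SA n); have /andP[b0 _] := lnle _ _ _ _ (SB n).
  have s12 : 1 <= t' <= 2 by rewrite t1' ltW.
  have h1 := pert A B t' n s12 A0 B0 dA dB AB detAB; have h2 := shift t t' n tt.
  move: a1 b0 h1 h2; move: (ln (level_sum A t n)) (ln (level_sum B t' n))
    (ln (level_sum A t' n)) (ln K) (ln 2) (ln lam) (n%:R).
  by clear; move=> *; lra.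
have tt0 : 0 < t - t' by rewrite subr_gt0.
rewrite (gtr0_norm tt0); apply: (@archimedean_rate _ (ln K' + (t - t') * ln 2)) => n.
have /andP[a0 _] := lnle _ _ _ _ (SA n); have /andP[_ b1] := lnle _ _ _ _ (SB n).
have s12 : 1 <= t' <= 2 by rewrite t1' ltW.
have h1 := pert B A t' n s12 B0 A0 dB dA BA detBA; have h2 := shift t' t n (ltW tt).
move: a0 b1 h1 h2; move: (ln (level_sum A t n)) (ln (level_sum B t' n))
  (ln (level_sum A t' n)) (ln K') (ln 2) (ln lam) (n%:R).
by clear; move=> *; lra.
Qed.

End Perturbation.

Section Nearby.
Context {R : realType} {kappa : nat} {Phi : ifs_space R kappa}.
Implicit Types (f g : ifs_space R kappa -> R) (x y : ifs_space R kappa -> 'cV[R]_2).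

Let cont f : Prop := f Psi @[Psi --> Phi] --> f Phi.
Let contv x : Prop := forall i, cont (fun Psi => x Psi i 0).

Let nF : Filter (nbhs Phi). Proof. exact: nbhs_filter. Qed.

Let nearS (P Q : set (ifs_space R kappa)) : P `<=` Q ->
  (\forall Psi \near Phi, P Psi) -> \forall Psi \near Phi, Q Psi.
Proof. exact: (@filterS _ _ nF). Qed.

Let nearI (P Q : set (ifs_space R kappa)) : (\forall Psi \near Phi, P Psi) ->
  (\forall Psi \near Phi, Q Psi) -> \forall Psi \near Phi, P Psi /\ Q Psi.
Proof. exact: (@filterI _ _ nF). Qed.

Let near_all (I : finType) (P : I -> set (ifs_space R kappa)) :
  (forall i, \forall Psi \near Phi, P i Psi) -> \forall Psi \near Phi, forall i, P i Psi.
Proof. exact: (@filter_forall _ _ _ _ nF). Qed.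

Lemma near_lt f g : cont f -> cont g -> f Phi < g Phi ->
  \forall Psi \near Phi, f Psi < g Psi.
Proof.
move=> cf cg lt; have h : (g Psi - f Psi) @[Psi --> Phi] --> g Phi - f Phi.
  exact: (cvgB (FF := nF) cg cf).
have lt0 : 0 < g Phi - f Phi by rewrite subr_gt0.
have := cvgr_gt (FF := nF) _ h _ lt0.
by apply: nearS => Psi /=; rewrite subr_gt0.
Qed.

Lemma cont_cst (c : R) : cont (fun=> c). Proof. exact: cvg_cst. Qed.

Arguments cont_cst : clear implicits.

Lemma contD f g : cont f -> cont g -> cont (fun Psi => f Psi + g Psi).
Proof. by move=> cf cg; exact: (cvgD (FF := nF) cf cg). Qed.

Lemma contB f g : cont f -> cont g -> cont (fun Psi => f Psi - g Psi).
Proof. by move=> cf cg; exact: (cvgB (FF := nF) cf cg). Qed.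

Lemma contM f g : cont f -> cont g -> cont (fun Psi => f Psi * g Psi).
Proof. by move=> cf cg; exact: (cvgM (FF := nF) cf cg). Qed.

Lemma contV f : f Phi != 0 -> cont f -> cont (fun Psi => (f Psi)^-1).
Proof. by move=> f0 cf; exact: (cvgV (FF := nF) f0 cf). Qed.

Lemma cont_norm f : cont f -> cont (fun Psi => `|f Psi|).
Proof. by move=> cf; exact: (cvg_norm (FF := nF) cf). Qed.

Let cont_eval i : (fun Psi : ifs_space R kappa => Psi i) Psi @[Psi --> Phi] --> Phi i.
Proof. exact: (@proj_continuous _ (fun=> ('M[R]_2 * 'cV[R]_2)%type) i Phi). Qed.

Lemma cont_lin i a b : cont (fun Psi => lin_part Psi i a b).
Proof.
have h : (fun p : 'M[R]_2 * 'cV[R]_2 => p.1 a b) p @[p --> Phi i] --> (Phi i).1 a b.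
  have c1 : fst p @[p --> Phi i] --> (Phi i).1.
    exact: (@cvg_fst _ _ (nbhs (Phi i).1) (nbhs (Phi i).2) (nbhs_filter _)).
  exact: (cvg_comp _ _ c1 (@coord_continuous _ _ _ a b (Phi i).1)).
exact: (cvg_comp _ _ (@cont_eval i) h).
Qed.

Arguments cont_lin : clear implicits.

Lemma cont_trans i : contv (fun Psi => (Psi i).2).
Proof.
move=> a; have h : (fun p : 'M[R]_2 * 'cV[R]_2 => p.2 a 0) p @[p --> Phi i] --> (Phi i).2 a 0.
  have c2 : snd p @[p --> Phi i] --> (Phi i).2.
    exact: (@cvg_snd _ _ (nbhs (Phi i).1) (nbhs (Phi i).2) (nbhs_filter _)).
  exact: (cvg_comp _ _ c2 (@coord_continuous _ _ _ a 0 (Phi i).2)).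
exact: (cvg_comp _ _ (@cont_eval i) h).
Qed.

Lemma contv_affine i x : contv x -> contv (fun Psi => affine_map Psi i (x Psi)).
Proof.
move=> cx a; rewrite /cont.
have E Psi : affine_map Psi i (x Psi) a 0 = lin_part Psi i a 0 * x Psi 0 0 +
    lin_part Psi i a 1 * x Psi 1 0 + (Psi i).2 a 0.
  by rewrite /affine_map mxE mulmx2E.
under eq_fun do rewrite E.
rewrite E; apply: contD; last exact: cont_trans.
by apply: contD; apply: contM => //; exact: cont_lin.
Qed.

Lemma contv_fixpt i : fix_det (Phi := Phi) i != 0 -> contv (fun Psi => fixpt (Phi := Psi) i).
Proof.
move=> d0.
have cd : cont (fun Psi => (fix_det (Phi := Psi) i)^-1).
  apply: contV => //; apply: contB; last by apply: contM; exact: cont_lin.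
  by apply: contM; apply: contB; [exact: cont_cst|exact: cont_lin|exact: cont_cst|exact: cont_lin].
apply: ord2P; rewrite /cont.
  under eq_fun do rewrite vec2_0; rewrite vec2_0.
  apply: contM => //; apply: contD; apply: contM; [|exact: cont_trans|exact: cont_lin|exact: cont_trans].
  by apply: contB; [exact: cont_cst|exact: cont_lin].
under eq_fun do rewrite vec2_1; rewrite vec2_1.
apply: contM => //; apply: contD; apply: contM; [exact: cont_lin|exact: cont_trans| |exact: cont_trans].
by apply: contB; [exact: cont_cst|exact: cont_lin].
Qed.

Lemma contvB x y : contv x -> contv y -> contv (fun Psi => x Psi - y Psi).
Proof.
move=> cx cy i; rewrite /cont; under eq_fun do rewrite colB; rewrite colB.
exact: contB.
Qed.

Lemma cont_cross2 x y : contv x -> contv y -> cont (fun Psi => cross2 (x Psi) (y Psi)).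
Proof. by move=> cx cy; apply: contB; apply: contM. Qed.

Lemma near_prec x y : contv x -> contv y -> prec (x Phi) (y Phi) ->
  \forall Psi \near Phi, prec (x Psi) (y Psi).
Proof.
move=> cx cy xy; apply: near_all => i.
exact: (near_lt (cont_cst 0) (@contvB _ _ cy cx i) (xy i)).
Qed.

Lemma near_pos : (forall i a b, 0 < lin_part Phi i a b) ->
  \forall Psi \near Phi, forall i a b, 0 < lin_part Psi i a b.
Proof.
move=> pos; apply: near_all => i; apply: near_all => a; apply: near_all => b.
exact: (near_lt (cont_cst 0) (cont_lin i a b) (pos i a b)).
Qed.

Lemma near_separated : cone_separated (lin_part Phi) ->
  \forall Psi \near Phi, cone_separated (lin_part Psi).
Proof.
move=> sep; apply: near_all => i; apply: near_all => j.
have [->|ij] := eqVneq i j; first by apply: (@filterE _ _ nF).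
have cc k l : cont (fun Psi => cross (lin_part Psi) i j k l).
  by apply: contB; apply: contM; exact: cont_lin.
have [pos|neg] := sep i j ij.
  have : \forall Psi \near Phi, forall k l, 0 < cross (lin_part Psi) i j k l.
    apply: near_all => k; apply: near_all => l.
    exact: (near_lt (cont_cst 0) (cc k l) (pos k l)).
  by apply: nearS => Psi h _; left.
have : \forall Psi \near Phi, forall k l, cross (lin_part Psi) i j k l < 0.
  apply: near_all => k; apply: near_all => l.
  exact: (near_lt (cc k l) (cont_cst 0) (neg k l)).
by apply: nearS => Psi h _; right.
Qed.

Lemma near_perturb (d : R) : 0 < d -> (forall i a b, 0 < lin_part Phi i a b) ->
  (forall i, \det (lin_part Phi i) != 0) ->
  \forall Psi \near Phi, forall i,
  [/\ (forall a b, lin_part Psi i a b <= expR d * lin_part Phi i a b),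
      (forall a b, lin_part Phi i a b <= expR d * lin_part Psi i a b),
      `|\det (lin_part Psi i)| <= expR d * `|\det (lin_part Phi i)| &
      `|\det (lin_part Phi i)| <= expR d * `|\det (lin_part Psi i)| ].
Proof.
move=> d0 pos detP; have e1 : 1 < expR d by rewrite -[ltLHS]expR0 ltr_expR.
have big (p : R) : 0 < p -> p < expR d * p by move=> p0; rewrite ltr_pMl.
have dg i : 0 < `|\det (lin_part Phi i)| by rewrite normr_gt0.
have cdet i : cont (fun Psi => `|\det (lin_part Psi i)|).
  apply: cont_norm; rewrite /cont; under eq_fun do rewrite det2E; rewrite det2E.
  by apply: contB; apply: contM; exact: cont_lin.
apply: near_all => i.
have h1 : \forall Psi \near Phi, forall a b, lin_part Psi i a b <= expR d * lin_part Phi i a b.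
  apply: near_all => a; apply: near_all => b.
  apply: nearS (near_lt (cont_lin i a b) (cont_cst _) (big _ (pos i a b))) => Psi.
  exact: ltW.
have h2 : \forall Psi \near Phi, forall a b, lin_part Phi i a b <= expR d * lin_part Psi i a b.
  apply: near_all => a; apply: near_all => b.
  apply: nearS (near_lt (cont_cst _) (contM (cont_cst (expR d)) (cont_lin i a b))
    (big _ (pos i a b))) => Psi.
  exact: ltW.
have h3 := near_lt (cdet i) (cont_cst _) (big _ (dg i)).
have h4 := near_lt (cont_cst _) (contM (cont_cst (expR d)) (cdet i)) (big _ (dg i)).
apply: nearS (nearI h1 (nearI h2 (nearI h3 h4))) => Psi [k1 [k2 [k3 k4]]].
by split=> //; exact: ltW.
Qed.

Context {m : nat} {J : 'I_m.+2 -> 'I_kappa}.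
Hypothesis fixPhi : forall i, fix_det (Phi := Phi) i != 0.

Let cont_x k : contv (fun Psi => seg_x (J := J) Psi k).
Proof. by apply: contv_affine; exact: contv_fixpt. Qed.

Let cont_y k : contv (fun Psi => seg_y (J := J) Psi k).
Proof. by apply: contv_affine; exact: contv_fixpt. Qed.

Arguments cont_x : clear implicits.
Arguments cont_y : clear implicits.

Lemma near_staircase_at k l : staircase_at (J := J) Phi k l ->
  \forall Psi \near Phi, staircase_at (J := J) Psi k l.
Proof.
move=> [h1 h2 h3].
have n1 := near_prec (cont_x k) (cont_x l) h1.
have n2 := near_prec (cont_x l) (cont_y k) h2.
have n3 := near_prec (cont_y k) (cont_y l) h3.
by apply: nearS (nearI n1 (nearI n2 n3)) => Psi [k1 [k2 k3]].
Qed.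

Lemma near_crossing_at k l : crossing_at (J := J) Phi k l ->
  \forall Psi \near Phi, crossing_at (J := J) Psi k l.
Proof.
move=> [h1 h2 h3 h4 h5].
have cd i := contvB (cont_y i) (cont_x i).
have cD := cont_cross2 (cd k) (cd l).
have ce := contvB (cont_x l) (cont_x k).
have ck := contM (cont_cross2 ce (cd k)) cD.
have cl := contM (cont_cross2 ce (cd l)) cD.
have cD2 := contM cD cD.
have n1 := near_lt (cont_cst 0) cD2 h1.
have n2 := near_lt (cont_cst 0) cl h2.
have n3 := near_lt cl cD2 h3.
have n4 := near_lt (cont_cst 0) ck h4.
have n5 := near_lt ck cD2 h5.
by apply: nearS (nearI n1 (nearI n2 (nearI n3 (nearI n4 n5)))) =>
  Psi [k1 [k2 [k3 [k4 k5]]]].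
Qed.

End Nearby.

(** * Turning (X1) and (X2) into strict inequalities *)

Section OriginalSystem.
Context {R : realType}.

(** Since [b = p - M *m p], the series telescopes to [P *m p - P *m (M ^+ n *m p)]. *)
Lemma limn_series_fixpt (M P : 'M[R]_2) (b p : 'cV[R]_2) (lam : R) :
  0 < lam -> lam < 1 -> (forall x, enorm (M *m x) <= lam * enorm x) ->
  M *m p + b = p -> limn (series (fun n => P *m M ^+ n *m b)) = P *m p.
Proof.
move=> lam0 lam1 contrM pE.
have E n : series (fun n => P *m M ^+ n *m b) n = P *m p - P *m (M ^+ n *m p).
  have bE : b = p - M *m p by rewrite -{1}pE addrAC subrr add0r.
  rewrite /series /=; elim: n => [|n IH].
    by rewrite big_nil expr0 mul1mx subrr.
  rewrite big_nat_recr//= IH.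
  have -> : P *m M ^+ n *m b = P *m (M ^+ n *m p) - P *m (M ^+ n.+1 *m p).
    by rewrite -mulmxA {1}bE !mulmxBr exprSr -mulmxE -[M ^+ n *m M *m p]mulmxA.
  by rewrite addrA subrK.
have small n : enorm (M ^+ n *m p) <= lam ^+ n * enorm p.
  elim: n => [|n IH]; first by rewrite !expr0 mul1mx mul1r.
  rewrite !exprS -mulmxE -mulmxA; apply: le_trans (contrM _) _.
  by rewrite -mulrA ler_wpM2l// ltW.
apply/cvg_lim; first exact: norm_hausdorff.
have -> : series (fun n => P *m M ^+ n *m b) = (fun n => P *m p - P *m (M ^+ n *m p)).
  by apply/funext => n; exact: E.
apply: (cvg_mx eventually_filter) => i j; rewrite ord1.
have zero : (P *m (M ^+ n *m p)) i 0 @[n --> \oo] --> (0 : R).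
  pose K := (`|P i 0| + `|P i 1|) * enorm p.
  have bnd n : `|(P *m (M ^+ n *m p)) i 0| <= K * lam ^+ n.
    rewrite mulmx2E; apply: le_trans (ler_normD _ _) _; rewrite !normrM.
    rewrite /K mulrAC -mulrA [_ * enorm p]mulrC mulrDl.
    have h k : `|(M ^+ n *m p) k 0| <= lam ^+ n * enorm p.
      exact: le_trans (coord_le_enorm _ _) (small n).
    by apply: lerD; rewrite ler_wpM2l// mulrC h.
  have K0 : K * lam ^+ n @[n --> \oo] --> (0 : R).
    have h : lam ^+ n @[n --> \oo] --> (0 : R) by apply: cvg_expr; rewrite gtr0_norm.
    by rewrite -(mulr0 K); exact: (cvgM (FF := eventually_filter) (cvg_cst K) h).
  apply/(@cvgrPdist_lt _ _ _ _ eventually_filter) => e e0.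
  move/(@cvgrPdist_lt _ _ _ _ eventually_filter) : K0 => /(_ e e0).
  apply: (@filterS _ _ eventually_filter) => n.
  rewrite !sub0r !normrN; apply: le_lt_trans; apply: le_trans (bnd n) _.
  exact: ler_norm.
have -> : (fun n => (P *m p - P *m (M ^+ n *m p)) i 0) =
    (fun n => (P *m p) i 0 - (P *m (M ^+ n *m p)) i 0).
  by apply/funext => n; rewrite colB.
rewrite -[X in _ --> X]subr0; exact: (cvgB (FF := eventually_filter) (cvg_cst _) zero).
Qed.

(** The open segment is empty when [x = y], hence the first conjunct. *)
Lemma open_segmentP (x y p : 'cV[R]_2) : open_segment x y p <->
  x != y /\ exists2 s : R, 0 < s < 1 & p = x + s *: (y - x).
Proof.
have E (l : R) : l *: x + (1 - l) *: y = x + (1 - l) *: (y - x).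
  by apply: col2P; rewrite !mxE; ring.
split.
  move=> [[l /= l01 <-] /= ne]; have /andP[l0 l1] : 0 <= l <= 1 by move: l01; rewrite in_itv.
  have xy : x != y.
    apply/eqP => xy; apply: ne; left; rewrite -xy -scalerDl.
    by rewrite addrCA subrr addr0 scale1r.
  split=> //; exists (1 - l); last exact: E.
  rewrite subr_gt0 ltrBlDr -{2}[1]addr0 ltrD2l !lt_neqAle l0 l1 !andbT.
  apply/andP; split; apply/eqP => le; apply: ne.
    by left; rewrite le scale1r subrr scale0r addr0.
  by right; rewrite -le scale0r subr0 scale1r add0r.
move=> [xy [s /andP[s0 s1] ->]]; split.
  exists (1 - s); first by rewrite /= in_itv/=; lra.
  by rewrite E; congr (_ + _ *: _); ring.
have d0 : y - x != 0 by rewrite subr_eq0 eq_sym.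
move=> [] /= h.
  have : s *: (y - x) = 0 by apply: (@addrI _ x); rewrite h addr0.
  by move/eqP; rewrite scaler_eq0 (negPf d0) orbF gt_eqF.
have : (1 - s) *: (y - x) = 0.
  have -> : (1 - s) *: (y - x) = y - (x + s *: (y - x)).
    by apply: col2P; rewrite !mxE; ring.
  by rewrite h subrr.
by move/eqP; rewrite scaler_eq0 (negPf d0) orbF subr_eq0 eq_sym lt_eqF.
Qed.

Lemma cross2_parallel (d d' : 'cV[R]_2) : d != 0 -> cross2 d d' = 0 ->
  exists c : R, d' = c *: d.
Proof.
rewrite /cross2 => d0 /eqP; rewrite subr_eq0 => /eqP h.
have [d00|d00] := eqVneq (d 0 0) 0.
  have d10 : d 1 0 != 0.
    by apply: contra d0 => /eqP d10; apply/eqP/col2P; rewrite mxE.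
  exists (d' 1 0 / d 1 0); apply: col2P; rewrite !mxE; last by rewrite divfK.
  rewrite d00 mulr0; apply/eqP; move/eqP: h.
  by rewrite d00 mul0r eq_sym mulf_eq0 (negPf d10).
exists (d' 0 0 / d 0 0); apply: col2P; rewrite !mxE; first by rewrite divfK.
by rewrite mulrAC [d' 0 0 * _]mulrC -h mulrAC divff// mul1r.
Qed.

Lemma cross2_lin (d d' e : 'cV[R]_2) (s t : R) :
  cross2 (s *: d - t *: d') e = s * cross2 d e - t * cross2 d' e.
Proof. by rewrite /cross2 !mxE; ring. Qed.

(* Parallel open segments that meet share infinitely many points. *)
Lemma single_point_crossing (x y x' y' p : 'cV[R]_2) :
  open_segment x y `&` open_segment x' y' = [set p] ->
  let D := cross2 (y - x) (y' - x') in
  [/\ 0 < D ^+ 2,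
      0 < cross2 (x' - x) (y' - x') * D, cross2 (x' - x) (y' - x') * D < D ^+ 2,
      0 < cross2 (x' - x) (y - x) * D & cross2 (x' - x) (y - x) * D < D ^+ 2].
Proof.
move=> one D.
have [/open_segmentP[xy [s /andP[s0 s1] ps]] /open_segmentP[xy' [t /andP[t0 t1] pt]]] :
  (open_segment x y `&` open_segment x' y') p by rewrite one.
have d0 : y - x != 0 by rewrite subr_eq0 eq_sym.
have d'0 : y' - x' != 0 by rewrite subr_eq0 eq_sym.
have Dn : D != 0.
  apply/eqP => /(cross2_parallel d0)[c cE].
  have c0 : c != 0 by apply: contra d'0 => /eqP c0; rewrite cE c0 scale0r.
  have c0' : 0 < `|c| by rewrite normr_gt0.
  (* Moving [p] by [e] times the direction shifts the parameters by [e] and [e / c]; both remain in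
     the open interval, giving a second common point. *)
  pose e := Num.min ((1 - s) / 2) (`|c| * (Num.min t (1 - t) / 2)).
  have e0 : 0 < e.
    by rewrite lt_min divr_gt0 ?subr_gt0//= mulr_gt0// divr_gt0// lt_min t0 subr_gt0.
  have es : e <= (1 - s) / 2 by rewrite ge_min lexx.
  have et : `|e / c| <= Num.min t (1 - t) / 2.
    by rewrite normrM normfV (gtr0_norm e0) ler_pdivrMr// mulrC ge_min lexx orbT.
  have [m1 m2] : Num.min t (1 - t) <= t /\ Num.min t (1 - t) <= 1 - t.
    by split; rewrite ge_min lexx ?orbT.
  have : (open_segment x y `&` open_segment x' y') (p + e *: (y - x)).
    split; apply/open_segmentP; split=> //.
      by exists (s + e); [apply/andP; split; lra|rewrite ps -addrA -scalerDl].
    exists (t + e / c).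
      by move: et; rewrite ler_norml => /andP[h1 h2]; apply/andP; split; lra.
    rewrite {1}pt -addrA; congr (_ + _); rewrite scalerDl; congr (_ + _).
    by rewrite cE scalerA divfK.
  rewrite one /= => /eqP; rewrite -subr_eq0 addrAC subrr add0r scaler_eq0 (negPf d0) orbF.
  by rewrite gt_eqF.
have D2 : 0 < D ^+ 2 by rewrite exprn_even_gt0.
have eE : x' - x = s *: (y - x) - t *: (y' - x').
  apply: (@addrI _ (x + t *: (y' - x'))).
  rewrite [LHS]addrC [LHS]addrA subrK [RHS]addrA [RHS]addrAC addrK.
  by rewrite -pt ps.
have e1 : cross2 (x' - x) (y' - x') = s * D.
  by rewrite eE cross2_lin /D /cross2; ring.
have e2 : cross2 (x' - x) (y - x) = t * D.
  by rewrite eE cross2_lin /D /cross2; ring.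
have lt1 k : k < 1 -> k * D * D < D ^+ 2.
  by move=> k1; rewrite -mulrA -expr2 -[ltRHS]mul1r ltr_pM2r.
have gt0 k : 0 < k -> 0 < k * D * D by move=> k0; rewrite -mulrA -expr2 mulr_gt0.
by rewrite e1 e2; split=> //; [exact: gt0|exact: lt1|exact: gt0|exact: lt1].
Qed.

(** A nonzero entry of a power of [M] is realized by a path along nonzero entries. *)
Lemma irreducible_connects m (M : 'M[R]_m.+2) : irreducible_mx M ->
  connects (fun k l => M k l != 0) /\ exists k l, M k l != 0.
Proof.
move=> [_ irr]; have step n k l : (M ^+ n.+1) k l != 0 ->
    exists2 j, (M ^+ n) k j != 0 & M j l != 0.
  rewrite exprSr -mulmxE mxE => h.
  have [j] : exists j, (M ^+ n) k j * M j l != 0.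
    apply: contrapT => /forallNP no; move/negP: h; apply.
    by apply/eqP; rewrite big1// => j _; apply/eqP/negPn/negP; exact: no.
  by rewrite mulf_eq0 negb_or => /andP[]; exists j.
split.
  move=> S S0 closed; have [n _ pos] := irr ord0 ord_max.
  have reach j k l : (M ^+ j) k l != 0 -> S k -> S l.
    elim: j l => [|j IH] l; first by rewrite expr0 mxE; case: (k =P l) => [->//|_]; rewrite eqxx.
    by move/step => [i ki il] Sk; apply: closed il _; exact: IH ki Sk.
  by apply: (reach n ord0 ord_max _ S0); rewrite gt_eqF.
(* The exponent is positive, so the closed path has a last edge. *)
have [[//|n] _ pos] := irr ord0 ord0.
by have [|j _ h] := step n ord0 ord0; [rewrite gt_eqF|exists j, ord0].
Qed.

(** The sign of [cross] is that of a difference of column slopes, and the intervals of (X1) are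
    spanned by these slopes. Two disjoint closed intervals are strictly ordered, since otherwise the
    larger left end would be common. *)
Lemma separated_intervals kappa (A : 'I_kappa -> 'M[R]_2) (u v w z : 'I_kappa -> R) :
  (forall i, [/\ 0 < u i, 0 < v i, 0 < w i & 0 < z i]) ->
  (forall i, A i = mx22 (u i) (v i) (w i) (z i)) ->
  (forall i j, i != j ->
     interval_between (w i / u i) (z i / v i) `&`
     interval_between (w j / u j) (z j / v j) = set0) ->
  (forall i a b, 0 < A i a b) /\ cone_separated A.
Proof.
move=> hpos hA X1.
have E00 i : A i 0 0 = u i by rewrite hA mxE.
have E01 i : A i 0 1 = v i by rewrite hA mxE.
have E10 i : A i 1 0 = w i by rewrite hA mxE.
have E11 i : A i 1 1 = z i by rewrite hA mxE.
have pos i a b : 0 < A i a b.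
  have [u0 v0 w0 z0] := hpos i.
  by move: a b; apply: ord2P; apply: ord2P; rewrite ?E00 ?E01 ?E10 ?E11.
split=> // i j ij.
pose sl i k := A i 1 k / A i 0 k.
have crossE k l : cross A i j k l = A i 0 k * A j 0 l * (sl j l - sl i k).
  rewrite /cross /sl; have := pos i 0 k; have := pos j 0 l => p1 p2.
  by field; rewrite !gt_eqF.
have := X1 i j ij; rewrite -!E00 -!E01 -!E10 -!E11 -/(sl i 0) -/(sl i 1) -/(sl j 0) -/(sl j 1).
rewrite /interval_between; set mi := Num.min (sl i 0) _; set Mi := Num.max (sl i 0) _.
set mj := Num.min (sl j 0) _; set Mj := Num.max (sl j 0) _ => dis.
have bi k : mi <= sl i k <= Mi.
  by move: k; apply: ord2P; rewrite /mi /Mi ge_min le_max lexx ?orbT.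
have bj k : mj <= sl j k <= Mj.
  by move: k; apply: ord2P; rewrite /mj /Mj ge_min le_max lexx ?orbT.
have [lt|le1] := ltP Mi mj.
  left=> k l; rewrite crossE !mulr_gt0// subr_gt0.
  have /andP[_ h1] := bi k; have /andP[h2 _] := bj l.
  exact: le_lt_trans h1 (lt_le_trans lt h2).
have [lt|le2] := ltP Mj mi.
  right=> k l; rewrite crossE pmulr_rlt0 ?mulr_gt0// subr_lt0.
  have /andP[h1 _] := bi k; have /andP[_ h2] := bj l.
  exact: le_lt_trans h2 (lt_le_trans lt h1).
have : (`[mi, Mi]%classic `&` `[mj, Mj]%classic) (Num.max mi mj).
  have miM : mi <= Mi by have /andP[h1 h2] := bi 0; exact: le_trans h1 h2.
  have mjM : mj <= Mj by have /andP[h1 h2] := bj 0; exact: le_trans h1 h2.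
  by split; rewrite /= in_itv /= le_max lexx ?orbT /= ge_max ?miM ?mjM ?le1 ?le2.
by rewrite dis.
Qed.

End OriginalSystem.

Theorem theorem6p1 (R : realType) (kappa : nat) (abar : R)
    (A : 'I_kappa -> 'M[R]_2) (a : 'I_kappa -> 'cV[R]_2)
    (u v w z : 'I_kappa -> R)
    (hkappa : (2 <= kappa)%N)
    (habar : abar < 1)
    (hinv : forall i, A i \in unitmx)
    (hnorm : forall i, opnorm (A i) <= abar)
    (hpos : forall i, [/\ 0 < u i, 0 < v i, 0 < w i & 0 < z i])
    (hA : forall i, A i = mx22 (u i) (v i) (w i) (z i))
    (X1 : forall i j, i != j ->
       interval_between (w i / u i) (z i / v i) `&`
       interval_between (w j / u j) (z j / v j) = set0)
    (X2 : exists (m : nat) (J : 'I_m.+2 -> 'I_kappa),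
       {homo J : k l / (k < l)%N} /\
       (irreducible_mx (crossing_mx (A \o J) (a \o J)) \/
        staircase (A \o J) (a \o J))) :
  exists2 U : set (ifs_space R kappa),
    nbhs ((fun i => (A i, a i)) : ifs_space R kappa) U &
    [/\ (forall Psi, U Psi -> is_affine_ifs Psi -> kakeya_type Psi),
        (forall Psi, U Psi -> is_affine_ifs Psi ->
           exists2 t : R, is_pressure_zero (lin_part Psi) t &
             has_minkowski_dim (invariant_set Psi) t) &
        {within [set Psi | U Psi /\ is_affine_ifs Psi],
          continuous (fun Psi : ifs_space R kappa =>
                        minkowski_dim (invariant_set Psi))}].
Proof.
have k0 : (0 < kappa)%N by exact: leq_trans hkappa.
have [pos sep] := separated_intervals hpos hA X1.
set Phi : ifs_space R kappa := (fun i => (A i, a i)).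
have aff : is_affine_ifs Phi by exists abar.
have [lam [lam0 lam1 _ contrA]] := affine_ifs_contr aff.
have fix0 i := @fix_det_neq0 _ _ Phi lam lam1 contrA i.
have [m [J [_ hJ]]] := X2.
have ptE (i : 'I_kappa) k : a (J k) + limn (series (fun n => A (J k) *m A i ^+ n *m a i)) =
    affine_map Phi (J k) (fixpt (Phi := Phi) i).
  rewrite (limn_series_fixpt (A (J k)) lam0 lam1 (contrA i) (fixptP lam1 contrA i)).
  by rewrite addrC.
have xE k : pt_x (A \o J) (a \o J) k = seg_x (J := J) Phi k by exact: ptE.
have yE k : pt_y (A \o J) (a \o J) k = seg_y (J := J) Phi k by exact: ptE.
(* [chain] collects the strict inequalities read off from (X2) at [Phi]. In case (a) the graph of
   [Phi] is kept fixed, and nearby systems have at least its crossings. *)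
have [chain nchain proj] : exists2 chain : set (ifs_space R kappa), nbhs Phi chain &
    forall Psi, chain Psi -> (forall i c d, 0 < lin_part Psi i c d) ->
    forall l : R, 0 < l -> l < 1 ->
     (forall i x, enorm (lin_part Psi i *m x) <= l * enorm x) ->
     invariant_set Psi !=set0 -> compact (invariant_set Psi) ->
     invariant_set Psi = \bigcup_i (affine_map Psi i @` invariant_set Psi) ->
     exists2 rho : R, 0 < rho & long_projections (invariant_set Psi) rho.
  case: hJ => [irr|st].
    have [conn [k [l kl]]] := irreducible_connects irr.
    exists [set Psi | forall k l, crossing_mx (A \o J) (a \o J) k l != 0 ->
      crossing_at (J := J) Psi k l].
      apply: (@filter_forall _ _ _ _ (nbhs_filter Phi)) => i.
      apply: (@filter_forall _ _ _ _ (nbhs_filter Phi)) => j.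
      have [_|ij] := eqVneq (crossing_mx (A \o J) (a \o J) i j) 0.
        by apply: (@filterE _ _ (nbhs_filter Phi)).
      have cr : crossing_at (J := J) Phi i j.
        move: ij; rewrite mxE pnatr_eq0 eqb0 negbK => /asboolP[p].
        by rewrite !xE !yE; exact: single_point_crossing.
      by apply: (@filterS _ _ (nbhs_filter Phi)) (near_crossing_at fix0 cr) => Psi.
    move=> Psi hPsi pP l' l0 l1 cP E0 Ec Ei.
    by apply: (crossing_projections l0 l1 cP pP E0 Ec Ei conn) hPsi; exists k, l.
  exists [set Psi | forall k l : 'I_m.+2, l = k.+1 :> nat -> staircase_at (J := J) Psi k l].
    apply: (@filter_forall _ _ _ _ (nbhs_filter Phi)) => i.
    apply: (@filter_forall _ _ _ _ (nbhs_filter Phi)) => j.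
    have [ij|ij] := eqVneq (val j) i.+1.
      have h : staircase_at (J := J) Phi i j.
        by have := st i j ij; rewrite !xE !yE.
      by apply: (@filterS _ _ (nbhs_filter Phi)) (near_staircase_at fix0 h) => Psi.
    by apply: (@filterE _ _ (nbhs_filter Phi)) => Psi /eqP; rewrite (negPf ij).
  move=> Psi hPsi pP l' l0 l1 cP E0 Ec Ei.
  exact: (staircase_projections l0 l1 cP pP E0 Ec Ei hPsi).
pose U : set (ifs_space R kappa) := [set Psi | (forall i c d, 0 < lin_part Psi i c d) /\
  (cone_separated (lin_part Psi) /\ chain Psi)].
have good Psi : U Psi -> is_affine_ifs Psi -> kakeya_type Psi /\ exists t B : R,
    [/\ 1 <= t < 2, is_pressure_zero (lin_part Psi) t,
    has_minkowski_dim (invariant_set Psi) t &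
    forall n, 1 <= level_sum (lin_part Psi) t n <= B].
  move=> [pP [sP cP]] aP.
  exact: (kakeya_and_dimension k0 pP sP aP (proj Psi cP pP)).
have dimE (Psi : ifs_space R kappa) (t : R) : has_minkowski_dim (invariant_set Psi) t ->
    minkowski_dim (invariant_set Psi) = t.
  by move=> h; apply/cvg_lim => //; exact: Rhausdorff.
exists U.
  apply: (@filterI _ _ (nbhs_filter Phi)); first exact: (@near_pos R kappa Phi pos).
  apply: (@filterI _ _ (nbhs_filter Phi)) => //; exact: (@near_separated R kappa Phi sep).
split.
- by move=> Psi UP aP; have [] := good Psi UP aP.
- by move=> Psi UP aP; have [_ [t [B [_ pz md _]]]] := good Psi UP aP; exists t.
apply/subspace_continuousP => Psi [UP aP].
have [_ [t [B [t12 _ md SB]]]] := good Psi UP aP.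
have [l [l0 l1 dP cP]] := affine_ifs_contr aP.
have lnl : 0 < - ln l by rewrite oppr_gt0 ln_lt0// l0.
have [pP _] := UP.
apply/(@cvgrPdist_le _ _ _ _ (within_filter _ (nbhs_filter Psi))) => e e0.
(* With rate [e * - ln l], [l] being the contraction ratio of [Psi], the comparison of the roots
   gives [|t - t'| <= e]. *)
have near := near_perturb (mulr_gt0 e0 lnl) pP dP.
apply: (@filterS _ _ (nbhs_filter Psi)) near => Psi' hP [UP' aP'].
have [_ [t' [B' [t12' _ md' SB']]]] := good Psi' UP' aP'.
have [_ [_ _ dP' _]] := affine_ifs_contr aP'.
rewrite /from_subspace (dimE _ _ md) (dimE _ _ md') -(ler_pM2r lnl).
have [pP' _] := UP'.
apply: (pressure_root_perturb (A := lin_part Psi) (B := lin_part Psi') l0 k0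
  (wsum_contr l0 cP) pP pP' dP dP' _ _ _ _ t12 t12' SB SB') => i; by have [] := hP i.
Qed.
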